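(* Suppose that $\{X^x_t\}_{t\ge0}$ and its numerical discretization $\{Y^{x^h,\Delta}_{t_k}\}_{k\in\mathbb N}$ satisfy conditions (A1), (A2) and (A3) of the context. Let $\gamma\in[\gamma_1\vee\gamma_2,1]$, let $k:=\lceil\tau^{-1-2\lambda}\rceil$ with $\lambda\in(0,\alpha_2\gamma)$, and let $h:=\tau^{\alpha_2/\alpha_1}$ when $h\ne0$. Let $p\ge1$ satisfy $$\tilde q^2\Big(3\vee\big(\tfrac1\lambda+1\big)\Big)\Big(p(\tilde q\vee\tilde r)+\big(3+4(\kappa\vee\beta)\big)\gamma\Big)\le q\wedge r,$$ and suppose that, for $0<\varepsilon\ll\lambda$ with $\sqrt\varepsilon-\frac{\varepsilon}{\lambda}-\frac{\varepsilon\sqrt\varepsilon}{\lambda}>0$, $$\lim_{\varepsilon\to0}\lim_{\tau\to0}\tau^{\varepsilon}\sum_{i=\lceil\tau^{-1-\varepsilon/4}\rceil}^{k}\big(\rho^\Delta(t_i)\big)^\gamma=0.$$ Then for any $f\in\mathcal C_{p,\gamma}(E;\mathbb R)$ and any $x\in E$, $$\frac1{\sqrt{k\tau}}\sum_{i=0}^{k-1}\big(f(Y^{x^h,\Delta}_{t_i})-\mu(f)\big)\tau\ \longrightarrow\ \mathscr N(0,v^2)\quad\text{in distribution as }\tau\to0,$$ where $\mu$ is the unique invariant measure of $\{X^x_t\}_{t\ge 0}$ and $v^2:=2\mu\big((f-\mu(f))\int_0^\infty(P_tf-\mu(f))\,\mathrm dt\big)$.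
   Context: Spaces. $(E,\|\cdot\|)$ is a real separable Banach space with Borel $\sigma$-algebra $\mathfrak B(E)$; $\nu(f):=\int_E f\,\mathrm d\nu$ for a probability measure $\nu$. For $p\ge1$, $\gamma\in(0,1]$, let $d_{p,\gamma}(u_1,u_2):=(1\wedge\|u_1-u_2\|^{\gamma})(1+\|u_1\|^p+\|u_2\|^p)^{1/2}$, and let $\mathcal C_{p,\gamma}=\mathcal C_{p,\gamma}(E;\mathbb R)$ be the set of continuous $f:E\to\mathbb R$ with finite norm $$\|f\|_{p,\gamma}:=\sup_{u\in E}\frac{|f(u)|}{1+\|u\|^{p/2}}+\sup_{u_1\ne u_2}\frac{|f(u_1)-f(u_2)|}{d_{p,\gamma}(u_1,u_2)}.$$ Processes. On a filtered probability space $(\Omega,\mathcal F,\{\mathcal F_t\}_{t\ge0},\mathbb P)$, $\{X^x_t\}_{t\ge0}$, $x\in E$, is a family of $E$-valued time-homogeneous Markov processes with $X^x_0=x$ deterministic; $P_tf(x):=\mathbb E[f(X^x_t)]$. The step-size is $\Delta=(h,\tau)^\top\in[0,1]\times(0,1]$ ($h$ spatial, $\tau$ temporal; $h=0$ when only time is discretized), and $t_k:=k\tau$. $E^h\subset E$ is the state space of the discretization, with the norm of $E$; $E^0:=E$; for $h\neq0$ (full discretization) $E^h$ is finite dimensional. $\{Y^{x^h,\Delta}_{t_k}\}_{k\in\mathbb N}$ is the $E^h$-valued discretization of $\{X^x_t\}$ with $Y^{x^h,\Delta}_0=x^h\in E^h$, where $x^h$ is the approximation of $x$ in $E^h$ ($x^h=x$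 if $x\in E^h$); set $Y^{x^h,\Delta}_t:=Y^{x^h,\Delta}_{t_k}$ for $t\in[t_k,t_{k+1})$. (A1) (i) There are $r\ge2$, $\tilde r\ge1$, $L_1>0$ with $\sup_{t\ge0}\mathbb E[\|X^x_t\|^r]\le L_1(1+\|x\|^{\tilde r r})$ for all $x\in E$. (ii) There are $\gamma_1\in(0,1]$, $\beta\in[0,r-1]$, $L_2>0$ and a continuous $\rho:[0,\infty)\to[0,\infty)$ with $\int_0^\infty\rho^{\gamma_1}(t)\,\mathrm dt<\infty$ such that $(\mathbb E[\|X^x_t-X^y_t\|^2])^{1/2}\le L_2\|x-y\|(1+\|x\|^\beta+\|y\|^\beta)\rho(t)$ for all $x,y\in E$, $t\ge 0$. (Under (A1), $\{X^x_t\}$ has a unique invariant measure $\mu$.) (A2) There is $\tilde\Delta=(\tilde h,\tilde\tau)^\top\in[0,1]\times(0,1]$ such that for all $h\in[0,\tilde h]$, $\tau\in(0,\tilde\tau]$, $x^h\in E^h$, the sequence $\{Y^{x^h,\Delta}_{t_k}\}_{k\in\mathbb N}$ is time-homogeneous Markov and: (i) $\sup_{k\ge0}\mathbb E[\|Y^{x^h,\Delta}_{t_k}\|^q]\le L_3(1+\|x^h\|^{\tilde q q})$ for constants $q\ge2$, $\tilde q\ge1$, $L_3>0$; (ii) there are $\gamma_2\in(0,1]$, $\kappa\in[0,q-1]$, $L_4>0$ and $\rho^\Delta:[0,\infty)\to[0,\infty)$ with $\sup_{h\in[0,\tilde h],\tau\in(0,\tilde\tau]}\tau\sum_{k=0}^\infty(\rho^\Delta(t_k))^{\gamma_2}<\infty$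 such that $(\mathbb E[\|Y^{x^h,\Delta}_{t_k}-Y^{y^h,\Delta}_{t_k}\|^2])^{1/2}\le L_4\|x^h-y^h\|(1+\|x^h\|^\kappa+\|y^h\|^\kappa)\rho^\Delta(t_k)$ for all $x^h,y^h\in E^h$, $k\in\mathbb N$. The constants $q,\tilde q,L_3,\gamma_2,\kappa,L_4$ do not depend on $\Delta$. (A3) There are $\alpha=(\alpha_1,\alpha_2)^\top$ with $\alpha_1,\alpha_2>0$ and $L_5>0$ such that for all $x\in E$, $\sup_{t\ge0}(\mathbb E[\|X^x_t-Y^{x^h,\Delta}_t\|^2])^{1/2}\le L_5(1+\|x\|^{\tilde r\vee\tilde q})|\Delta^\alpha|$, where $|\Delta^\alpha|:=h^{\alpha_1}+\tau^{\alpha_2}$. Throughout, $h\in[0,\tilde h]$, $\tau\in(0,\tilde\tau]$, and $r$, $q$ are assumed as large as needed. $a\vee b$ and $a\wedge b$ denote maximum and minimum; $\mathscr N(0,v^2)$ is the centered Gaussian law with variance $v^2$. *)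

(* Defs.v *)
From HB Require Import structures.
From mathcomp Require Import all_boot all_order all_algebra.
From mathcomp Require Import all_classical all_reals all_analysis.
From mathcomp Require Import measurable_realfun.

Set Implicit Arguments.
Unset Strict Implicit.
Unset Printing Implicit Defensive.

Import Order.TTheory GRing.Theory Num.Theory.
Import numFieldNormedType.Exports.

Local Open Scope classical_set_scope.
Local Open Scope ring_scope.

Notation borelType E := (g_sigma_algebraType (@open E)).

Definition separable (T : topologicalType) : Prop :=
  exists2 D : set T, countable D & dense D.

Definition finite_dimensional (R : realType) (E : normedModType R)
    (S : set E) : Prop :=
  exists (n : nat) (e : 'I_n -> E),
    S = [set v | exists c : 'I_n -> R, v = \sum_(i < n) c i *: e i].

Section function_space.
Context (R : realType) (E : normedModType R).
Implicit Types (p gamma : R) (f : E -> R).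

Definition dist_pg p gamma (u1 u2 : E) : R :=
  Num.min 1 (`|u1 - u2| `^ gamma) *
  (1 + `|u1| `^ p + `|u2| `^ p) `^ 2^-1.

Definition norm_pg p gamma f : \bar R :=
  (ereal_sup [set (`|f u| / (1 + `|u| `^ (p / 2)))%:E | u in [set: E]] +
   ereal_sup [set (`|f u.1 - f u.2| / dist_pg p gamma u.1 u.2)%:E
             | u in [set u : E * E | u.1 != u.2]])%E.

Definition space_C p gamma : set (E -> R) :=
  [set f | continuous f /\ (norm_pg p gamma f < +oo)%E].

End function_space.

Section processes.
Context (d : measure_display) (Omega : measurableType d) (R : realType).
Context (P : probability Omega R) (E : completeNormedModType R).

Definition filtration (F : R -> set (set Omega)) : Prop :=
  [/\ forall t, 0 <= t -> sigma_algebra setT (F t),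
      forall t, 0 <= t -> F t `<=` measurable &
      forall s t, 0 <= s -> s <= t -> F s `<=` F t].

(* [Z y t] is the process at time [t] started from [y]; the times range over *)
(* [Tm] and the starting points over the state space [S].  The transition    *)
(* kernel is (y, B) |-> P (Z y t @^-1` B), and the Markov property           *)
(* P (Z x (s + t) \in B | F s) = kernel t (Z x s) B is stated by integrating *)
(* over the events of [F s].                                                 *)
Record markov_family (I : nmodType) (Tm : set I) (F : I -> set (set Omega))
    (S : set E) (Z : E -> I -> Omega -> E) : Prop := {
  markov_init : forall x w, S x -> Z x 0 w = x ;
  markov_state : forall x t w, S x -> Tm t -> S (Z x t w) ;
  markov_adapted : forall x t (B : set (borelType E)),
    S x -> Tm t -> measurable B -> F t (Z x t @^-1` B) ;
  markov_kernel : forall t (B : set (borelType E)),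
    Tm t -> measurable B ->
    measurable_fun (S : set (borelType E))
      ((fun y => P (Z y t @^-1` B)) : borelType E -> \bar R) ;
  markov_property : forall x s t (B : set (borelType E)) (A : set Omega),
    S x -> Tm s -> Tm t -> measurable B -> F s A ->
    P (A `&` Z x (s + t) @^-1` B) =
    (\int[P]_(w in A) P (Z (Z x s w) t @^-1` B))%E }.

Definition invariant_measure (X : E -> R -> Omega -> E)
    (mu : probability (borelType E) R) : Prop :=
  forall t (B : set (borelType E)), 0 <= t -> measurable B ->
    (\int[mu]_u P (X u t @^-1` B))%E = mu B.

Definition semigroup (X : E -> R -> Omega -> E) (t : R) (f : E -> R) (u : E)
    : R := \int[P]_w f (X u t w).

Definition mean (mu : probability (borelType E) R) (f : E -> R) : R :=
  \int[mu]_u f u.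

Definition asymptotic_variance (X : E -> R -> Omega -> E)
    (mu : probability (borelType E) R) (f : E -> R) : R :=
  2 * mean mu (fun u => (f u - mean mu f) *
    \int[lebesgue_measure]_(t in `[0, +oo[) (semigroup X t f u - mean mu f)).

Definition L2norm (V : Omega -> E) : \bar R :=
  ('E_P[fun w => (`|V w| ^+ 2)%R] `^ 2^-1)%E.

Record ergodic_process (X : E -> R -> Omega -> E)
    (r rt gamma1 beta : R) (rho : R -> R) : Prop := {
  ep_r : 2 <= r ;
  ep_rt : 1 <= rt ;
  ep_moment : exists2 L1 : R, 0 < L1 & forall x t, 0 <= t ->
    ('E_P[fun w => (`|X x t w| `^ r)%R] <= (L1 * (1 + `|x| `^ (rt * r)))%:E)%E ;
  ep_gamma1 : 0 < gamma1 <= 1 ;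
  ep_beta : 0 <= beta <= r - 1 ;
  ep_rho_ge0 : forall t, 0 <= t -> 0 <= rho t ;
  ep_rho_cont : {within `[0, +oo[, continuous rho} ;
  ep_rho_int :
    (\int[lebesgue_measure]_(t in `[0%R, +oo[) ((rho t `^ gamma1)%R)%:E < +oo)%E ;
  ep_contract : exists2 L2 : R, 0 < L2 & forall x y t, 0 <= t ->
    (L2norm (fun w => X x t w - X y t w)%R <=
     (L2 * `|x - y| * (1 + `|x| `^ beta + `|y| `^ beta) * rho t)%:E)%E }.

Record state_spaces (ht : R) (Eh : R -> set E) (xh : R -> E -> E) : Prop := {
  ss_Eh0 : Eh 0 = setT ;
  ss_Eh_fin : forall h, 0 < h <= ht -> finite_dimensional (Eh h) ;
  ss_xh : forall h x, 0 <= h <= ht -> Eh h (xh h x) ;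
  ss_xh_id : forall h x, 0 <= h <= ht -> Eh h x -> xh h x = x }.

(* [Y h tau y k] is the scheme of step-size (h, tau) started from [y], after *)
(* [k] steps, i.e. at time t_k = k * tau.                                    *)
Record ergodic_scheme (F : R -> set (set Omega)) (Eh : R -> set E)
    (Y : R -> R -> E -> nat -> Omega -> E) (ht taut : R)
    (q qt gamma2 kappa : R) (rhoD : R -> R -> R -> R) : Prop := {
  es_ht : 0 <= ht <= 1 ;
  es_taut : 0 < taut <= 1 ;
  es_markov : forall h tau, 0 <= h <= ht -> 0 < tau <= taut ->
    markov_family setT (fun k : nat => F (k%:R * tau)) (Eh h) (Y h tau) ;
  es_q : 2 <= q ;
  es_qt : 1 <= qt ;
  es_moment : exists2 L3 : R, 0 < L3 &
    forall h tau x k, 0 <= h <= ht -> 0 < tau <= taut -> Eh h x ->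
    ('E_P[fun w => (`|Y h tau x k w| `^ q)%R] <=
     (L3 * (1 + `|x| `^ (qt * q)))%:E)%E ;
  es_gamma2 : 0 < gamma2 <= 1 ;
  es_kappa : 0 <= kappa <= q - 1 ;
  es_rho_ge0 : forall h tau t, 0 <= h <= ht -> 0 < tau <= taut -> 0 <= t ->
    0 <= rhoD h tau t ;
  es_rho_sum : exists C : R, forall h tau, 0 <= h <= ht -> 0 < tau <= taut ->
    (tau%:E * \sum_(0 <= k <oo) ((rhoD h tau (k%:R * tau) `^ gamma2)%R)%:E
     <= C%:E)%E ;
  es_contract : exists2 L4 : R, 0 < L4 &
    forall h tau x y k, 0 <= h <= ht -> 0 < tau <= taut -> Eh h x -> Eh h y ->
    (L2norm (fun w => Y h tau x k w - Y h tau y k w)%R <=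
     (L4 * `|x - y| * (1 + `|x| `^ kappa + `|y| `^ kappa) *
      rhoD h tau (k%:R * tau))%:E)%E }.

(* At time t the scheme takes its value at the grid point t_k with           *)
(* t_k <= t < t_(k+1), i.e. k = truncn (t / tau).                            *)
Definition strong_order (X : E -> R -> Omega -> E) (xh : R -> E -> E)
    (Y : R -> R -> E -> nat -> Omega -> E) (ht taut rt qt alpha1 alpha2 : R)
    : Prop :=
  exists2 L5 : R, 0 < L5 &
    forall h tau x t, 0 <= h <= ht -> 0 < tau <= taut -> 0 <= t ->
    (L2norm (fun w => X x t w - Y h tau (xh h x) (Num.truncn (t / tau)) w)%R <=
     (L5 * (1 + `|x| `^ Num.max rt qt) *
      (h `^ alpha1 + tau `^ alpha2))%:E)%E.

Definition cvg_in_distribution (S : R -> Omega -> R)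
    (nu : probability (measurableTypeR R) R) : Prop :=
  forall g : R -> R, continuous g -> (exists M : R, forall y, `|g y| <= M) ->
    \int[P]_w g (S tau w) @[tau --> 0^'+] --> \int[nu]_y g y.

End processes.

(* [normal_prob 0 0] is not the Dirac mass at 0, hence the case distinction. *)
Definition centered_gaussian (R : realType) (v2 : R) :
    probability (measurableTypeR R) R :=
  if v2 == 0 then (\d_(0 : measurableTypeR R) : probability _ R)
  else (normal_prob 0 (Num.sqrt v2) : probability _ R).

Definition natceil (R : realType) (x : R) : nat := `|Num.ceil x|%N.

(* [full = false]: only time is discretized, h = 0; [full = true]: the space *)
(* is discretized too, h = tau ^ (alpha2 / alpha1).                          *)
Definition space_step (R : realType) (full : bool) (alpha1 alpha2 tau : R) : R :=
  if full then tau `^ (alpha2 / alpha1) else 0.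

Definition num_steps (R : realType) (lambda tau : R) : nat :=
  natceil (tau `^ (- 1 - 2 * lambda)).

(* Iterated limit, in tau first and then in eps: the inner limits [l eps]    *)
(* exist for all small eps > 0, and tend to 0 with eps.                      *)
Definition tail_condition (R : realType) (rhoD : R -> R -> R -> R)
    (hstep : R -> R) (gamma lambda : R) : Prop :=
  exists2 l : R -> R,
    (\forall eps \near (0 : R)^'+,
       0 < Num.sqrt eps - eps / lambda - eps * Num.sqrt eps / lambda ->
       tau `^ eps *
         \sum_(natceil (tau `^ (- 1 - eps / 4)) <= i < (num_steps lambda tau).+1)
            rhoD (hstep tau) tau (i%:R * tau) `^ gamma
       @[tau --> (0 : R)^'+] --> l eps) &
    l eps @[eps --> (0 : R)^'+] --> (0 : R).

(* Main.v *)
Require Import Defs.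
From HB Require Import structures.
From mathcomp Require Import all_boot all_order all_algebra.
From mathcomp Require Import all_classical all_reals all_analysis.
From mathcomp Require Import measurable_realfun.
From mathcomp Require Import ring lra.
Set Implicit Arguments.
Unset Strict Implicit.
Unset Printing Implicit Defensive.
Import Order.TTheory GRing.Theory Num.Theory.
Import numFieldNormedType.Exports.
Local Open Scope classical_set_scope.
Local Open Scope ring_scope.

(* The strong error bound (A3) is uniform in time, so the scheme may be       *)
(* replaced by the exact process X sampled on the grid: the two normalized    *)
(* sums differ in L^1 by O((k tau)^(1/2) tau^(alpha2 gamma)), which tends to  *)
(* 0 because lambda < alpha2 gamma.                                           *)
(*   For the exact process, write g = f - mu(f), X_i = X_(i tau), s for       *)
(* (k tau)^(-1/2), W_n = s tau (g(X_0) + ... + g(X_(n-1))), and let           *)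
(* phi = int_0^oo P_t g dt be the solution of the Poisson equation            *)
(* - L phi = g. Adding the corrector s psi'(W_n) phi(X_n) to psi(W_n) and     *)
(* expanding to second order gives                                            *)
(*   E psi(W_n) - psi(0) =                                                    *)
(*     s^2 tau sum_(i < n) E[psi''(W_i) (g phi)(X_i)] + o(1),                 *)
(* and mixing replaces (g phi)(X_i) by its mean mu(g phi) = v^2 / 2. With     *)
(* psi = cos(th . + b) a discrete Gronwall argument yields the Gaussian       *)
(* characteristic function, with psi(y) = y^2 / (L^2 + y^2) tightness, and    *)
(* Lévy's continuity theorem concludes.                                       *)

(** * Discrete Gronwall and Taylor estimates *)

(** How the argument is carried. Everything rests on one coupling estimate, [coupling_holder]: if
    two random points are at distance e in L^2, the values there of a weighted Hölder function of
    exponent g are at distance O(e^g) in L^1, with a constant governed by moments. Applied to X and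
    Y through (A3), it gives [scheme_error] and the near constancy of f(X) on grid cells,
    [cell_regularity]. Applied to two copies of X through (A1), it shows that P_t h is again
    weighted Hölder, with constant of order rho(t)^gamma1 ([semigroup_holder]). Averaging against mu
    gives [semigroup_decay], hence the convergence of the integral phi, and along the path
    [mixing_bound].

    The role of a martingale decomposition is played by [corrector_identity]: for V bounded and
    known at time t_i, the expectation of V (phi(X_(i+1)) - phi(X_i) + tau g(X_i)) is O(tau^(1+eta))
    with eta = alpha2 gamma. [corrector_expansion] feeds this into a second-order Taylor expansion,
    [averaging] replaces g phi by its mean D = v^2 / 2, and [grid_expansion] combines the two.

    For a cosine the second derivative is a multiple of the function, so the expansion closes into a
    linear recursion that forces an exponential ([linear_recursion_expR], [charfun_limit]). The same
    expansion applied to a smooth tail function gives tightness ([tail_limit]).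
    [scheme_sum_transfer] carries both facts to the scheme, and [levy_continuity], with
    [normal_prob_cos] for the limit law, passes from cosines to all bounded continuous functions by
    Bernstein approximation in a sine variable. That v^2 is nonnegative is read off the limit of the
    characteristic functions. *)

Section real_estimates.
Context (R : realType).
Implicit Types (x y z c e K L : R) (f g : R -> R).

Lemma lipschitz_of_bounded_derive f f1 C :
  (forall x, is_derive x 1 f (f1 x)) -> (forall x, `|f1 x| <= C) ->
  forall x y, `|f y - f x| <= C * `|y - x|.
Proof.
move=> df bf x y.
have cf : continuous f.
  by move=> z; apply/differentiable_continuous/derivable1_diffP.
wlog xy : x y / x <= y => [hw|].
  case: (leP x y) => [/hw//|/ltW/hw]; by rewrite distrC (distrC x).
have [c _ ->] := MVT_segment xy (fun z _ => df z) (continuous_subspaceT cf).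
by rewrite normrM ler_wpM2r.
Qed.

(** The mean value theorem writes the increment as [f1 c * (y - x)], and [c] is no farther from [x]
    than [y] is. This gives the constant [C] instead of C / 2 but asks for no second derivative. *)
Lemma taylor1 f f1 C :
  (forall x, is_derive x 1 f (f1 x)) ->
  (forall x y, `|f1 y - f1 x| <= C * `|y - x|) ->
  forall x y, `|f y - f x - f1 x * (y - x)| <= C * (y - x) ^+ 2.
Proof.
move=> df lf x y.
have cf : continuous f.
  by move=> z; apply/differentiable_continuous/derivable1_diffP.
have [c cxy ->] : exists2 c, `|c - x| <= `|y - x| & f y - f x = f1 c * (y - x).
  case: (leP x y) => xy.
  - have [c cxy ->] := MVT_segment xy (fun z _ => df z) (continuous_subspaceT cf).
    exists c => //; move: cxy; rewrite in_itv/= => /andP[xc cy].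
    by rewrite !ger0_norm ?subr_ge0// lerD2r.
  - have [c cxy E] := MVT_segment (ltW xy) (fun z _ => df z) (continuous_subspaceT cf).
    exists c; last by rewrite -opprB E -mulrN opprB.
    move: cxy; rewrite in_itv/= => /andP[yc cx].
    by rewrite distrC (distrC y) !ger0_norm ?subr_ge0// ?(ltW xy)// lerD2l lerN2.
rewrite -mulrBl normrM -real_normK ?num_real// expr2 mulrA ler_wpM2r//.
rewrite (le_trans (lf _ _))//.
have C0 : 0 <= C.
  have := lf 0 1; rewrite subr0 normr1 mulr1; exact/le_trans.
by rewrite ler_wpM2l.
Qed.

(** The majorant [e * (1 + |c|) ^+ n] solves z n = e + |c| (z 0 + ... + z (n-1)) exactly, which is
    [geo]; strong induction compares [z] with it. *)
Lemma gronwall_sum (z : nat -> R) (c e : R) (k : nat) :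
  (forall n, (n <= k)%N -> `|z n - c * \sum_(i < n) z i| <= e) ->
  forall n, (n <= k)%N -> `|z n| <= e * (1 + `|c|) ^+ n.
Proof.
move=> h.
have geo n : `|c| * \sum_(i < n) (e * (1 + `|c|) ^+ i) = e * (1 + `|c|) ^+ n - e.
  elim: n => [|n IH]; first by rewrite big_ord0 mulr0 expr0 mulr1 subrr.
  by rewrite big_ord_recr/= mulrDr IH exprS; ring.
elim/ltn_ind => n IH nk.
have -> : z n = (z n - c * \sum_(i < n) z i) + c * \sum_(i < n) z i by ring.
rewrite (le_trans (ler_normD _ _))//.
rewrite (_ : _ * _ ^+ _ = e + `|c| * \sum_(i < n) (e * (1 + `|c|) ^+ i)); last first.
  by rewrite geo; ring.
rewrite lerD ?h// normrM ler_wpM2l// (le_trans (ler_norm_sum _ _ _))//.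
by apply: ler_sum => i _; rewrite IH// ltnW// (leq_trans (ltn_ord i)).
Qed.

Lemma expR_sub1_bound c : `|c| <= 2^-1 -> `|expR c - 1 - c| <= 2 * c ^+ 2.
Proof.
move=> c2; have /andP[c1 c3] : (- 2^-1 <= c <= 2^-1) by rewrite -ler_norml.
rewrite -addrA -opprD ger0_norm; last by rewrite subr_ge0 expR_ge1Dx.
(* This is 1 - c <= exp(-c), inverted; the excess of 1 / (1 - c) over 1 + c is c^2 / (1 - c). *)
have : expR c <= (1 - c)^-1.
  rewrite -[c]opprK expRN opprK lef_pV2 ?posrE ?expR_gt0//; last lra.
  exact: expR_ge1Dx.
have e : (1 - c)^-1 - (1 + c) = c ^+ 2 * (1 - c)^-1 by field; lra.
have : (1 - c)^-1 <= 2.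
  by rewrite -[leRHS]invrK lef_pV2 ?posrE; lra.
have := sqr_ge0 c; nra.
Qed.

(** The comparison sequence is v n = exp(n c) with c = a / k. It satisfies the recursion up to (exp
    c - 1 - c) times a sum of k terms, that is up to O(a^2 / k). Gronwall applied to u - u 0 v costs
    the factor (1 + |c|)^k <= exp |a|. *)
Lemma linear_recursion_expR (u : nat -> R) (a e : R) (k : nat) :
  (0 < k)%N -> `|a / k%:R| <= 2^-1 -> 0 <= e ->
  (forall n, (n <= k)%N -> `|u n - u 0%N - a / k%:R * \sum_(i < n) u i| <= e) ->
  `|u k - u 0%N * expR a| <=
    (e + `|u 0%N| * (2 * expR `|a| * a ^+ 2 / k%:R)) * expR `|a|.
Proof.
move=> k0 ak e0 h; set c := a / k%:R.
have kR0 : 0 < k%:R :> R by rewrite ltr0n.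
pose v (n : nat) : R := expR (c *+ n).
have ck : `|c| *+ k = `|a|.
  rewrite -mulr_natr /c normrM (ger0_norm (x := k%:R^-1)) ?invr_ge0 ?ler0n//.
  by rewrite divfK ?gt_eqF.
have vE n : v n = 1 + c * \sum_(i < n) v i + (expR c - 1 - c) * \sum_(i < n) v i.
  elim: n => [|n IH]; first by rewrite /v mulr0n expR0 !big_ord0; ring.
  rewrite big_ord_recr/= [LHS](_ : _ = v n * expR c); last first.
    by rewrite /v mulrSr expRD.
  have -> : v n * expR c = v n + v n * (expR c - 1) by ring.
  by rewrite {1}IH; ring.
have vb n : (n <= k)%N -> 0 <= v n <= expR `|a|.
  move=> nk; rewrite /v expR_ge0 ler_expR/= -ck.
  rewrite (le_trans (ler_norm _))// normrMn.
  by rewrite -[leLHS]mulr_natr -[leRHS]mulr_natr ler_wpM2l ?ler_nat.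
have sv n : (n <= k)%N -> 0 <= \sum_(i < n) v i <= k%:R * expR `|a|.
  move=> nk; apply/andP; split.
    by apply: sumr_ge0 => i _; case/andP: (vb i (ltnW (leq_trans (ltn_ord i) nk))).
  apply: (@le_trans _ _ (\sum_(i < n) expR `|a|)).
    apply: ler_sum => i _.
    by case/andP: (vb i (ltnW (leq_trans (ltn_ord i) nk))).
  rewrite sumr_const card_ord -[leLHS]mulr_natl ler_wpM2r ?expR_ge0// ler_nat//.
have hz n : (n <= k)%N ->
   `|(u n - u 0%N * v n) - c * \sum_(i < n) (u i - u 0%N * v i)| <=
   e + `|u 0%N| * (2 * expR `|a| * a ^+ 2 / k%:R).
  move=> nk; rewrite sumrB -mulr_sumr.
  have -> : u n - u 0%N * v n - c * (\sum_(i < n) u i - u 0%N * \sum_(i < n) v i)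
    = (u n - u 0%N - c * \sum_(i < n) u i) -
      u 0%N * ((expR c - 1 - c) * \sum_(i < n) v i) by rewrite vE; ring.
  rewrite (le_trans (ler_normB _ _))// lerD ?h// normrM ler_wpM2l// normrM.
  have /andP[s0 s1] := sv n nk; rewrite (ger0_norm s0).
  have := expR_sub1_bound ak; rewrite -/c => ec.
  have -> : 2 * expR `|a| * a ^+ 2 / k%:R = 2 * c ^+ 2 * (k%:R * expR `|a|).
    by rewrite /c; field; rewrite gt_eqF.
  by rewrite ler_pM.
have := gronwall_sum hz (leqnn k).
rewrite {1}/v -mulr_natr /c divfK ?gt_eqF// => /le_trans; apply.
rewrite ler_wpM2l//.
  by rewrite addr_ge0// mulr_ge0// mulr_ge0 ?invr_ge0// mulr_ge0 ?sqr_ge0// mulr_ge0 ?expR_ge0.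
rewrite -/c -ck -[`|c| *+ k]mulr_natl expRM_natl lerXn2r// ?nnegrE ?expR_ge0 ?addr_ge0//.
exact: expR_ge1Dx.
Qed.

(* This form of Young's inequality stands in for Hölder's and Jensen's. *)
Lemma min1_powR_young (D B e a : R) : 0 <= D -> 0 <= B -> 0 < e -> 0 <= a <= 1 ->
  Num.min 1 (D `^ a) * B `^ 2^-1 <= e `^ a * (1 + (D / e) ^+ 2 + B).
Proof.
move=> D0 B0 e0 /andP[a0 a1].
have ea : 0 < e `^ a by rewrite powR_gt0.
apply: (@le_trans _ _ (D `^ a * B `^ 2^-1)).
  by rewrite ler_wpM2r ?powR_ge0// ge_min lexx orbT.
have -> : D `^ a = e `^ a * (D / e) `^ a.
  by rewrite -powRM ?(ltW e0)// ?divr_ge0// ?(ltW e0)// mulrCA divff ?mulr1 ?gt_eqF.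
rewrite -mulrA ler_wpM2l ?powR_ge0//.
set t := D / e; have t0 : 0 <= t by rewrite divr_ge0// ltW.
have sB : (B `^ 2^-1) ^+ 2 = B by rewrite powR12_sqrt// sqr_sqrtr.
have ta : (t `^ a) ^+ 2 <= 1 + t ^+ 2.
  case: (leP t 1) => t1.
    rewrite (@le_trans _ _ 1) ?lerDl ?sqr_ge0// expr_le1// ?powR_ge0//.
    by have := @ge0_ler_powR R a a0 t 1 t0 ler01 t1; rewrite powR1.
  rewrite (@le_trans _ _ (t ^+ 2)) ?lerDr// lerXn2r ?nnegrE ?powR_ge0//.
  by apply: ler1_powR => //; exact: ltW.
set p := t `^ a in ta *; set q := B `^ 2^-1 in sB *.
have := sqr_ge0 (p - q); have := sqr_ge0 t.
nra.
Qed.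

End real_estimates.

(** * Real-valued integrals *)

Definition L1 d (T : measurableType d) (R : realType)
  (mu : {measure set T -> \bar R}) (f : T -> R) :=
  mu.-integrable setT (EFin \o f).

Section integral_estimates.
Context d (T : measurableType d) (R : realType).
Implicit Types (mu : {measure set T -> \bar R}) (P : probability T R).
Implicit Types (f g : T -> R).

Lemma L1_measurable mu f : L1 mu f -> measurable_fun setT f.
Proof. by move=> /measurable_int/measurable_EFinP. Qed.

Lemma L1_le mu f g : measurable_fun setT f -> L1 mu g ->
  (forall w, `|f w| <= g w) -> L1 mu f.
Proof.
move=> mf Lg fg; apply: le_integrable Lg => //; first exact/measurable_EFinP.
by move=> w _ /=; rewrite lee_fin (le_trans (fg w))// ler_norm.
Qed.

Lemma L1_ge0 mu f c : measurable_fun setT f -> (forall w, 0 <= f w) ->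
  (\int[mu]_w (f w)%:E <= c%:E)%E -> L1 mu f /\ \int[mu]_w f w <= c.
Proof.
move=> mf f0 fc; have Lf : L1 mu f.
  apply/integrableP; split; first exact/measurable_EFinP.
  under eq_integral do rewrite /= ger0_norm//.
  exact: le_lt_trans fc (ltry _).
split=> //; rewrite -lee_fin /Rintegral fineK//.
exact: (integrable_fin_num measurableT Lf).
Qed.

Lemma L1_EFin mu f : L1 mu f -> (\int[mu]_w f w)%:E = (\int[mu]_w (f w)%:E)%E.
Proof. by move=> Lf; rewrite /Rintegral fineK//; exact: (integrable_fin_num measurableT Lf). Qed.

Lemma L1D mu f g : L1 mu f -> L1 mu g -> L1 mu (fun w => f w + g w).
Proof. by move=> Lf Lg; exact: (integrableD measurableT Lf Lg). Qed.

Lemma L1B mu f g : L1 mu f -> L1 mu g -> L1 mu (fun w => f w - g w).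
Proof. by move=> Lf Lg; exact: (integrableB measurableT Lf Lg). Qed.

Lemma L1Z mu f c : L1 mu f -> L1 mu (fun w => c * f w).
Proof. by move=> Lf; exact: (integrableZl measurableT c Lf). Qed.

Lemma L1_norm mu f : L1 mu f -> L1 mu (fun w => `|f w|).
Proof. by move=> Lf; exact: (integrable_abse Lf). Qed.

Lemma L1_sum mu (I : Type) (s : seq I) (f : I -> T -> R) :
  (forall i, L1 mu (f i)) -> L1 mu (fun w => \sum_(i <- s) f i w).
Proof.
move=> Lf; elim: s => [|i s IH].
  rewrite (_ : (fun w => _) = cst 0); last by apply/funext => w; rewrite big_nil.
  exact: integrable0.
rewrite (_ : (fun w => _) = fun w => f i w + \sum_(j <- s) f j w); last first.
  by apply/funext => w; rewrite big_cons.
exact: L1D.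
Qed.

Lemma ERZ mu f c : L1 mu f -> \int[mu]_w (c * f w) = c * \int[mu]_w f w.
Proof. exact: RintegralZl. Qed.

Lemma ERD mu f g : L1 mu f -> L1 mu g ->
  \int[mu]_w (f w + g w) = \int[mu]_w f w + \int[mu]_w g w.
Proof. exact: RintegralD. Qed.

Lemma ERB mu f g : L1 mu f -> L1 mu g ->
  \int[mu]_w (f w - g w) = \int[mu]_w f w - \int[mu]_w g w.
Proof. exact: RintegralB. Qed.

Lemma ER_sum mu (I : Type) (s : seq I) (f : I -> T -> R) :
  (forall i, L1 mu (f i)) ->
  \int[mu]_w (\sum_(i <- s) f i w) = \sum_(i <- s) \int[mu]_w f i w.
Proof.
move=> Lf; elim: s => [|i s IH].
  by under eq_Rintegral do rewrite big_nil; rewrite Rintegral_cst// mul0r big_nil.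
under eq_Rintegral do rewrite big_cons.
by rewrite big_cons -IH ERD//; exact: L1_sum.
Qed.

Lemma ER_le mu f g : L1 mu f -> L1 mu g -> (forall w, f w <= g w) ->
  \int[mu]_w f w <= \int[mu]_w g w.
Proof. by move=> Lf Lg fg; apply: le_Rintegral. Qed.

Lemma ER_abs mu f g : L1 mu f -> L1 mu g -> (forall w, `|f w| <= g w) ->
  `|\int[mu]_w f w| <= \int[mu]_w g w.
Proof.
move=> Lf Lg fg; rewrite (le_trans (le_normr_Rintegral _ _))//.
by apply: ER_le => //; exact: L1_norm.
Qed.

Lemma L1_cst P c : L1 P (fun=> c).
Proof.
exact: (finite_measure_integrable_cst P c measurableT).
Qed.

Lemma L1_bounded P f M : measurable_fun setT f -> (forall w, `|f w| <= M) -> L1 P f.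
Proof. by move=> mf fM; apply: L1_le fM => //; exact: L1_cst. Qed.

Lemma ER_cst P c : \int[P]_w c = c.
Proof.
rewrite (Rintegral_cst _ measurableT c).
have := @probability_setT _ _ _ P => /= PT.
by rewrite PT mulr1.
Qed.

Lemma ER_dominated mu (f_ : nat -> T -> R) f g :
  (forall n, measurable_fun setT (f_ n)) ->
  (forall x, f_ n x @[n --> \oo] --> f x) -> L1 mu g ->
  (forall n x, `|f_ n x| <= g x) ->
  L1 mu f /\ \int[mu]_x f_ n x @[n --> \oo] --> \int[mu]_x f x.
Proof.
move=> mf fcvg Lg fg.
have mE n : measurable_fun setT (fun x => (f_ n x)%:E) by exact/measurable_EFinP.
have cE x : [set: T] x -> (f_ n x)%:E @[n --> \oo] --> (f x)%:E.
  by move=> _; apply: cvg_EFin; [exact: nearW|exact: fcvg].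
have mfE : measurable_fun setT (fun x => (f x)%:E) by exact: emeasurable_fun_cvg mE cE.
have bE : {ae mu, forall x n, [set: T] x -> (`|(f_ n x)%:E| <= (EFin \o g) x)%E}.
  by apply: aeW => x n _; rewrite /= lee_fin.
have [Lf _ cI] := @dominated_convergence _ _ _ mu _ measurableT
  (fun n x => (f_ n x)%:E) _ (EFin \o g) mE mfE (aeW _ cE) Lg bE.
split; first exact: Lf.
by apply: fine_cvg; rewrite (L1_EFin Lf); exact: cI.
Qed.

End integral_estimates.

(** * Bernstein polynomials and uniform continuity *)

Section bernstein.
Context (R : realType).
Implicit Types (t a : R) (h : nat -> R).

(* Bernstein operator: [bern t n h] is the mean of [h] under the binomial law. *)
Fixpoint bern t n h : R := match n with
  | 0%N => h 0%N
  | m.+1 => t * bern t m (fun k => h k.+1) + (1 - t) * bern t m h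
  end.

Lemma bern_le t n h h' : 0 <= t <= 1 -> (forall k, h k <= h' k) ->
  bern t n h <= bern t n h'.
Proof.
move=> /andP[t0 t1]; elim: n h h' => [|n IH] h h' hh; first exact: hh.
by rewrite /= lerD// ler_wpM2l ?IH ?subr_ge0.
Qed.

Lemma bern_linear t n a b h h' :
  bern t n (fun k => a * h k + b * h' k) = a * bern t n h + b * bern t n h'.
Proof. by elim: n h h' => [|n IH] h h' //=; rewrite !IH; ring. Qed.

Lemma bern_cst t n a : bern t n (fun=> a) = a.
Proof. by elim: n => [|n IH] //=; rewrite IH; ring. Qed.

(** The right-hand side is the binomial variance plus the squared mean. The shift [a] makes the
    induction work: a success raises it by one. *)
Lemma bern_sqr t n a :
  bern t n (fun k => (k%:R + a) ^+ 2) = n%:R * t * (1 - t) + (n%:R * t + a) ^+ 2.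
Proof.
elim: n a => [|n IH] a; first by rewrite /=; ring.
rewrite /= IH; under [X in bern _ _ X]funext => k do rewrite -addn1 natrD -addrA.
by rewrite (IH (1 + a)) -(addn1 n) natrD; ring.
Qed.

Lemma bern_norm t n h M : 0 <= t <= 1 -> (forall k, `|h k| <= M) ->
  `|bern t n h| <= M.
Proof.
move=> t01 hM; rewrite ler_norml; apply/andP; split.
  by rewrite -(bern_cst t n (- M)) bern_le// => k; have := hM k; rewrite ler_norml => /andP[].
by rewrite -(bern_cst t n M) bern_le// => k; have := hM k; rewrite ler_norml => /andP[].
Qed.

(** A modulus of continuity in quadratic form replaces Chebyshev's inequality: it integrates
    directly against the binomial law, whose rescaled variance t (1 - t) / n is at most 1 / n. *)
Lemma bern_approx (G : R -> R) (e C : R) t n : 0 <= t <= 1 -> 0 <= C ->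
  (0 < n)%N ->
  (forall x y, `|G x - G y| <= e + C * (x - y) ^+ 2) ->
  `|G t - bern t n (fun k => G (k%:R / n%:R))| <= e + C / n%:R.
Proof.
move=> t01 C0 n0 GC; have nR : 0 < n%:R :> R by rewrite ltr0n.
have b2 : bern t n (fun k => e + C * (t - k%:R / n%:R) ^+ 2) <= e + C / n%:R.
  have -> : (fun k : nat => e + C * (t - k%:R / n%:R) ^+ 2) =
      (fun k : nat => 1 * (fun=> e) k + (C / n%:R ^+ 2) * (k%:R + - (n%:R * t)) ^+ 2).
    by apply/funext => k; field; rewrite gt_eqF.
  rewrite (bern_linear _ _ _ _ (fun=> e) (fun k => (k%:R + - (n%:R * t)) ^+ 2)).
  rewrite bern_cst bern_sqr subrr expr0n/= addr0 mul1r lerD2l.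
  rewrite (_ : C / n%:R ^+ 2 * _ = C / n%:R * (t * (1 - t))); last first.
    by field; rewrite gt_eqF.
  rewrite ler_piMr ?divr_ge0 ?(ltW nR)//.
  by case/andP: t01 => t0 t1; have := sqr_ge0 t; nra.
have hl k : - (e + C * (t - k%:R / n%:R) ^+ 2) <= G (k%:R / n%:R) - G t
              <= e + C * (t - k%:R / n%:R) ^+ 2.
  by rewrite -ler_norml distrC.
rewrite distrC (_ : _ - _ = bern t n (fun k => 1 * G (k%:R / n%:R) + (-1) * (fun=> G t) k)); last first.
  by rewrite (bern_linear _ _ _ _ (fun k => G (k%:R / n%:R)) (fun=> G t)) bern_cst; ring.
set d := fun k => 1 * _ + _.
have up : bern t n d <= e + C / n%:R.
  apply: le_trans b2; apply: bern_le => // k.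
  by case/andP: (hl k) => _; rewrite /d mul1r mulN1r.
have dn : bern t n (fun k => (-1) * d k + 0 * (fun=> 0) k) <= e + C / n%:R.
  apply: le_trans b2; apply: bern_le => // k.
  by case/andP: (hl k) => + _; rewrite /d; lra.
rewrite bern_linear mul0r addr0 mulN1r in dn.
by rewrite ler_norml up andbT lerNl.
Qed.

(** Heine-Cantor by compactness of the segment. Only [x] has to lie in it; [y] may fall outside. *)
Lemma unif_continuous_segment (g : R -> R) (L e : R) : continuous g -> 0 < e ->
  exists2 de, 0 < de &
    forall x y, `|x| <= L -> `|x - y| < de -> `|g x - g y| < e.
Proof.
move=> cg e0.
have /compact_near_coveringP cK := @segment_compact R (- L) L.
have hde : \forall de \near 0^'+, `[- L, L]%classic `<=`
    (fun x => forall y, `|x - y| < de -> `|g x - g y| < e).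
  apply: cK.
  move=> x _.
  have := cg x => /cvgrPdist_lt /(_ (e / 2)); rewrite divr_gt0// => /(_ isT).
  move=> /nbhs_ballP[r /= r0 hr].
  exists (ball x (r / 2), [set de | 0 < de < r / 2]) => /=.
    split; first by apply: nbhsx_ballx; rewrite divr_gt0.
    by near=> de; apply/andP; split; near: de; [exact: nbhs_right_gt|
       apply: nbhs_right_lt; rewrite divr_gt0].
  move=> [z de] /= [xz /andP[de0 der]] y zy.
  have h1 := hr z; have h2 := hr y; rewrite /ball/= in xz h1 h2.
  have {}h1 : `|g x - g z| < e / 2.
    by apply: h1; rewrite (lt_le_trans xz)// ler_pdivrMr// ler_peMr// ?ltW// ltr1n.
  have {}h2 : `|g x - g y| < e / 2.
    apply: h2; rewrite -(subrKA z) (le_lt_trans (ler_normD _ _))//.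
    by rewrite (splitr r) ltrD// (lt_trans zy).
  rewrite -(subrKA (g x)) (le_lt_trans (ler_normD _ _))//.
  by rewrite (splitr e) ltrD// distrC.
have : \forall de \near 0^'+, 0 < de /\ `[- L, L]%classic `<=`
    (fun x => forall y, `|x - y| < de -> `|g x - g y| < e).
  by apply: filterI; [exact: nbhs_right_gt|exact: hde].
case/filter_ex => r [r0 hr]; exists r => // x y xL; apply: hr.
by rewrite /= in_itv/= -ler_norml.
Unshelve. all: by end_near. Qed.

End bernstein.

(** * Lévy's continuity theorem *)

Section trigonometric_approximation.
Context (R : realType).
Implicit Types (L e M : R).

(** A change of variable into [0, 1] through the sine, so that a polynomial in [circ L y] is a
    trigonometric polynomial in [y]. *)
Definition circ L (y : R) : R := (1 + sin (y / L)) / 2.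

Lemma circ_itv L y : 0 <= circ L y <= 1.
Proof.
have := sin_geN1 (y / L); have := sin_le1 (y / L); rewrite /circ => h1 h2.
by apply/andP; split; lra.
Qed.

(** For |y| <= L / 2 the arcsine recovers y from [circ L y], so g is there a continuous function G
    of [circ], approximated by its Bernstein polynomial. The coefficients are values of g, hence the
    approximant is bounded by [M] on the whole line, which controls the tails later. *)
Lemma trig_approx (g : R -> R) L e M : continuous g -> (forall y, `|g y| <= M) ->
  0 < L -> 0 < e ->
  exists n h, (forall k, `|h k| <= M) /\
    (forall y, `|y| <= L / 2 -> `|g y - bern (circ L y) n h| <= e).
Proof.
move=> cg gM L0 e0.
have p2 : 1 <= pi / 2 :> R := pihalf_ge1 R.
have b0 : 0 < sin (2^-1 : R) by apply: sin_gt0_pihalf; lra.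
have b1 : sin (2^-1 : R) < 1.
  rewrite lt_neqAle sin_le1 andbT; apply/eqP => /(congr1 (fun z => z ^+ 2)).
  have := cos2Dsin2 (2^-1 : R); have : 0 < cos (2^-1 : R) by apply: cos_gt0_pihalf; lra.
  by move=> c0 cs; nra.
have half : 2^-1 \in `[- (pi / 2), pi / 2 : R].
  by rewrite in_itv/=; apply/andP; split; lra.
have nhalf : - 2^-1 \in `[- (pi / 2), pi / 2 : R].
  by rewrite in_itv/=; apply/andP; split; lra.
set b := sin (2^-1 : R) in b0 b1 *.
(* Clamping to [-sin(1/2), sin(1/2)] keeps away from the endpoints -1 and 1, where the arcsine is
   not Lipschitz, and leaves the values of sin(y / L) with |y| <= L / 2 unchanged. *)
pose cl (x : R) := Num.max (- b) (Num.min x b).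
have cl_itv x : - b <= cl x <= b.
  by rewrite /cl le_max lexx/= ge_max ge_min lexx orbT andbT; lra.
have cl_lip x y : `|cl x - cl y| <= `|x - y|.
  wlog xy : x y / x <= y => [hw|].
    by case: (leP x y) => [/hw//|/ltW/hw]; rewrite distrC (distrC y).
  rewrite distrC (distrC x) [leRHS]ger0_norm ?subr_ge0// ger0_norm; last first.
    rewrite subr_ge0 /cl ge_max !le_max lexx/= !le_min !ge_min lexx ?orbT/= xy/=.
    by rewrite orbT.
  rewrite /cl; case: (leP x b) => xb; case: (leP y b) => yb;
    case: (leP (- b) x) => ?; case: (leP (- b) y) => ?;
    rewrite ?[Num.max _ b]max_r; clear cl_itv; lra.
pose A (x : R) := asin (cl (2 * x - 1)).
pose CA := 2 * (Num.sqrt (1 - b ^+ 2))^-1.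
have b2 : 0 < 1 - b ^+ 2 by rewrite subr_gt0 expr_lt1// ltW.
have CA0 : 0 <= CA by rewrite mulr_ge0// invr_ge0 sqrtr_ge0.
have asin_lip u v : - b <= u <= b -> - b <= v <= b ->
    `|asin u - asin v| <= (Num.sqrt (1 - b ^+ 2))^-1 * `|u - v|.
  wlog uv : u v / u <= v => [hw|] ub vb.
    case: (leP u v) => [uv|/ltW uv]; first exact: hw.
    by rewrite distrC (distrC u); exact: hw.
  have dasin x : x \in `]u, v[ -> is_derive x 1 asin (Num.sqrt (1 - x ^+ 2))^-1.
    rewrite in_itv/= => /andP[ux xv]; apply: is_derive1_asin.
    by apply/andP; split; lra.
  have casin : {within `[u, v], continuous (@asin R)}.
    apply: continuous_in_subspaceT => x; rewrite inE/= in_itv/= => /andP[ux xv].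
    by apply: continuous_asin; apply/andP; split; lra.
  have [c cuv] := MVT_segment uv dasin casin.
  rewrite distrC (distrC u) => ->; rewrite normrM ler_wpM2r//.
  rewrite ger0_norm ?invr_ge0 ?sqrtr_ge0// lef_pV2 ?posrE ?sqrtr_gt0//; last first.
    by move: cuv; rewrite in_itv/= => /andP[uc cv]; nra.
  by rewrite ler_sqrt//; move: cuv; rewrite in_itv/= => /andP[uc cv]; nra.
have A_lip x y : `|A x - A y| <= CA * `|x - y|.
  rewrite (le_trans (asin_lip _ _ (cl_itv _) (cl_itv _)))//.
  rewrite /CA -mulrA mulrCA ler_wpM2l ?invr_ge0 ?sqrtr_ge0//.
  rewrite (le_trans (cl_lip _ _))//.
  have -> : 2 * x - 1 - (2 * y - 1) = 2 * (x - y) by ring.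
  by rewrite normrM ger0_norm.
have A1 x : `|A x| <= 1.
  have au u : - b <= u <= b -> asin u \in `[- (pi / 2), pi / 2] /\ sin (asin u) = u.
    move=> /andP[ub1 ub2]; have u1 : -1 <= u <= 1 by apply/andP; split; lra.
    by rewrite in_itv/= asin_geNpi2 ?asin_lepi2// asinK ?in_itv.
  have mono u : - b <= u <= b -> asin u <= 2^-1.
    move=> ub; rewrite leNgt; apply/negP => h; have [au1 au2] := au _ ub.
    by have := ltr_sin half au1; rewrite h au2 -/b; case/andP: ub; lra.
  have mono' u : - b <= u <= b -> - 2^-1 <= asin u.
    move=> ub; rewrite leNgt; apply/negP => h; have [au1 au2] := au _ ub.
    by have := ltr_sin au1 nhalf; rewrite h au2 sinN -/b; case/andP: ub; lra.
  by rewrite ler_norml (le_trans _ (mono' _ _))// ?(le_trans (mono _ _))//; lra.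
have A_circ y : `|y| <= L / 2 -> L * A (circ L y) = y.
  move=> yL; have yL1 : - 2^-1 <= y / L <= 2^-1.
    rewrite ler_pdivrMr// ler_pdivlMr//; move: yL; rewrite ler_norml mulNr mulrC//.
  rewrite /A (_ : 2 * _ - 1 = sin (y / L)); last by rewrite /circ; field.
  case/andP: yL1 => y1 y2.
  have yI : y / L \in `[- (pi / 2), pi / 2].
    by rewrite in_itv/=; apply/andP; split; lra.
  rewrite /cl min_l; last by rewrite leNgt /b ltr_sin// -leNgt.
  rewrite max_r; last by rewrite /b -sinN leNgt ltr_sin// -leNgt.
  by rewrite sinK// mulrC divfK ?gt_eqF.
have e2 : 0 < e / 2 by rewrite divr_gt0.
have [de de0 hde] := unif_continuous_segment L cg e2.
pose G x := g (L * A x).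
have M0 : 0 <= M by exact: le_trans (gM 0).
(* When the two arguments of g are at least [de] apart, L CA |x - y| / de is at least 1, so the
   trivial bound 2 M is at most [C * (x - y) ^+ 2]. *)
pose C := 2 * M * (L * CA) ^+ 2 / de ^+ 2.
have C0 : 0 <= C by rewrite divr_ge0 ?sqr_ge0// mulr_ge0 ?sqr_ge0// mulr_ge0.
have GC x y : `|G x - G y| <= e / 2 + C * (x - y) ^+ 2.
  case: (ltP `|L * A x - L * A y| de) => h.
    rewrite (le_trans (ltW (hde _ _ _ h)))//.
      by rewrite normrM (gtr0_norm L0) ler_piMr// ltW.
    by rewrite lerDl mulr_ge0// sqr_ge0.
  rewrite (le_trans (ler_normB _ _))// (@le_trans _ _ (2 * M))//.
    by have := gM (L * A x); have := gM (L * A y); rewrite /G; lra.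
  apply: ler_wpDl; first exact: ltW.
  have -> : C * (x - y) ^+ 2 = 2 * M * ((L * CA * (x - y)) ^+ 2 / de ^+ 2).
    by rewrite /C; field; rewrite gt_eqF.
  rewrite ler_peMr ?mulr_ge0// ler_pdivlMr ?exprn_gt0// mul1r.
  rewrite -[leRHS]real_normK ?num_real// lerXn2r ?nnegrE ?(ltW de0)//.
  rewrite (le_trans h)// -mulrBr normrM (gtr0_norm L0) -(mulrA L) normrM.
  by rewrite (gtr0_norm L0) ler_wpM2l ?(ltW L0)// normrM (ger0_norm CA0).
have [n] : exists n : nat, C / n.+1%:R <= e / 2.
  exists (Num.truncn (C / (e / 2))).
  rewrite ler_pdivrMr ?ltr0n// mulrC -ler_pdivrMr//.
  by rewrite ltW// truncnS_gt.
move=> Cn; exists n.+1, (fun k => G (k%:R / n.+1%:R)); split=> [k|y yL].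
  exact: gM.
rewrite -{1}(A_circ y yL) -/(G _).
apply: le_trans (bern_approx (circ_itv L y) C0 (ltn0Sn n) GC) _.
by rewrite [leRHS](splitr e) lerD2l.
Qed.

End trigonometric_approximation.

Section tail_function.
Context (R : realType).

(** A smooth substitute for the indicator of |y| >= L: it lies in [0, 1] and is at least 1/2 there.
    Being smooth, it can serve as a test function in the expansion. *)
Definition tail_fun (L y : R) : R := y ^+ 2 / (L ^+ 2 + y ^+ 2).

Lemma tail_fun_itv L y : 0 < L -> 0 <= tail_fun L y <= 1.
Proof.
move=> L0; have y2 := sqr_ge0 y; have L2 : 0 < L ^+ 2 by rewrite exprn_gt0.
rewrite /tail_fun divr_ge0 ?addr_ge0 ?(ltW L2)//= ler_pdivrMr ?mul1r; lra.
Qed.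

Lemma tail_fun_norm L y : 0 < L -> `|tail_fun L y| <= 1.
Proof. by move=> /(tail_fun_itv y)/andP[? ?]; rewrite ger0_norm. Qed.

Lemma tail_fun_ge2 L y : 0 < L -> L <= `|y| -> 1 <= 2 * tail_fun L y.
Proof.
move=> L0 Ly; rewrite /tail_fun mulrA ler_pdivlMr; last first.
  by rewrite ltr_pwDl ?sqr_ge0// exprn_gt0.
have : L ^+ 2 <= y ^+ 2 by rewrite -(real_normK (num_real y)) lerXn2r// nnegrE ltW.
lra.
Qed.

Lemma continuous_tail_fun L : 0 < L -> continuous (tail_fun L).
Proof.
move=> L0 y; apply: cvgM; first exact: exprn_continuous.
apply: cvgV; first by rewrite gt_eqF// ltr_pwDl ?sqr_ge0// exprn_gt0.
by apply: cvgD; [exact: cvg_cst|exact: exprn_continuous].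
Qed.

End tail_function.

Section levy_continuity.
Context d (Omega : measurableType d) (R : realType) (P : probability Omega R).
Context (F : set_system R) {FF : ProperFilter F} (S : R -> Omega -> R).
Context (nu : probability (measurableTypeR R) R).
Hypothesis mS : \forall t \near F, measurable_fun setT (S t).

Let good (g : R -> R) := [/\ continuous g, exists M, forall y, `|g y| <= M &
  \int[P]_w g (S t w) @[t --> F] --> \int[nu]_y g y].

Let L1S g M (t : R) : continuous g -> (forall y, `|g y| <= M) ->
  measurable_fun setT (S t) -> L1 P (fun w => g (S t w)).
Proof.
move=> cg gM mt; apply: (@L1_bounded _ _ _ _ _ M) => //.
exact: measurableT_comp (continuous_measurable_fun cg) mt.
Qed.

Let L1nu g M : continuous g -> (forall y, `|g y| <= M) -> L1 nu g.
Proof.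
move=> cg gM; apply: (@L1_bounded _ _ _ _ _ M) => //.
exact: continuous_measurable_fun.
Qed.

Let good_lin a b f g : good f -> good g -> good (fun y => a * f y + b * g y).
Proof.
move=> [cf [M fM] hf] [cg [N gN] hg]; split.
- move=> y; apply: (@cvgD _ _ _ _ _ (fun y => a * f y) (fun y => b * g y)).
    exact: (cvgM (cvg_cst a) (cf y)).
  exact: (cvgM (cvg_cst b) (cg y)).
- exists (`|a| * M + `|b| * N) => y; rewrite (le_trans (ler_normD _ _))//.
  by rewrite !normrM lerD// ler_wpM2l.
- have -> : \int[nu]_y (a * f y + b * g y) = a * \int[nu]_y f y + b * \int[nu]_y g y.
    have Lf := L1nu cf fM; have Lg := L1nu cg gN.
    by rewrite ERD ?ERZ//; exact: L1Z.
  have h : (a * \int[P]_w f (S t w) + b * \int[P]_w g (S t w)) @[t --> F] -->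
           a * \int[nu]_y f y + b * \int[nu]_y g y.
    by apply: cvgD; apply: cvgM => //; exact: cvg_cst.
  apply: cvg_trans h; apply: near_eq_cvg; near=> t.
  have mt : measurable_fun setT (S t) by near: t.
  have Lf := L1S cf fM mt; have Lg := L1S cg gN mt.
  by rewrite ERD ?ERZ//; exact: L1Z.
Unshelve. all: by end_near. Qed.

Hypothesis cvg_cos : forall th b : R,
  \int[P]_w cos (th * S t w + b) @[t --> F] --> \int[nu]_y cos (th * y + b).

Let good_cos (th b : R) : good (fun y => cos (th * y + b)).
Proof.
split; [|by exists 1 => y; rewrite ler_norml cos_geN1 cos_le1|exact: cvg_cos].
move=> y; apply: continuous_comp; last exact: continuous_cos.
by apply: cvgD; [apply: cvgM; [exact: cvg_cst|exact: cvg_id]|exact: cvg_cst].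
Qed.

(** One Bernstein step multiplies by (1 + sin(y / L)) / 2 or by (1 - sin(y / L)) / 2. The
    product-to-sum formula turns a cosine times this factor into cosines of frequencies th, th + 1/L
    and th - 1/L, the last two with phase lowered by pi / 2; hence the induction over all [th] and
    [b]. *)
Let good_bern L n h (th b : R) : L != 0 ->
  good (fun y => cos (th * y + b) * bern (circ L y) n h).
Proof.
move=> L0; elim: n h th b => [|n IH] h th b.
  rewrite (_ : (fun y => _) = fun y => h 0%N * cos (th * y + b) + 0 * cos (th * y + b)); last first.
    by apply/funext => y /=; ring.
  exact: good_lin.
have half h' (s : R) : good (fun y => cos (th * y + b) * ((1 + s * sin (y / L)) / 2) * bern (circ L y) n h').
  rewrite (_ : (fun y => _) = fun y =>
    2^-1 * (cos (th * y + b) * bern (circ L y) n h') + 1 *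
    ((s / 4) * (cos ((th + L^-1) * y + (b - pi / 2)) * bern (circ L y) n h') +
     (- s / 4) * (cos ((th - L^-1) * y + (b - pi / 2)) * bern (circ L y) n h'))).
    by apply: good_lin; [exact: IH|apply: good_lin; exact: IH].
  apply/funext => y.
  have -> : (th + L^-1) * y + (b - pi / 2) = (th * y + b) + y / L - pi / 2 by ring.
  have -> : (th - L^-1) * y + (b - pi / 2) = (th * y + b) - y / L - pi / 2 by ring.
  by rewrite !cosB cos_pihalf sin_pihalf !sinD !sinN !cosN; field.
have -> : (fun y => cos (th * y + b) * bern (circ L y) n.+1 h) = fun y =>
   1 * (cos (th * y + b) * ((1 + 1 * sin (y / L)) / 2) * bern (circ L y) n (fun k => h k.+1)) +
   1 * (cos (th * y + b) * ((1 + (-1) * sin (y / L)) / 2) * bern (circ L y) n h).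
  by apply/funext => y; rewrite /circ/=; field.
by apply: good_lin; exact: half.
Qed.

(** On [-L, L] the function g is within e / 8 of a trigonometric polynomial T, for which convergence
    is known. Outside, both are bounded by M, so |g - T| <= 2 M <= 4 M [tail_fun L], which tightness
    makes small under both laws. *)
Lemma levy_continuity (g : R -> R) :
  (forall e, 0 < e -> exists L, [/\ 0 < L, \int[nu]_y tail_fun L y <= e &
      \forall t \near F, \int[P]_w tail_fun L (S t w) <= e]) ->
  continuous g -> (exists M, forall y, `|g y| <= M) ->
  \int[P]_w g (S t w) @[t --> F] --> \int[nu]_y g y.
Proof.
move=> tight cg [M gM]; apply/cvgrPdist_le => e e0.
have M0 : 0 <= M by exact: le_trans (gM 0).
have M1 : 0 < 4 * M + 1 by lra.
have [L [L0 nuL PL]] := tight (e / 8 / (4 * M + 1)) (divr_gt0 (divr_gt0 e0 (ltr0Sn _ _)) M1).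
have L2 : 0 < 2 * L by lra.
have e8 : 0 < e / 8 by rewrite divr_gt0.
(* The scale is 2 L because the approximation holds on half of it, that is on [-L, L]. *)
have [n [h [hM hg]]] := trig_approx cg gM L2 e8.
have [cT0 [N TN] hT0] := good_bern n h 0 0 (lt0r_neq0 L2).
set T := (fun y => _) in cT0 TN hT0.
have TE y : T y = bern (circ (2 * L) y) n h by rewrite /T mul0r addr0 cos0 mul1r.
have TM y : `|T y| <= M by rewrite TE; exact: bern_norm (circ_itv _ _) hM.
have gT y : `|g y - T y| <= e / 8 + 4 * M * tail_fun L y.
  case: (leP `|y| L) => yL.
    rewrite TE (le_trans (hg y _))//; first by rewrite mulrC mulKf.
    case/andP: (tail_fun_itv y L0) => t0 _.
    by rewrite lerDl mulr_ge0// mulr_ge0.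
  have := tail_fun_ge2 L0 (ltW yL); have := gM y; have := TM y => h1 h2 h3.
  rewrite (le_trans (ler_normB _ _))//; nra.
have bnd : e / 8 + 4 * M * (e / 8 / (4 * M + 1)) <= e / 4.
  have -> : e / 4 = e / 8 + e / 8 by field.
  rewrite lerD2l mulrCA ler_piMr ?(ltW e8)// ler_pdivrMr//; lra.
have Ltnu := L1nu (continuous_tail_fun L0) (fun y => tail_fun_norm y L0).
have nu_gT : `|\int[nu]_y g y - \int[nu]_y T y| <= e / 4.
  have Lg := L1nu cg gM; have LT := L1nu cT0 TM.
  have Lb : L1 nu (fun y => e / 8 + 4 * M * tail_fun L y).
    by apply: L1D; [exact: L1_cst|exact: L1Z].
  rewrite -ERB// (le_trans (ER_abs (L1B Lg LT) Lb gT))// (le_trans _ bnd)//.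
  rewrite ERD; [|exact: L1_cst|exact: L1Z].
  by rewrite ER_cst ERZ// lerD2l ler_wpM2l// mulr_ge0.
near=> t.
have mt : measurable_fun setT (S t) by near: t.
have P_gT : `|\int[P]_w g (S t w) - \int[P]_w T (S t w)| <= e / 4.
  have Lg := L1S cg gM mt; have LT := L1S cT0 TM mt.
  have Lt := L1S (continuous_tail_fun L0) (fun y => tail_fun_norm y L0) mt.
  have Lb : L1 P (fun w => e / 8 + 4 * M * tail_fun L (S t w)).
    by apply: L1D; [exact: L1_cst|exact: L1Z].
  rewrite -ERB// (le_trans (ER_abs (L1B Lg LT) Lb (fun w => gT _)))// (le_trans _ bnd)//.
  rewrite ERD; [|exact: L1_cst|exact: L1Z].
  rewrite ER_cst ERZ// lerD2l ler_wpM2l ?mulr_ge0//.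
  by near: t.
have hT : `|\int[nu]_y T y - \int[P]_w T (S t w)| <= e / 2.
  near: t; move/cvgrPdist_le : hT0; apply; exact: divr_gt0.
move: nu_gT P_gT hT; clear; rewrite !ler_norml => /andP[? ?] /andP[? ?] /andP[? ?].
by apply/andP; split; lra.
Unshelve. all: by end_near. Qed.

End levy_continuity.

(** * Mixtures of measures *)

Section mixture.
Context d d' (W : measurableType d) (T : measurableType d') (R : realType).
Variables (nu : {measure set W -> \bar R}) (K : W -> {measure set T -> \bar R}).
Hypothesis mK : forall B, measurable B -> measurable_fun setT (K ^~ B).
Local Open Scope ereal_scope.
Import HBNNSimple.

Lemma mixture_nnsfun (f : {nnsfun T >-> R}) :
  \int[nu]_w \int[K w]_z (f z)%:E =
  \sum_(r \in range f) r%:E * \int[nu]_w K w (f @^-1` [set r]).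
Proof.
under eq_integral.
  move=> w _.
  under eq_integral.
    by move=> z _; rewrite fimfunE -fsumEFin//; over.
  rewrite /= ge0_integral_fsum//; last 2 first.
    - by move=> r; exact/measurable_EFinP/measurableT_comp.
    - by move=> r z _; rewrite EFinM nnfun_muleindic_ge0.
  under eq_fsbigr.
    move=> r _.
    rewrite (integralZl_indic _ (fun r => f @^-1` [set r]))//; last first.
      by move=> r0; rewrite preimage_nnfun0.
    rewrite integral_indic// setIT.
    over.
  over.
rewrite /= ge0_integral_fsum//; last 2 first.
  - move=> r; apply: measurable_funeM.
    exact: mK.
  - move=> r w _.
    have := mulemu_ge0 (mu := K w) (fun n => f @^-1` [set n]).
    by apply; exact: preimage_nnfun0.
apply: eq_fsbigr => r _.
have [r0|r0] := leP 0%R r.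
  by rewrite ge0_integralZl//; exact: mK.
rewrite integral0_eq; last first.
  by move=> w _; rewrite preimage_nnfun0// measure0 mule0.
rewrite integral0_eq ?mule0// => w _.
by rewrite preimage_nnfun0// measure0.
Qed.

Lemma mixture_lim (h : T -> \bar R) (mh : measurable_fun setT h) :
  (forall z, 0 <= h z) ->
  \int[nu]_w \int[K w]_z h z =
  limn (fun n => \int[nu]_w \int[K w]_z (nnsfun_approx measurableT mh n z)%:E).
Proof.
move=> h0; pose f_ := nnsfun_approx measurableT mh; rewrite -/f_.
transitivity (\int[nu]_y lim ((\int[K y]_z (f_ n z)%:E) @[n --> \oo])).
  apply: eq_integral => y _; rewrite -monotone_convergence//; last 3 first.
  - by move=> n; exact/measurable_EFinP.
  - by move=> n z _; rewrite lee_fin.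
  - by move=> z _ a b ab; rewrite lee_fin; exact/lefP/nd_nnsfun_approx.
  by apply: eq_integral => z _; apply/esym/cvg_lim => //; exact: cvg_nnsfun_approx.
rewrite -monotone_convergence//.
- move=> n; apply: measurable_fun_integral_kernel => //.
  + by move=> z; rewrite lee_fin.
  + exact/measurable_EFinP.
- by move=> n y _; apply: integral_ge0 => // z _; rewrite lee_fin.
- move=> y _ a b ab; apply: ge0_le_integral => //.
  + by move=> z _; rewrite lee_fin.
  + exact/measurable_EFinP.
  + exact/measurable_EFinP.
  + by move=> z _; rewrite lee_fin; exact/lefP/nd_nnsfun_approx.
Qed.

End mixture.

Section mixture_equality.
Import HBNNSimple.

(** Agreement on sets extends to nonnegative functions through simple functions and monotone
    convergence. Changes of density, the Markov property and invariance all reduce to it, with Dirac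
    masses, weighted Dirac masses or transition laws as [K1] and [K2]. *)
Lemma mixture_eq d1 d2 d' (W1 : measurableType d1) (W2 : measurableType d2)
    (T : measurableType d') (R : realType)
    (nu1 : {measure set W1 -> \bar R}) (K1 : W1 -> {measure set T -> \bar R})
    (nu2 : {measure set W2 -> \bar R}) (K2 : W2 -> {measure set T -> \bar R})
    (h : T -> \bar R) :
  (forall B, measurable B -> measurable_fun setT (K1 ^~ B)) ->
  (forall B, measurable B -> measurable_fun setT (K2 ^~ B)) ->
  (forall B, measurable B ->
    (\int[nu1]_w K1 w B = \int[nu2]_w K2 w B)%E) ->
  measurable_fun setT h -> (forall z, 0 <= h z)%E ->
  (\int[nu1]_w \int[K1 w]_z h z = \int[nu2]_w \int[K2 w]_z h z)%E.
Proof.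
move=> mK1 mK2 K12 mh h0; rewrite (mixture_lim _ mK1 mh)// (mixture_lim _ mK2 mh)//.
congr (limn _); apply/funext => n; rewrite !mixture_nnsfun//.
by apply: eq_fsbigr => r _; rewrite K12.
Qed.

End mixture_equality.

(** * The Gaussian characteristic function *)

Section density.
Context d (T : measurableType d) (R : realType).
Variables (mu nu : {measure set T -> \bar R}) (g : T -> R).
Hypotheses (mg : measurable_fun setT g) (g0 : forall x, 0 <= g x).
Hypothesis nuE : forall B, measurable B -> nu B = (\int[mu]_(x in B) (g x)%:E)%E.

(** The measure [nu] is the mixture of the Dirac masses at x under [nu] itself, and also of the
    masses g(x) at x under [mu]. *)
Lemma integral_density (h : T -> \bar R) :
  measurable_fun setT h -> (forall x, 0 <= h x)%E ->
  (\int[nu]_x h x = \int[mu]_x ((g x)%:E * h x))%E.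
Proof.
move=> mh h0.
pose K2 x : {measure set T -> \bar R} := mscale (NngNum (g0 x)) \d_x.
have := @mixture_eq _ _ _ _ _ _ _ nu (fun x => \d_x) mu K2 h.
rewrite (_ : (\int[nu]_w _)%E = (\int[nu]_x h x)%E); last first.
  by apply: eq_integral => x _; rewrite integral_dirac// diracT mul1e.
rewrite (_ : (\int[mu]_w \int[K2 w]_z h z)%E = (\int[mu]_x ((g x)%:E * h x))%E); last first.
  by apply: eq_integral => x _; rewrite ge0_integral_mscale// integral_dirac// diracT mul1e.
apply=> //.
- move=> B mB; exact/measurable_EFinP/measurable_indic.
- move=> B mB; apply: emeasurable_funM; first exact/measurable_EFinP.
  exact/measurable_EFinP/measurable_indic.
- move=> B mB; rewrite (_ : (\int[nu]_w _)%E = nu B); last first.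
    by transitivity (\int[nu]_w (\1_B w)%:E)%E => //; rewrite integral_indic// setIT.
  rewrite nuE// integral_mkcond; apply: eq_integral => x _.
  by rewrite patchE /K2 /= /mscale/= /dirac indicE; case: (x \in B); rewrite ?mule1 ?mule0.
Qed.

End density.

Section gaussian.
Context (R : realType) (sigma : R).
Hypothesis s0 : 0 < sigma.
Let leb : {measure set (measurableTypeR R) -> \bar R} := lebesgue_measure.
Let n : R -> R := normal_pdf 0 sigma.
Let c : R := (sigma ^+ 2 *+ 2)^-1.

Let nE y : n y = normal_peak sigma * expR (- c * y ^+ 2).
Proof.
by rewrite /n normal_pdfE ?gt_eqF// /normal_fun subr0 -/c mulNr (mulrC (y ^+ 2)) -mulNr.
Qed.

Let c0 : 0 < c.
Proof. by rewrite invr_gt0 mulrn_wgt0// exprn_gt0. Qed.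

Let derive_n (y : R) : is_derive y (1 : R) n (- (2 * c) * y * n y).
Proof.
rewrite (_ : n = fun y => normal_peak sigma * expR (- c * y ^+ 2)); last first.
  by apply/funext => z; exact: nE.
apply: is_derive_eq.
rewrite /= /GRing.scale/=; ring.
Qed.

Let n0 y : 0 <= n y. Proof. exact: normal_pdf_ge0. Qed.

Let cn : continuous n.
Proof. by apply: continuous_normal_pdf; rewrite gt_eqF. Qed.

Let Ln : L1 leb n. Proof. exact: integrable_normal_pdf. Qed.

(** Half of the Gaussian exponent absorbs |y|; the other half is the density of variance 2 sigma^2,
    which is integrable. *)
Let Lyn : L1 leb (fun y => `|y| * n y).
Proof.
pose s2 := sigma * Num.sqrt 2.
have s20 : 0 < s2 by rewrite mulr_gt0// sqrtr_gt0.
have c2 : (s2 ^+ 2 *+ 2)^-1 = c / 2.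
  by rewrite /c exprMn sqr_sqrtr// -mulr_natr -(mulr_natr (sigma ^+ 2)); field; rewrite gt_eqF.
pose C := (1 + 2 / c) * (normal_peak sigma / normal_peak s2).
have p0 : 0 < normal_peak s2 by rewrite normal_peak_gt0 ?gt_eqF.
refine (@L1_le _ _ _ leb (fun y => `|y| * n y) (fun y => C * normal_pdf 0 s2 y) _ _ _).
- apply: measurable_funM; first exact: normr_measurable.
  exact: measurable_normal_pdf.
- by apply: L1Z; exact: integrable_normal_pdf.
move=> y; rewrite ger0_norm ?mulr_ge0// normal_pdfE ?gt_eqF// /normal_fun subr0.
rewrite c2 nE /C mulrCA -!mulrA [leRHS]mulrCA ler_wpM2l ?normal_peak_ge0//.
rewrite (mulrA _^-1) mulVf ?gt_eqF// mul1r.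
have -> : - c * y ^+ 2 = - (c / 2 * y ^+ 2) + - (c / 2 * y ^+ 2) by field.
have -> : - y ^+ 2 * (c / 2) = - (c / 2 * y ^+ 2) by ring.
rewrite expRD mulrA ler_wpM2r ?expR_ge0// expRN ler_pdivrMr ?expR_gt0//.
set z := c / 2 * y ^+ 2.
have y2 : `|y| ^+ 2 = 2 / c * z by rewrite real_normK ?num_real// /z; field; rewrite gt_eqF.
have z0 : 0 <= z by rewrite mulr_ge0 ?sqr_ge0// divr_ge0// ltW.
have d0 : 0 <= 2 / c by rewrite divr_ge0// ltW.
apply: (@le_trans _ _ ((1 + 2 / c) * (1 + z))); last first.
  by rewrite ler_wpM2l ?addr_ge0// expR_ge1Dx.
have := sqr_ge0 (`|y| - 1); rewrite sqrrB y2; have := mulr_ge0 d0 z0; lra.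
Qed.

Let mcos th b : measurable_fun setT (fun y : R => cos (th * y + b)).
Proof.
apply: continuous_measurable_fun => y; apply: continuous_comp; last exact: continuous_cos.
by apply: cvgD; [apply: cvgM; [exact: cvg_cst|exact: cvg_id]|exact: cvg_cst].
Qed.

Let msin th b : measurable_fun setT (fun y : R => sin (th * y + b)).
Proof.
apply: continuous_measurable_fun => y; apply: continuous_comp; last exact: continuous_sin.
by apply: cvgD; [apply: cvgM; [exact: cvg_cst|exact: cvg_id]|exact: cvg_cst].
Qed.

Let mn : measurable_fun setT n. Proof. exact: measurable_normal_pdf. Qed.

Let Lcos th b : L1 leb (fun y => cos (th * y + b) * n y).
Proof.
refine (@L1_le _ _ _ leb (fun y => cos (th * y + b) * n y) n _ Ln _).
  by apply: measurable_funM; [exact: mcos|exact: mn].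
by move=> y; rewrite normrM (ger0_norm (n0 y)) ler_piMl// ler_norml cos_geN1 cos_le1.
Qed.

Let Lsin th b : L1 leb (fun y => y * sin (th * y + b) * n y).
Proof.
refine (@L1_le _ _ _ leb (fun y => y * sin (th * y + b) * n y) _ _ Lyn _); first by apply: measurable_funM; [apply: measurable_funM; [exact: measurable_id|exact: msin]|exact: mn].
move=> y; rewrite !normrM (ger0_norm (n0 y)) ler_wpM2r// ler_piMr//.
by rewrite ler_norml sin_geN1 sin_le1.
Qed.

Let gauss_cos th b : R := \int[leb]_y (cos (th * y + b) * n y).

(* Integration by parts: y n(y) = - sigma^2 n'(y). *)
Let gauss_parts th b :
  \int[leb]_y (y * sin (th * y + b) * n y) = sigma ^+ 2 * th * gauss_cos th b.
Proof.
have D y : is_derive (y : R) (1 : R) (fun y : R => sin (th * y + b) * n y)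
    (th * (cos (th * y + b) * n y) - (2 * c) * (y * sin (th * y + b) * n y)).
  have dn := derive_n y.
  apply: is_derive_eq; rewrite /= /GRing.scale/=; ring.
set G := (fun y : R => _) in D.
pose G' y := th * (cos (th * y + b) * n y) - (2 * c) * (y * sin (th * y + b) * n y).
have LG : L1 leb G' by apply: L1B; apply: L1Z; [exact: Lcos|exact: Lsin].
have IG : \int[leb]_y G' y = 0.
  have cG' : continuous G'.
    move=> y; have cy : continuous (fun y : R => th * y + b).
      by move=> z; apply: cvgD; [apply: cvgM; [exact: cvg_cst|exact: cvg_id]|exact: cvg_cst].
    apply: cvgB; apply: cvgM; try exact: cvg_cst.
      apply: cvgM; last exact: cn.
      exact: (continuous_comp (cy y) (@continuous_cos R _)).
    apply: cvgM; last exact: cn.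
    apply: cvgM; first exact: cvg_id.
    exact: (continuous_comp (cy y) (@continuous_sin R _)).
  have cG : continuous G.
    by move=> y; apply/differentiable_continuous/derivable1_diffP.
  have FTC (m : nat) : (\int[leb]_(y in `[(- m.+1%:R)%R, (m.+1%:R)%R]) (G' y)%:E)%E =
      (G m.+1%:R - G (- m.+1%:R))%:E.
    rewrite (@continuous_FTC2 _ G' G)//.
    - by rewrite (@lt_trans _ _ 0) ?oppr_lt0 ?ltr0n.
    - exact: continuous_subspaceT.
    - split; [by move=> y _; apply: ex_derive| |].
      + by apply: cvg_at_right_filter; exact: cG.
      + by apply: cvg_at_left_filter; exact: cG.
    - by move=> y _; rewrite derive1E derive_val.
  pose f_ (m : nat) := G' \_ `[- m.+1%:R, m.+1%:R].
  have mG' : measurable_fun setT G' by exact: L1_measurable LG.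
  have mf m : measurable_fun setT (f_ m).
    by apply/(measurable_restrictT _ _).1 => //; exact: measurable_funTS.
  have fcvg y : f_ n y @[n --> \oo] --> G' y.
    apply: cvg_near_cst; near=> m; rewrite /f_ patchE mem_set//=.
    rewrite in_itv/= -ler_norml (@le_trans _ _ m%:R) ?ler_nat//.
    near: m; exact: nbhs_infty_ger.
  have fb m y : `|f_ m y| <= `|G' y|.
    by rewrite /f_ patchE; case: ifP => // _; rewrite normr0.
  have [_ I1] := @ER_dominated _ (measurableTypeR R) R leb f_ G' _ mf fcvg (L1_norm LG) fb.
  have I2 : \int[leb]_x f_ m x @[m --> \oo] --> (0 : R).
    have IE m : \int[leb]_x f_ m x = G m.+1%:R - G (- m.+1%:R).
      by rewrite /f_ -Rintegral_mkcond /Rintegral FTC.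
    (* The integral over [-(m+1), m+1] is a difference of boundary values. Since exp(c y^2) >= c
       y^2, each of them is at most the peak of the density divided by c (m + 1). *)
    apply/norm_cvg0P/(@squeeze_cvgr _ _ _ _ (fun=> 0) (fun m => 2 * normal_peak sigma / c * m.+1%:R^-1)).
    - near=> m; rewrite normr_ge0/= IE.
      have nb y : m.+1%:R = `|y| -> `|G y| <= normal_peak sigma / c * m.+1%:R^-1.
        move=> ym; rewrite /G normrM (ger0_norm (n0 y)) (@le_trans _ _ (n y))//.
          by rewrite ler_piMl// ler_norml sin_geN1 sin_le1.
        rewrite nE -mulrA ler_wpM2l ?normal_peak_ge0// mulNr expRN -invfM.
        rewrite lef_pV2 ?posrE ?expR_gt0 ?mulr_gt0// ?ltr0n//.
        rewrite (le_trans _ (expR_ge1Dx _))// -(real_normK (num_real y)) -ym.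
        rewrite ler_wpDl// ler_wpM2l ?(ltW c0)// expr2 ler_peMr// ler1n//.
      rewrite (le_trans (ler_normB _ _))//.
      have := nb m.+1%:R; rewrite ger0_norm// => /(_ erefl) h1.
      have := nb (- m.+1%:R); rewrite normrN ger0_norm// => /(_ erefl) h2.
      have -> : 2 * normal_peak sigma / c / m.+1%:R =
        normal_peak sigma / c / m.+1%:R + normal_peak sigma / c / m.+1%:R by ring.
      exact: lerD.
    - exact: cvg_cst.
    - rewrite -(mulr0 (2 * normal_peak sigma / c)); apply: cvgM; first exact: cvg_cst.
      exact: cvg_harmonic.
  exact: (cvg_unique _ I1 I2).
have E : \int[leb]_y G' y = th * gauss_cos th b - 2 * c * \int[leb]_y (y * sin (th * y + b) * n y).
  rewrite /G' ERB; [|apply: L1Z; exact: Lcos|apply: L1Z; exact: Lsin].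
  by rewrite !ERZ.
move: E; rewrite IG => /esym/eqP; rewrite subr_eq0 => /eqP E.
have -> : sigma ^+ 2 * th * gauss_cos th b = sigma ^+ 2 * (th * gauss_cos th b) by ring.
rewrite E /c -mulr_natr; field; rewrite gt_eqF//.
Unshelve. all: by end_near. Qed.

Let derive_gauss (th b : R) : is_derive th (1:R) (gauss_cos^~ b)
  (- \int[leb]_y (y * sin (th * y + b) * n y)).
Proof.
have dcos (t y : R) : is_derive t (1 : R) (fun t : R => cos (t * y + b) * n y) (- (y * sin (t * y + b) * n y)).
  apply: is_derive_eq; rewrite /= /GRing.scale/=; ring.
pose f t y := cos (t * y + b) * n y.
have p1 t y : partial1of2 f t y = - (y * sin (t * y + b) * n y).
  by rewrite partial1of2E; apply: (@derive_val _ _ _ _ _ _ _ (dcos t y)).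
have I : `]th - 1, th + 1[%classic th by rewrite /= in_itv/=; apply/andP; split; lra.
have bG t y : `]th - 1, th + 1[%classic t -> [set: R] y -> `|partial1of2 f t y| <= `|y| * n y.
  move=> _ _; rewrite p1 normrN !normrM (ger0_norm (n0 y)) ler_wpM2r// ler_piMr//.
  by rewrite ler_norml sin_geN1 sin_le1.
have G0 y : 0 <= `|y| * n y by rewrite mulr_ge0.
have intf t : `]th - 1, th + 1[%classic t -> leb.-integrable setT (EFin \o f t).
  by move=> _; exact: Lcos.
have df t y : `]th - 1, th + 1[%classic t -> [set: R] y -> derivable (f ^~ y) t 1.
  by move=> _ _; apply: ex_derive.
have D := @derivable_under_integral R _ _ leb f setT measurableT th _ _ I intf df _ G0 Lyn bG.
have E := @differentiation_under_integral R _ _ leb f setT measurableT th _ _ I intf df _ G0 Lyn bG.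
apply: DeriveDef; first exact: D.
rewrite -derive1E E (_ : (\int[leb]_(y in setT) _) = \int[leb]_y ((-1) * (y * sin (th * y + b) * n y))).
  by rewrite ERZ// mulN1r.
by apply: eq_Rintegral => y _; rewrite p1 mulN1r.
Qed.

Let N : probability (measurableTypeR R) R := normal_prob 0 sigma.

(** Differentiation under the integral and integration by parts give the equation G' = - sigma^2 th
    G for the cosine transform G, so G(t) exp(sigma^2 t^2 / 2) is constant, equal to its value cos b
    at 0. *)
Lemma normal_prob_cos th b :
  \int[N]_y cos (th * y + b) = cos b * expR (- (th ^+ 2 * sigma ^+ 2 / 2)).
Proof.
have -> : \int[N]_y cos (th * y + b) = gauss_cos th b.
  (* Adding 1 makes the integrand nonnegative, as the change of density requires; the 1 is
     subtracted at the end. *)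
  have mh : measurable_fun setT (fun y : R => 1 + cos (th * y + b)) by exact: measurable_funD.
  have h0 y : 0 <= 1 + cos (th * y + b) by have := cos_geN1 (th * y + b); lra.
  have mE : measurable_fun setT (EFin \o (fun y : R => 1 + cos (th * y + b))).
    exact/measurable_EFinP.
  have E : \int[N]_y (1 + cos (th * y + b)) =
     \int[leb]_y (n y + cos (th * y + b) * n y).
    rewrite /Rintegral (@integral_density _ _ _ leb N n mn n0 (fun B _ => erefl) _ mE)//.
    by congr fine; apply: eq_integral => y _ /=; rewrite -EFinM; congr EFin; ring.
  have La : L1 N (fun=> 1) by exact: (L1_cst N).
  have Lb : L1 N (fun y => cos (th * y + b)).
    apply: (@L1_bounded _ _ _ N _ 1); first exact: mcos.
    by move=> y; rewrite ler_norml cos_geN1 cos_le1.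
  rewrite (ERD La Lb) in E.
  rewrite (ER_cst N) in E.
  rewrite ERD// in E; apply: (addrI 1); rewrite E; congr (_ + _).
  by rewrite /Rintegral (_ : (\int[leb]_y (n y)%:E = 1)%E)//; exact: integral_normal_pdf.
pose H t := gauss_cos t b * expR (sigma ^+ 2 / 2 * t ^+ 2).
have dH (t : R) : is_derive t (1 : R) H 0.
  have dg := derive_gauss t b.
  by apply: is_derive_eq; rewrite /= /GRing.scale/= gauss_parts; field.
have := is_derive_0_is_cst th 0 dH; rewrite /H => HE.
have g0 : gauss_cos 0 b = cos b.
  rewrite /gauss_cos; under eq_Rintegral do rewrite mul0r add0r.
  rewrite ERZ//= /Rintegral (_ : (\int[leb]_y (n y)%:E = 1)%E) ?mulr1//.
  exact: integral_normal_pdf.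
move: HE; rewrite g0 expr0n/= mulr0 expR0 mulr1 => <-.
rewrite -mulrA -expRD [X in expR X](_ : _ = 0) ?expR0 ?mulr1//.
by field.
Qed.

End gaussian.

(** * Expansion with a corrector *)

(** [psi1] and [psi2] stand for the first two derivatives, recorded through the remainder bounds
    that the expansion uses. A single constant [c] bounds everything, so that estimates are uniform
    over families such as [tail_fun L] with L >= 1. *)
Record smooth_test (R : realType) (psi psi1 psi2 : R -> R) (c : R) : Prop := {
  test_cont : continuous psi ;
  test1_cont : continuous psi1 ;
  test2_cont : continuous psi2 ;
  test_bound : forall y, `|psi y| <= c ;
  test1_bound : forall y, `|psi1 y| <= c ;
  test2_bound : forall y, `|psi2 y| <= c ;
  test_lip : forall x y, `|psi y - psi x| <= c * `|y - x| ;
  test2_lip : forall x y, `|psi2 y - psi2 x| <= c * `|y - x| ;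
  test_taylor : forall x y, `|psi y - psi x - psi1 x * (y - x)| <= c * (y - x) ^+ 2 ;
  test1_taylor : forall x y,
    `|psi1 y - psi1 x - psi2 x * (y - x)| <= c * (y - x) ^+ 2 }.

Section corrector_recursion.
Context d (Omega : measurableType d) (R : realType) (P : probability Omega R).
Variables (xi phi : nat -> Omega -> R) (s tau : R) (k : nat).

Definition partial_sum (n : nat) (w : Omega) : R := s * tau * \sum_(j < n) xi j w.

Local Notation W := partial_sum.

Hypotheses (mxi : forall i, measurable_fun setT (xi i))
  (mphi : forall i, measurable_fun setT (phi i)).

Lemma measurable_partial_sum n : measurable_fun setT (W n).
Proof.
apply: measurable_funM; first exact: measurable_cst.
apply: measurable_sum => i; exact: mxi.
Qed.

Lemma partial_sumS n w : W n.+1 w - W n w = s * tau * xi n w.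
Proof. by rewrite /partial_sum big_ord_recr/=; ring. Qed.

Hypotheses (s0 : 0 <= s) (tau0 : 0 <= tau).
Variable B : R.
Hypotheses (L_phi : forall i, L1 P (phi i)) (L_xi : forall i, L1 P (xi i))
  (L_xi2 : forall i, L1 P (fun w => xi i w ^+ 2))
  (L_xiphi : forall i, L1 P (fun w => xi i w * phi i w))
  (L_xi2phi : forall i, L1 P (fun w => xi i w ^+ 2 * `|phi i w|)).
Hypotheses (B_phi : forall i, \int[P]_w `|phi i w| <= B)
  (B_xi2 : forall i, \int[P]_w (xi i w ^+ 2) <= B)
  (B_xi2phi : forall i, \int[P]_w (xi i w ^+ 2 * `|phi i w|) <= B).
Variables (psi psi1 psi2 : R -> R) (c e : R).
Hypothesis psiP : smooth_test psi psi1 psi2 c.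
(** The weight [psi1 (W i.+1 w)] involves the observations 0, ..., i only, so it is known at the
    time of the i-th one: this is what lets the Poisson equation give the bound. *)
Hypothesis corrector : forall i, (i < k)%N ->
  `|\int[P]_w (psi1 (W i.+1 w) * (phi i.+1 w - phi i w + tau * xi i w))| <= c * (tau * e).

Let L1_bnd (g : R -> R) (V : Omega -> R) n : continuous g -> (forall y, `|g y| <= c) ->
  measurable_fun setT V -> L1 P V -> L1 P (fun w => g (W n w) * V w).
Proof.
move=> cg gc mV LV; have c0 : 0 <= c by exact: le_trans (gc 0).
apply: (@L1_le _ _ _ _ _ (fun w => c * `|V w|)).
- apply: measurable_funM => //.
  exact: measurableT_comp (continuous_measurable_fun cg) (measurable_partial_sum n).
- by apply: L1Z; exact: L1_norm.
- by move=> w; rewrite normrM ler_wpM2r.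
Qed.

(** [psi] is expanded backwards, around [W n.+1]. Its first-order term s tau psi1(W n.+1) xi_n then
    cancels against the increment of the corrector s psi1 phi, leaving s phi_n (psi1(W n.+1) -
    psi1(W n)), whose leading part is s^2 tau psi2(W n) xi_n phi_n. The two Taylor remainders give
    the terms of orders s^2 tau^2 and s^3 tau^2. *)
Let step n : (n < k)%N ->
  `|(\int[P]_w psi (W n.+1 w) + s * \int[P]_w (psi1 (W n.+1 w) * phi n.+1 w)) -
    (\int[P]_w psi (W n w) + s * \int[P]_w (psi1 (W n w) * phi n w)) -
    s ^+ 2 * tau * \int[P]_w (psi2 (W n w) * (xi n w * phi n w))| <=
  c * (s * tau * e + s ^+ 2 * tau ^+ 2 * B + s ^+ 3 * tau ^+ 2 * B).
Proof.
case: psiP => cp cp1 cp2 bp b1 b2 _ _ tp t1 nk.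
have c0 : 0 <= c by exact: le_trans (bp 0).
have Lpsi m : L1 P (fun w => psi (W m w)).
  apply: (@L1_bounded _ _ _ _ _ c) => //.
  exact: measurableT_comp (continuous_measurable_fun cp) (measurable_partial_sum m).
have Lp1 m : L1 P (fun w => s * (psi1 (W m w) * phi m w)) by apply: L1Z; exact: L1_bnd.
have mxp : measurable_fun setT (fun w => xi n w * phi n w) by exact: measurable_funM.
have Lp2 : L1 P (fun w => s ^+ 2 * tau * (psi2 (W n w) * (xi n w * phi n w))).
  by apply: L1Z; exact: L1_bnd.
have LV : L1 P (fun w => phi n.+1 w - phi n w + tau * xi n w).
  by apply: L1D; [exact: L1B|exact: L1Z].
have mV : measurable_fun setT (fun w => phi n.+1 w - phi n w + tau * xi n w).
  exact: L1_measurable LV.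
have Lc : L1 P (fun w => s * (psi1 (W n.+1 w) * (phi n.+1 w - phi n w + tau * xi n w))).
  by apply: L1Z; exact: (L1_bnd (V := fun w => phi n.+1 w - phi n w + tau * xi n w)).
pose D w := (psi (W n.+1 w) + s * (psi1 (W n.+1 w) * phi n.+1 w)) -
   (psi (W n w) + s * (psi1 (W n w) * phi n w)) -
   s ^+ 2 * tau * (psi2 (W n w) * (xi n w * phi n w)) -
   s * (psi1 (W n.+1 w) * (phi n.+1 w - phi n w + tau * xi n w)).
have LD : L1 P D.
  by apply: L1B => //; apply: L1B => //; apply: L1B => //; apply: L1D.
have LG : L1 P (fun w => c * s ^+ 2 * tau ^+ 2 * xi n w ^+ 2 +
                c * s ^+ 3 * tau ^+ 2 * (xi n w ^+ 2 * `|phi n w|)).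
  by apply: L1D; exact: L1Z.
have DG w : `|D w| <= c * s ^+ 2 * tau ^+ 2 * xi n w ^+ 2 +
                c * s ^+ 3 * tau ^+ 2 * (xi n w ^+ 2 * `|phi n w|).
  have := tp (W n.+1 w) (W n w); have := t1 (W n w) (W n.+1 w).
  rewrite -[W n w - W n.+1 w]opprB partial_sumS => h1 h2.
  have -> : D w = - (psi (W n w) - psi (W n.+1 w) - psi1 (W n.+1 w) * - (s * tau * xi n w)) +
      s * (phi n w * (psi1 (W n.+1 w) - psi1 (W n w) - psi2 (W n w) * (s * tau * xi n w))).
    by rewrite /D; ring.
  rewrite (le_trans (ler_normD _ _))// lerD//.
    rewrite normrN (le_trans h2)//.
    by rewrite le_eqVlt; apply/orP; left; apply/eqP; ring.
  rewrite 2!normrM (ger0_norm s0).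
  have -> : c * s ^+ 3 * tau ^+ 2 * (xi n w ^+ 2 * `|phi n w|) =
      s * (`|phi n w| * (c * (s * tau * xi n w) ^+ 2)) by ring.
  by rewrite ler_wpM2l// ler_wpM2l.
have ED : \int[P]_w D w = (\int[P]_w psi (W n.+1 w) + s * \int[P]_w (psi1 (W n.+1 w) * phi n.+1 w)) -
    (\int[P]_w psi (W n w) + s * \int[P]_w (psi1 (W n w) * phi n w)) -
    s ^+ 2 * tau * \int[P]_w (psi2 (W n w) * (xi n w * phi n w)) -
    s * \int[P]_w (psi1 (W n.+1 w) * (phi n.+1 w - phi n w + tau * xi n w)).
  rewrite /D ERB//; last by apply: L1B => //; apply: L1B => //; apply: L1D.
  rewrite ERB//; last by apply: L1B => //; apply: L1D.
  rewrite ERB//; [|exact: L1D|exact: L1D].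
  rewrite !ERD// !ERZ//; by apply: L1_bnd.
rewrite [X in `|X|](_ : _ = \int[P]_w D w +
    s * \int[P]_w (psi1 (W n.+1 w) * (phi n.+1 w - phi n w + tau * xi n w))); last first.
  by rewrite ED; ring.
rewrite (le_trans (ler_normD _ _))//.
have hD := ER_abs LD LG DG.
rewrite (ERD (L1Z _ (L_xi2 n)) (L1Z _ (L_xi2phi n))) !ERZ// in hD.
have hc : `|s * \int[P]_w (psi1 (W n.+1 w) * (phi n.+1 w - phi n w + tau * xi n w))| <= s * (c * (tau * e)).
  by rewrite normrM (ger0_norm s0) ler_wpM2l// corrector.
have h1 : c * s ^+ 2 * tau ^+ 2 * \int[P]_w (xi n w ^+ 2) <= c * s ^+ 2 * tau ^+ 2 * B.
  by rewrite ler_wpM2l// !mulr_ge0 ?sqr_ge0.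
have h2 : c * s ^+ 3 * tau ^+ 2 * \int[P]_w (xi n w ^+ 2 * `|phi n w|) <= c * s ^+ 3 * tau ^+ 2 * B.
  by rewrite ler_wpM2l// !mulr_ge0 ?sqr_ge0 ?exprn_ge0.
rewrite (le_trans (lerD (le_trans hD (lerD h1 h2)) hc))//.
by rewrite le_eqVlt; apply/orP; left; apply/eqP; ring.
Qed.

(** The one-step estimates telescope for psi + s psi1 phi; removing the corrector at both ends costs
    [2 * s * B]. *)
Lemma corrector_expansion n : (n <= k)%N ->
  `|\int[P]_w psi (W n w) - psi 0 -
    s ^+ 2 * tau * \sum_(i < n) \int[P]_w (psi2 (W i w) * (xi i w * phi i w))| <=
  c * (2 * s * B + n%:R * (s * tau * e + s ^+ 2 * tau ^+ 2 * B + s ^+ 3 * tau ^+ 2 * B)).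
Proof.
case: (psiP) => cp cp1 cp2 bp b1 b2 _ _ tp t1 nk.
have c0 : 0 <= c by exact: le_trans (bp 0).
have bd m : `|s * \int[P]_w (psi1 (W m w) * phi m w)| <= c * (s * B).
  rewrite normrM (ger0_norm s0) mulrCA ler_wpM2l//.
  rewrite (le_trans (@ER_abs _ _ _ _ _ (fun w => c * `|phi m w|) _ _ _))//.
  - exact: L1_bnd.
  - by apply: L1Z; exact: L1_norm.
  - by move=> w; rewrite normrM ler_wpM2r.
  - by rewrite ERZ ?ler_wpM2l//; exact: L1_norm.
pose A m := \int[P]_w psi (W m w) + s * \int[P]_w (psi1 (W m w) * phi m w).
have tel : `|A n - A 0%N - s ^+ 2 * tau * \sum_(i < n) \int[P]_w (psi2 (W i w) * (xi i w * phi i w))| <=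
    n%:R * (c * (s * tau * e + s ^+ 2 * tau ^+ 2 * B + s ^+ 3 * tau ^+ 2 * B)).
  elim: n nk => [|n IH] nk; first by rewrite big_ord0 mulr0 !subrr normr0 mul0r.
  have {}IH := IH (ltnW nk); have := step nk; rewrite -/(A n.+1) -/(A n) => st.
  rewrite big_ord_recr/= -natr1 mulrDl mul1r.
  set S0 := \sum_(i < n) _ in IH *; set I := \int[P]_w _ in st *.
  have -> : A n.+1 - A 0%N - s ^+ 2 * tau * (S0 + I) =
    (A n - A 0%N - s ^+ 2 * tau * S0) + (A n.+1 - A n - s ^+ 2 * tau * I) by ring.
  by rewrite (le_trans (ler_normD _ _))// lerD.
have W0 : \int[P]_w psi (W 0%N w) = psi 0.
  rewrite (_ : (fun w => psi (W 0%N w)) = fun=> psi 0) ?ER_cst//.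
  by apply/funext => w; rewrite /partial_sum big_ord0 mulr0.
have h1 := bd n; have h2 := bd 0%N.
move: tel; rewrite {1}/A /(A 0%N) W0.
set S0 := \sum_(i < n) _; set I1 := s * _ in h1 *; set I2 := s * _ in h2 *.
set J := \int[P]_w _; move=> tel.
have -> : J - psi 0 - s ^+ 2 * tau * S0 = (J + I1 - (psi 0 + I2) - s ^+ 2 * tau * S0) - I1 + I2 by ring.
rewrite (le_trans (ler_normD _ _))// (le_trans (lerD (ler_normB _ _) (lexx _)))//.
rewrite (le_trans (lerD (lerD tel h1) h2))//.
by rewrite le_eqVlt; apply/orP; left; apply/eqP; ring.
Qed.

End corrector_recursion.

(** * The Markov property for functions *)

Section borel_measurability.
Context (R : realType) (E : normedModType R).

Lemma continuous_borel_measurable (f : E -> R) :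
  continuous f -> measurable_fun setT (f : borelType E -> R).
Proof.
move=> cf; apply: (measurability _ (RGenOInfty.measurableE R)) => _ [_ [x ->] <-].
rewrite setTI; apply: sub_sigma_algebra.
have /continuousP := cf; apply; exact: rray_open.
Qed.

Context d (T : measurableType d).
Implicit Types U V : T -> E.

(** Separability makes the distance of two random points measurable: |U - V| < x holds exactly when
    |U - e| + |V - e| < x for some e in a countable dense set. *)
Lemma measurable_norm_sub U V : separable E ->
  measurable_fun setT (U : T -> borelType E) ->
  measurable_fun setT (V : T -> borelType E) ->
  measurable_fun setT (fun w => `|U w - V w|).
Proof.
move=> [D cD dD] mU mV.
have mdist (Z : T -> E) e : measurable_fun setT (Z : T -> borelType E) ->
    measurable_fun setT (fun w => `|Z w - e|).
  move=> mZ; apply: (@measurableT_comp _ _ _ _ _ _ (fun z : borelType E => `|(z : E) - e|)) => //.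
  apply: continuous_borel_measurable => z.
  by apply: cvg_norm; apply: cvgB; [exact: cvg_id|exact: cvg_cst].
apply: (measurability _ (RGenInftyO.measurableE R)) => _ [_ [x ->] <-].
rewrite setTI.
rewrite (_ : _ @^-1` _ = \bigcup_(e in D) [set w | `|U w - e| + `|V w - e| < x]).
  have [D0|[g]] := pfcard_geP cD.
    by rewrite D0 bigcup_set0; exact: measurable0.
  rewrite -(image_eq g) bigcup_image; apply: bigcup_measurable => i _.
  set e := g i.
  rewrite -[X in measurable X]setTI.
  have mUV : measurable_fun setT (fun w => `|U w - e| + `|V w - e|).
    by apply: measurable_funD; exact: mdist.
  have := mUV measurableT `]-oo, x[%classic (measurable_itv _).
  by congr measurable; congr (_ `&` _); apply/funext => w; rewrite /= in_itv.
apply/seteqP; split => [w|w [e De] /=]; rewrite /= in_itv/=.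
  move=> UVx.
  have [e [De Ue]] : D `&` ball (U w) ((x - `|U w - V w|) / 2) !=set0.
    rewrite setIC; apply: dD; last exact: ball_open.
    by exists (U w); apply: ballxx; rewrite divr_gt0// subr_gt0.
  exists e => //=.
  have : `|V w - e| <= `|U w - V w| + `|U w - e|.
    by rewrite (distrC (U w) (V w)) -(subrKA (U w)) ler_normD.
  move: Ue; rewrite -ball_normE/= => Ue; lra.
move=> h; rewrite (le_lt_trans _ h)//.
by rewrite -(subrKA e) (distrC (V w)) ler_normD.
Qed.

End borel_measurability.

Section functional_markov.
Context d (Omega : measurableType d) (R : realType) (P : probability Omega R).
Context (E : completeNormedModType R) (F : R -> set (set Omega)).
Hypothesis F_filt : filtration F.
Variable X : E -> R -> Omega -> E.
Hypothesis X_markov : markov_family P `[0, +oo[ F setT X.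

Let sF s : 0 <= s -> <<s F s>> = F s.
Proof. by move=> s0; have [h _ _] := F_filt; exact: sigma_algebra_id (h s s0). Qed.

Definition adapted s (V : Omega -> R) :=
  measurable_fun setT (V : g_sigma_algebraType (F s) -> R).

Lemma measurable_adapted s V : 0 <= s -> adapted s V -> measurable_fun setT V.
Proof.
move=> s0 aV _ B mB; rewrite setTI.
have := aV measurableT B mB; rewrite setTI /measurable/= (sF s0).
by have [_ h _] := F_filt; exact: h.
Qed.

Lemma adapted_le s t V : 0 <= s -> s <= t -> adapted s V -> adapted t V.
Proof.
move=> s0 st aV _ B mB.
have := aV measurableT B mB; rewrite /measurable/= !sF//; last exact: le_trans st.
by have [_ _ h] := F_filt; exact: h.
Qed.

Lemma measurable_process y t : 0 <= t ->
  measurable_fun setT (X y t : Omega -> borelType E).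
Proof.
move=> t0 _ B mB; rewrite setTI.
have [_ h _] := F_filt; apply: (h t t0).
by apply: (markov_adapted X_markov) => //; rewrite /= in_itv/= t0.
Qed.

Lemma adapted_process (f : E -> R) y t : 0 <= t ->
  measurable_fun setT (f : borelType E -> R) -> adapted t (fun w => f (X y t w)).
Proof.
move=> t0 mf _ B mB; rewrite setTI /measurable/= sF//.
have := mf measurableT B mB; rewrite setTI => mfB.
by apply: (markov_adapted X_markov (B := f @^-1` B)) => //; rewrite /= in_itv/= t0.
Qed.

Let wdirac d' (T : measurableType d') (a : R) (a0 : 0 <= a) (x : T) : {measure set T -> \bar R} :=
  mscale (NngNum a0) \d_x.

Let integral_wdirac d' (T : measurableType d') (a : R) (a0 : 0 <= a) (x : T) (h : T -> \bar R) :
  measurable_fun setT h -> (forall x, 0 <= h x)%E ->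
  (\int[wdirac a0 x]_z h z = a%:E * h x)%E.
Proof.
by move=> mh h0; rewrite ge0_integral_mscale// integral_dirac// diracT mul1e.
Qed.

Let law y t (t0 : 0 <= t) : {measure set (borelType E) -> \bar R} :=
  distribution P (mfun_Sub (mem_set (measurable_process y t0))).

Let integral_law y t (t0 : 0 <= t) (h : borelType E -> \bar R) :
  measurable_fun setT h -> (forall x, 0 <= h x)%E ->
  (\int[law y t0]_z h z = \int[P]_w h (X y t w))%E.
Proof.
by move=> mh h0; rewrite /law /distribution ge0_integral_pushforward//.
Qed.

Let measurable_law t (t0 : 0 <= t) (B : set (borelType E)) : measurable B ->
  measurable_fun setT ((fun y => law y t0 B) : borelType E -> \bar R).
Proof.
move=> mB; have := markov_kernel X_markov (t := t) (B := B); apply => //.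
by rewrite /= in_itv/= t0.
Qed.

(** The Markov property tests against events of [F s]. The two sides are mixtures of weighted Dirac
    masses on Omega equipped with the sigma-algebra [F s], equal on those events, hence equal on any
    nonnegative adapted [V]. *)
Lemma markov_weight x s t (V : Omega -> R) (B : set (borelType E)) :
  0 <= s -> 0 <= t -> adapted s V -> (forall w, 0 <= V w) -> measurable B ->
  (\int[P]_w ((V w)%:E * (\1_B (X x (s + t) w))%:E) =
   \int[P]_w ((V w)%:E * P (X (X x s w) t @^-1` B)))%E.
Proof.
move=> s0 t0 aV V0 mB.
have mXs := measurable_process x s0.
have st0 : 0 <= s + t by exact: addr_ge0.
pose S := g_sigma_algebraType (F s).
have SE : @measurable _ S = F s by rewrite /measurable/= sF.
have subS : F s `<=` measurable by have [_ h _] := F_filt; exact: h.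
have b0 w : 0 <= (\1_B (X x (s + t) w) : R) by [].
have k0 w : 0 <= fine (P (X (X x s w) t @^-1` B)) by rewrite fine_ge0.
have kfin w : (fine (P (X (X x s w) t @^-1` B)))%:E = P (X (X x s w) t @^-1` B).
  rewrite fineK// fin_num_measure//.
  by have := measurable_process (X x s w) t0 measurableT mB; rewrite setTI.
pose K1 w : {measure set S -> \bar R} := wdirac (b0 w) (w : S).
pose K2 w : {measure set S -> \bar R} := wdirac (k0 w) (w : S).
have mind (A : set S) : measurable A -> measurable_fun setT (fun w : Omega => (\1_A w)%:E : \bar R).
  by move=> mA; apply/measurable_EFinP/measurable_indic/subS; rewrite -SE.
have mk : measurable_fun setT (fun w => P (X (X x s w) t @^-1` B)).
  exact: (measurableT_comp (measurable_law t0 mB) mXs).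
have mb : measurable_fun setT (fun w => (\1_B (X x (s + t) w))%:E : \bar R).
  apply/measurable_EFinP.
  apply: (@measurableT_comp _ _ _ _ _ _ (\1_B : borelType E -> R)); first exact: measurable_indic.
  exact: measurable_process.
have mVE : measurable_fun (setT : set S) (EFin \o V) by exact/measurable_EFinP.
have V0E (z : S) : (0 <= (EFin \o V) z)%E by rewrite /= lee_fin.
have mK1 A : measurable A -> measurable_fun setT (K1 ^~ A).
  by move=> mA; apply: emeasurable_funM; [exact: mb|exact: mind].
have mK2 A : measurable A -> measurable_fun setT (K2 ^~ A).
  move=> mA.
  rewrite (_ : K2 ^~ A = fun w => (P (X (X x s w) t @^-1` B) * (\1_A w)%:E)%E).
    by apply: emeasurable_funM; [exact: mk|exact: mind].
  by apply/funext => w; rewrite -kfin.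
have K12 A : measurable A -> (\int[P]_w K1 w A = \int[P]_w K2 w A)%E.
  move=> mA; have mA' : F s A by rewrite -SE.
  have mA2 : @measurable _ Omega A by exact: subS.
  have := markov_property X_markov (x := x) (s := s) (t := t) (B := B) (A := A).
  rewrite /= !in_itv/= s0 t0 => /(_ I isT isT mB mA') E1.
  transitivity (P (A `&` X x (s + t) @^-1` B)).
    have mXB : measurable (X x (s + t) @^-1` B).
      by have := measurable_process x st0 measurableT mB; rewrite setTI.
    have mAX : @measurable _ Omega (A `&` X x (s + t) @^-1` B) by exact: measurableI.
    transitivity (\int[P]_w (\1_(A `&` X x (s + t) @^-1` B) w)%:E)%E; last first.
      by rewrite integral_indic// setIT.
    apply: eq_integral => w _.
    by rewrite indicI /= mulrC EFinM.
  rewrite E1 integral_mkcond; apply: eq_integral => w _.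
  transitivity (P (X (X x s w) t @^-1` B) * (\1_A w)%:E)%E; last first.
    transitivity ((fine (P (X (X x s w) t @^-1` B)))%:E * (\1_A w)%:E)%E => //.
    by rewrite kfin.
  by rewrite patchE indicE; case: (w \in A); rewrite ?mule1 ?mule0.
have mix := mixture_eq mK1 mK2 K12 mVE V0E.
transitivity (\int[P]_w \int[K1 w]_z (EFin \o V) z)%E.
  by apply: eq_integral => w _; rewrite /K1 integral_wdirac//= muleC.
rewrite mix; apply: eq_integral => w _.
by rewrite /K2 integral_wdirac//= kfin muleC.
Qed.

(** Second extension, now in the state variable: Dirac masses at X_(s+t) with weight V are compared
    with V times the transition law from X_s. *)
Lemma markov_ge0 x s t (V : Omega -> R) (h : borelType E -> \bar R) :
  0 <= s -> 0 <= t -> adapted s V -> (forall w, 0 <= V w) ->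
  measurable_fun setT h -> (forall z, 0 <= h z)%E ->
  (\int[P]_w ((V w)%:E * h (X x (s + t) w)) =
   \int[P]_w ((V w)%:E * \int[P]_w' h (X (X x s w) t w')))%E.
Proof.
move=> s0 t0 aV V0 mh h0.
have mXs := measurable_process x s0.
have mXst := measurable_process x (addr_ge0 s0 t0).
have mV : measurable_fun setT V := measurable_adapted s0 aV.
have mVE : measurable_fun setT (EFin \o V) by exact/measurable_EFinP.
pose K1 w : {measure set (borelType E) -> \bar R} :=
  wdirac (V0 w) (X x (s + t) w : borelType E).
pose K2 w : {measure set (borelType E) -> \bar R} := mscale (NngNum (V0 w)) (law (X x s w) t0).
have mK1 A : measurable A -> measurable_fun setT (K1 ^~ A).
  move=> mA; apply: emeasurable_funM; first exact: mVE.
  apply/measurable_EFinP.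
  by apply: (@measurableT_comp _ _ _ _ _ _ (\1_A : borelType E -> R)); [exact: measurable_indic|].
have mK2 A : measurable A -> measurable_fun setT (K2 ^~ A).
  move=> mA; apply: emeasurable_funM; first exact: mVE.
  exact: (measurableT_comp (measurable_law t0 mA) mXs).
have K12 A : measurable A -> (\int[P]_w K1 w A = \int[P]_w K2 w A)%E.
  by move=> mA; exact: (markov_weight x s0 t0 aV V0 mA).
have mix := mixture_eq mK1 mK2 K12 mh h0.
transitivity (\int[P]_w \int[K1 w]_z h z)%E.
  by apply: eq_integral => w _; rewrite /K1 integral_wdirac.
rewrite mix; apply: eq_integral => w _.
by rewrite /K2 ge0_integral_mscale// integral_law.
Qed.

Lemma measurable_semigroup_ge0 t (h : E -> R) : 0 <= t ->
  measurable_fun setT (h : borelType E -> R) -> (forall z, 0 <= h z) ->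
  measurable_fun setT (semigroup P X t h : borelType E -> R).
Proof.
move=> t0 mh h0; have mhE : measurable_fun setT (EFin \o (h : borelType E -> R)).
  exact/measurable_EFinP.
have := @measurable_fun_integral_kernel _ _ (borelType E) (borelType E) R (fun y : borelType E => law y t0)
  (fun B mB => measurable_law t0 mB) (EFin \o h) h0 mhE.
move=> mI.
rewrite (_ : semigroup P X t h = fun y => fine (\int[law y t0]_z (EFin \o h) z)%E).
  exact: measurableT_comp mI.
by apply/funext => y; rewrite integral_law.
Qed.

Lemma measurable_semigroup t (h : E -> R) : 0 <= t ->
  measurable_fun setT (h : borelType E -> R) ->
  (forall y, L1 P (fun w => h (X y t w))) ->
  measurable_fun setT (semigroup P X t h : borelType E -> R).
Proof.
move=> t0 mh Lh.
pose hp z := `|h z|; pose hm z := `|h z| - h z.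
have mhp : measurable_fun setT (hp : borelType E -> R).
  by apply: measurableT_comp mh; exact: normr_measurable.
have mhm : measurable_fun setT (hm : borelType E -> R) by exact: measurable_funB.
rewrite (_ : semigroup P X t h = fun y => semigroup P X t hp y - semigroup P X t hm y).
  apply: measurable_funB; apply: measurable_semigroup_ge0 => // z; first by rewrite /hp.
  by rewrite /hm subr_ge0 ler_norm.
apply/funext => y; rewrite /semigroup -ERB; [|exact: L1_norm|exact/L1B/Lh/L1_norm].
by apply: eq_Rintegral => w _; rewrite /hp /hm; ring.
Qed.

Lemma markov_expectation_ge0 x s t (V : Omega -> R) (M : R) (h : E -> R) :
  0 <= s -> 0 <= t -> adapted s V -> (forall w, 0 <= V w <= M) ->
  measurable_fun setT (h : borelType E -> R) -> (forall z, 0 <= h z) ->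
  L1 P (fun w => h (X x (s + t) w)) -> (forall y, L1 P (fun w => h (X y t w))) ->
  L1 P (fun w => semigroup P X t h (X x s w)) /\
  \int[P]_w (V w * h (X x (s + t) w)) = \int[P]_w (V w * semigroup P X t h (X x s w)).
Proof.
move=> s0 t0 aV VM mh h0 Lst Ly.
have mhE : measurable_fun setT (EFin \o (h : borelType E -> R)) by exact/measurable_EFinP.
have h0E z : (0 <= (EFin \o h) z)%E by rewrite /= lee_fin.
have eqV (U : Omega -> R) : adapted s U -> (forall w, 0 <= U w) ->
    (\int[P]_w (U w * h (X x (s + t) w))%:E =
     \int[P]_w (U w * semigroup P X t h (X x s w))%:E)%E.
  move=> aU U0; have := markov_ge0 x s0 t0 aU U0 mhE h0E => /= E1.
  under eq_integral do rewrite EFinM.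
  rewrite E1; apply: eq_integral => w _.
  by rewrite EFinM /semigroup (L1_EFin (Ly _)).
split; last by rewrite /Rintegral eqV// => w; case/andP: (VM w).
have a1 : adapted s (fun=> 1) by exact: measurable_cst.
have := eqV _ a1 (fun=> ler01).
under eq_integral do rewrite mul1r; under [in X in _ = X]eq_integral do rewrite mul1r.
rewrite -(L1_EFin Lst) => E1.
have mP : measurable_fun setT (fun w => semigroup P X t h (X x s w)).
  exact: (measurableT_comp (measurable_semigroup_ge0 t0 mh h0) (measurable_process x s0)).
have P0 w : 0 <= semigroup P X t h (X x s w) by apply: Rintegral_ge0.
have le1 : (\int[P]_w (semigroup P X t h (X x s w))%:E <=
    (\int[P]_w h (X x (s + t) w))%:E)%E by rewrite -E1.
by have [] := L1_ge0 mP P0 le1.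
Qed.

(** Signed data are reduced to nonnegative ones by V = (V + M) - M and h = |h| - (|h| - h); the
    shift keeps the weights bounded, so every piece stays integrable. *)
Lemma markov_expectation x s t (V : Omega -> R) (M : R) (h : E -> R) :
  0 <= s -> 0 <= t -> adapted s V -> (forall w, `|V w| <= M) ->
  measurable_fun setT (h : borelType E -> R) ->
  L1 P (fun w => h (X x (s + t) w)) -> (forall y, L1 P (fun w => h (X y t w))) ->
  L1 P (fun w => semigroup P X t h (X x s w)) /\
  \int[P]_w (V w * h (X x (s + t) w)) = \int[P]_w (V w * semigroup P X t h (X x s w)).
Proof.
move=> s0 t0 aV VM mh Lst Ly.
pose hp z := `|h z|; pose hm z := `|h z| - h z.
have mhp : measurable_fun setT (hp : borelType E -> R).
  by apply: measurableT_comp mh; exact: normr_measurable.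
have mhm : measurable_fun setT (hm : borelType E -> R) by exact: measurable_funB.
have hp0 z : 0 <= hp z by rewrite /hp.
have hm0 z : 0 <= hm z by rewrite /hm subr_ge0 ler_norm.
have Lp y u : L1 P (fun w => h (X y u w)) -> L1 P (fun w => hp (X y u w)) by exact: L1_norm.
have Lm y u : L1 P (fun w => h (X y u w)) -> L1 P (fun w => hm (X y u w)).
  by move=> Lh; apply: L1B => //; exact: L1_norm.
have semE y : semigroup P X t h y = semigroup P X t hp y - semigroup P X t hm y.
  rewrite /semigroup -ERB; [|exact: Lp|exact: Lm].
  by apply: eq_Rintegral => w _; rewrite /hp /hm; ring.
pose V1 w := V w + M; pose V2 (w : Omega) := M.
have aV1 : adapted s V1 by apply: measurable_funD; [exact: aV|exact: measurable_cst].
have aV2 : adapted s V2 by exact: measurable_cst.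
have b1 w : 0 <= V1 w <= M + M.
  by move: (VM w); rewrite /V1 ler_norml => /andP[? ?]; apply/andP; split; lra.
have b2 w : 0 <= V2 w <= M by rewrite /V2 lexx andbT (le_trans _ (VM w)).
have E1p := markov_expectation_ge0 s0 t0 aV1 b1 mhp hp0 (Lp _ _ Lst) (fun y => Lp _ _ (Ly y)).
have E1m := markov_expectation_ge0 s0 t0 aV1 b1 mhm hm0 (Lm _ _ Lst) (fun y => Lm _ _ (Ly y)).
have E2p := markov_expectation_ge0 s0 t0 aV2 b2 mhp hp0 (Lp _ _ Lst) (fun y => Lp _ _ (Ly y)).
have E2m := markov_expectation_ge0 s0 t0 aV2 b2 mhm hm0 (Lm _ _ Lst) (fun y => Lm _ _ (Ly y)).
have [[Lsp E1p'] [Lsm E1m']] := (E1p, E1m).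
split; first by under eq_fun do rewrite semE; exact: L1B.
have mV := measurable_adapted s0 aV.
have LV (c : R) U G : (U = V1 \/ U = V2) -> L1 P G -> L1 P (fun w => U w * G w).
  move=> UV LG; apply: (@L1_le _ _ _ _ _ (fun w => (M + M) * `|G w|)).
  - apply: measurable_funM; last exact: L1_measurable LG.
    by case: UV => ->; [exact: measurable_funD|exact: measurable_cst].
  - by apply: L1Z; exact: L1_norm.
  - move=> w; rewrite normrM ler_wpM2r//; have [u1 u2] := (b1 w, b2 w).
    case: UV => ->; first by case/andP: u1 => u1 ?; rewrite ger0_norm.
    by case/andP: u2 => u2 _; rewrite ger0_norm// /V2 lerDl.
have split4 A B : L1 P A -> L1 P B ->
   \int[P]_w (V w * (A w - B w)) =
   (\int[P]_w (V1 w * A w) - \int[P]_w (V1 w * B w)) -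
   (\int[P]_w (V2 w * A w) - \int[P]_w (V2 w * B w)).
  move=> LA LB; have [i1 i2] : (V1 = V1 \/ V1 = V2) /\ (V2 = V1 \/ V2 = V2) by split; [left|right].
  rewrite -ERB; [|exact: LV|exact: LV]; rewrite -ERB; [|exact: LV|exact: LV].
  rewrite -ERB; [|by apply: L1B; exact: LV|by apply: L1B; exact: LV].
  by apply: eq_Rintegral => w _; rewrite /V1 /V2; ring.
transitivity (\int[P]_w (V w * (hp (X x (s + t) w) - hm (X x (s + t) w)))).
  by apply: eq_Rintegral => w _; rewrite /hp /hm; ring.
rewrite split4; [|exact: Lp|exact: Lm].
rewrite E1p.2 E1m.2 E2p.2 E2m.2 -(split4 _ _ Lsp Lsm).
by apply: eq_Rintegral => w _; rewrite semE.
Qed.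

Variable mu : probability (borelType E) R.
Hypothesis mu_inv : invariant_measure P X mu.

Lemma invariant_ge0 t (h : borelType E -> \bar R) : 0 <= t ->
  measurable_fun setT h -> (forall z, 0 <= h z)%E ->
  (\int[mu]_u h u = \int[mu]_u \int[P]_w h (X u t w))%E.
Proof.
move=> t0 mh h0.
pose K1 (u : borelType E) : {measure set (borelType E) -> \bar R} := \d_u.
pose K2 (u : borelType E) : {measure set (borelType E) -> \bar R} := law u t0.
have mK1 A : measurable A -> measurable_fun setT (K1 ^~ A).
  by move=> mA; apply/measurable_EFinP; exact: measurable_indic.
have mK2 A : measurable A -> measurable_fun setT (K2 ^~ A) by exact: measurable_law.
have K12 A : measurable A -> (\int[mu]_u K1 u A = \int[mu]_u K2 u A)%E.
  move=> mA; rewrite [RHS](mu_inv t0 mA).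
  by transitivity (\int[mu]_u (\1_A u)%:E)%E => //; rewrite integral_indic// setIT.
have mix := mixture_eq mK1 mK2 K12 mh h0.
transitivity (\int[mu]_u \int[K1 u]_z h z)%E.
  by apply: eq_integral => u _; rewrite /K1 integral_dirac// diracT mul1e.
by rewrite mix; apply: eq_integral => u _; rewrite /K2 integral_law.
Qed.

Lemma invariant_expectation t (h : E -> R) : 0 <= t ->
  measurable_fun setT (h : borelType E -> R) -> L1 mu h ->
  (forall y, L1 P (fun w => h (X y t w))) ->
  L1 mu (semigroup P X t h) /\ \int[mu]_u semigroup P X t h u = \int[mu]_u h u.
Proof.
move=> t0 mh Lh Ly.
have main (g : E -> R) : measurable_fun setT (g : borelType E -> R) ->
    (forall z, 0 <= g z) -> L1 mu g -> (forall y, L1 P (fun w => g (X y t w))) ->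
    L1 mu (semigroup P X t g) /\ \int[mu]_u semigroup P X t g u = \int[mu]_u g u.
  move=> mg g0 Lg Lgy.
  have mgE : measurable_fun setT (EFin \o (g : borelType E -> R)) by exact/measurable_EFinP.
  have g0E z : (0 <= (EFin \o g) z)%E by rewrite /= lee_fin.
  have E1 : (\int[mu]_u (semigroup P X t g u)%:E = \int[mu]_u (g u)%:E)%E.
    rewrite (invariant_ge0 t0 mgE g0E); apply: eq_integral => u _.
    by rewrite /semigroup (L1_EFin (Lgy u)).
  have mP := measurable_semigroup_ge0 t0 mg g0.
  have P0 u : 0 <= semigroup P X t g u by apply: Rintegral_ge0.
  have le1 : (\int[mu]_u (semigroup P X t g u)%:E <= (\int[mu]_u g u)%:E)%E.
    by rewrite (L1_EFin Lg) E1.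
  by have [L _] := L1_ge0 mP P0 le1; split=> //; rewrite /Rintegral E1.
pose hp z := `|h z|; pose hm z := `|h z| - h z.
have mhp : measurable_fun setT (hp : borelType E -> R).
  by apply: measurableT_comp mh; exact: normr_measurable.
have mhm : measurable_fun setT (hm : borelType E -> R) by exact: measurable_funB.
have hp0 z : 0 <= hp z by rewrite /hp.
have hm0 z : 0 <= hm z by rewrite /hm subr_ge0 ler_norm.
have Lp y : L1 P (fun w => hp (X y t w)) by exact: L1_norm.
have Lm y : L1 P (fun w => hm (X y t w)) by apply: L1B => //; exact: L1_norm.
have Lmup : L1 mu hp by exact: L1_norm.
have Lmum : L1 mu hm by exact: L1B.
have semE : semigroup P X t h = fun y => semigroup P X t hp y - semigroup P X t hm y.
  apply/funext => y; rewrite /semigroup -ERB//.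
  by apply: eq_Rintegral => w _; rewrite /hp /hm; ring.
have [L1p E1p] := main _ mhp hp0 Lmup Lp.
have [L1m E1m] := main _ mhm hm0 Lmum Lm.
rewrite semE; split; first exact: L1B.
rewrite ERB// E1p E1m -ERB//.
by apply: eq_Rintegral => w _; rewrite /hp /hm; ring.
Qed.

End functional_markov.

(** * Weighted Hölder functions and couplings *)

Section weights.
Context (R : realType) (E : normedModType R).
Implicit Types (u v : E) (a b c g C K : R).

Definition weight u : R := 1 + `|u|.
Definition weight2 u v : R := 1 + `|u| + `|v|.

(** For a = p / 2 this is, up to a constant, the Hölder part of the norm of C_(p,g). In this form
    the exponent [a] can be followed through products and through the semigroup. *)
Definition holder_weight a g C (h : E -> R) := forall u v,
  `|h u - h v| <= C * (Num.min 1 (`|u - v| `^ g) * weight2 u v `^ a).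

Lemma weight_ge1 u : 1 <= weight u.
Proof. by rewrite /weight lerDl. Qed.

Lemma weight2_ge1 u v : 1 <= weight2 u v.
Proof. by rewrite /weight2 -addrA lerDl addr_ge0. Qed.

Lemma weight_ge0 u : 0 <= weight u.
Proof. exact: le_trans (weight_ge1 u). Qed.

Lemma weight2_ge0 u v : 0 <= weight2 u v.
Proof. exact: le_trans (weight2_ge1 u v). Qed.

Lemma weight2C u v : weight2 u v = weight2 v u.
Proof. by rewrite /weight2 addrAC. Qed.

Lemma weight_le2 u v : weight u <= weight2 u v.
Proof. by rewrite /weight2 lerDl. Qed.

Lemma weight2_le_mul u v : weight2 u v <= weight u * weight v.
Proof.
rewrite /weight2 /weight; have := mulr_ge0 (normr_ge0 u) (normr_ge0 v); nra.
Qed.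

Lemma norm_sub_weight2 u v : `|u - v| <= weight2 u v.
Proof. rewrite (le_trans (ler_normB _ _))// /weight2; lra. Qed.

Lemma powR_le_of_ge1 (x a b : R) : 1 <= x -> a <= b -> x `^ a <= x `^ b.
Proof. by move=> x1 ab; exact: ler_powR. Qed.

Lemma powR_mono (x y a : R) : 0 <= a -> 0 <= x -> x <= y -> x `^ a <= y `^ a.
Proof.
by move=> a0 x0 xy; apply: ge0_ler_powR => //; rewrite nnegrE// (le_trans x0).
Qed.

Lemma powR_ge1 (x a : R) : 0 <= a -> 1 <= x -> 1 <= x `^ a.
Proof. by move=> a0 x1; rewrite -(powRr0 x); exact: powR_le_of_ge1. Qed.

Lemma powR_sum2 (x y z a : R) : 0 <= a -> 0 <= x -> 0 <= y -> 0 <= z ->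
  z <= x + y -> z `^ a <= 2 `^ a * (x `^ a + y `^ a).
Proof.
move=> a0 x0 y0 z0 zxy.
wlog xy : x y x0 y0 zxy / x <= y => [hw|].
  case: (leP x y) => [|/ltW] xy; first exact: hw.
  by rewrite [x `^ a + _]addrC hw// addrC.
rewrite (@le_trans _ _ ((2 * y) `^ a))//.
  by apply: powR_mono => //; rewrite (le_trans zxy)// mulr_natl mulr2n lerD2r.
by rewrite powRM// ler_wpM2l ?powR_ge0// lerDr powR_ge0.
Qed.

Lemma weight2_powR u v a : 0 <= a ->
  weight2 u v `^ a <= 2 `^ a * (weight u `^ a + weight v `^ a).
Proof.
move=> a0; apply: powR_sum2; rewrite ?weight_ge0 ?weight2_ge0//.
by rewrite /weight2 /weight; lra.
Qed.

Lemma continuous_weight_powR a : continuous (fun u => weight u `^ a).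
Proof.
move=> u; have cw : weight v @[v --> u] --> weight u.
  by apply: cvgD; [exact: cvg_cst|exact: cvg_norm].
have w0 : 0 < weight u by exact: lt_le_trans (weight_ge1 u).
rewrite (_ : (fun v => _) = (fun v => expR (a * ln (weight v)))); last first.
  by apply/funext => v; rewrite /powR gt_eqF// (lt_le_trans _ (weight_ge1 v)).
apply: (cvg_comp _ expR); last exact: continuous_expR.
apply: cvgM; first exact: cvg_cst.
by apply: (cvg_comp _ (@ln R)); [exact: cw|exact: continuous_ln].
Qed.

Lemma measurable_weight_powR a :
  measurable_fun setT ((fun u => weight u `^ a) : borelType E -> R).
Proof. by apply: continuous_borel_measurable; exact: continuous_weight_powR. Qed.

Lemma holder_weight_continuous a g C h : 0 < g -> 0 <= a ->
  holder_weight a g C h -> continuous h.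
Proof.
move=> g0 a0 hh u; apply/cvgrPdist_le => e e0.
have C0 : 0 <= `|C| by [].
pose K := `|C| * (weight2 u u + 1) `^ a + 1.
have W0 : 0 <= `|C| * (weight2 u u + 1) `^ a by rewrite mulr_ge0 ?powR_ge0.
have K0 : 0 < K by rewrite ltr_wpDl.
pose de := Num.min 1 ((e / K) `^ g^-1).
have de0 : 0 < de by rewrite lt_min ltr01 powR_gt0// divr_gt0.
near=> v.
have uv : `|u - v| < de.
  by near: v; exact: cvgr_dist_lt.
have uv1 : `|u - v| <= 1 by rewrite ltW// (lt_le_trans uv)// ge_min lexx.
have uve : `|u - v| `^ g <= e / K.
  have -> : e / K = ((e / K) `^ g^-1) `^ g.
    by rewrite -powRrM mulVf ?gt_eqF// powRr1// divr_ge0// ltW.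
  by apply: powR_mono => //; [exact: ltW|rewrite ltW// (lt_le_trans uv)// ge_min lexx orbT].
have Muv : weight2 u v <= weight2 u u + 1.
  have : `|v| <= `|u| + `|u - v| by rewrite distrC -{1}(subrK u v) addrC ler_normD.
  by rewrite /weight2; lra.
rewrite (le_trans (hh u v))// (@le_trans _ _ (`|C| * (e / K * (weight2 u u + 1) `^ a)))//.
  rewrite (le_trans (ler_norm _))// normrM ler_wpM2l// ger0_norm; last first.
    by rewrite mulr_ge0 ?powR_ge0// le_min ler01 powR_ge0.
  apply: ler_pM; rewrite ?powR_ge0 ?le_min ?ler01 ?powR_ge0 ?ge_min ?uve ?orbT//.
  by apply: powR_mono => //; exact: weight2_ge0.
rewrite mulrCA -mulrA ler_piMr ?(ltW e0)// mulrC ler_pdivrMr// mul1r /K.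
by rewrite lerDl.
Unshelve. all: by end_near. Qed.

End weights.

(** Young's inequality is used at a scale e' by which one divides. This lemma passes to the true
    distance [e], which may be 0. *)
Lemma powR_limit0 (R : realType) (A B K e g : R) : 0 <= e -> 0 < g -> 0 <= K ->
  (forall e', 0 < e' -> e <= e' -> A <= B + K * e' `^ g) -> A <= B + K * e `^ g.
Proof.
move=> e0 g0 K0 h; move: e0; rewrite le_eqVlt => /predU1P[e0|e0]; last exact: h.
rewrite -e0 powR0 ?gt_eqF// mulr0 addr0; apply/ler_addgt0Pr => de de0.
have K1 : 0 < K + 1 by rewrite ltr_wpDl.
have := h ((de / (K + 1)) `^ g^-1); rewrite powR_gt0 ?divr_gt0// -e0 powR_ge0.
move=> /(_ isT isT) /le_trans; apply; rewrite lerD2l -powRrM mulVf ?gt_eqF//.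
rewrite powRr1 ?divr_ge0 ?(ltW de0) ?(ltW K1)// mulrCA ler_piMr ?(ltW de0)//.
by rewrite ler_pdivrMr// mul1r lerDl.
Qed.

Section coupling.
Context d (Omega : measurableType d) (R : realType) (P : probability Omega R).
Context (E : completeNormedModType R).
Hypothesis E_sep : separable E.
Variables (U V : Omega -> E).
Hypotheses (mU : measurable_fun setT (U : Omega -> borelType E))
  (mV : measurable_fun setT (V : Omega -> borelType E)).

Let mD : measurable_fun setT (fun w => `|U w - V w|).
Proof. exact: measurable_norm_sub. Qed.

Lemma L2norm_sqr e : 0 <= e ->
  (L2norm P (fun w => U w - V w)%R <= e%:E)%E ->
  L1 P (fun w => `|U w - V w| ^+ 2) /\ \int[P]_w (`|U w - V w| ^+ 2) <= e ^+ 2.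
Proof.
move=> e0; rewrite /L2norm unlock => he.
apply: L1_ge0.
- exact: (measurable_funX 2 mD).
- by move=> w; rewrite sqr_ge0.
set I := (\int[P]_w _)%E in he *.
have I0 : (0 <= I)%E by apply: integral_ge0 => w _; rewrite lee_fin sqr_ge0.
move: I0 he; case: I => [x| |] //; last by rewrite poweRyr ?invr_eq0 ?pnatr_eq0.
rewrite poweR_EFin !lee_fin => x0 he.
have -> : x = (x `^ 2^-1) ^+ 2 by rewrite powR12_sqrt// sqr_sqrtr.
by rewrite lerXn2r// nnegrE powR_ge0.
Qed.

Variables (a g C : R) (h : E -> R).
Hypotheses (a0 : 0 <= a) (g01 : 0 < g <= 1) (C0 : 0 <= C).
Hypothesis hh : holder_weight a g C h.
Hypotheses (LU : L1 P (fun w => weight (U w) `^ (2 * a)))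
  (LV : L1 P (fun w => weight (V w) `^ (2 * a))).
Variable e : R.
Hypotheses (e0 : 0 <= e) (De : (L2norm P (fun w => U w - V w)%R <= e%:E)%E).

Let moments := \int[P]_w (weight (U w) `^ (2 * a)) + \int[P]_w (weight (V w) `^ (2 * a)).

Let mh : measurable_fun setT (h : borelType E -> R).
Proof.
by apply: continuous_borel_measurable; apply: holder_weight_continuous hh => //; case/andP: g01.
Qed.

Let mdiff : measurable_fun setT (fun w => `|h (U w) - h (V w)|).
Proof.
apply: measurableT_comp; first exact: normr_measurable.
by apply: measurable_funB; [exact: (measurableT_comp mh mU)|exact: (measurableT_comp mh mV)].
Qed.

Let moments0 : 0 <= moments.
Proof. by rewrite addr_ge0//; apply: Rintegral_ge0 => w _; exact: powR_ge0. Qed.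

Let min0 (x : R) : 0 <= Num.min 1 (x `^ g).
Proof. by rewrite le_min ler01 powR_ge0. Qed.

(** Young's inequality at scale e' bounds the integrand by e'^g (1 + (|U - V| / e')^2 +
    weight2^(2a)), and the quadratic term has expectation at most 1. Only second moments of the
    distance and moments of order 2a are involved. *)
Lemma coupling_holder : L1 P (fun w => `|h (U w) - h (V w)|) /\
  \int[P]_w `|h (U w) - h (V w)| <= C * e `^ g * (2 + 2 `^ (2 * a) * moments).
Proof.
have key e' : 0 < e' -> e <= e' -> L1 P (fun w => `|h (U w) - h (V w)|) /\
   \int[P]_w `|h (U w) - h (V w)| <= 0 + C * (2 + 2 `^ (2 * a) * moments) * e' `^ g.
  move=> e'0 ee'.
  have [LD D2] : L1 P (fun w => `|U w - V w| ^+ 2) /\ \int[P]_w (`|U w - V w| ^+ 2) <= e' ^+ 2.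
    by apply: L2norm_sqr; [exact: ltW|rewrite (le_trans De)// lee_fin].
  pose G w := C * e' `^ g * (1 + (e' ^- 2 * `|U w - V w| ^+ 2 +
     2 `^ (2 * a) * (weight (U w) `^ (2 * a) + weight (V w) `^ (2 * a)))).
  have LW : L1 P (fun w => weight (U w) `^ (2 * a) + weight (V w) `^ (2 * a)) by exact: L1D.
  have LG1 : L1 P (fun w => e' ^- 2 * `|U w - V w| ^+ 2 +
     2 `^ (2 * a) * (weight (U w) `^ (2 * a) + weight (V w) `^ (2 * a))).
    by apply: L1D; exact: L1Z.
  have LG2 : L1 P (fun w => 1 + (e' ^- 2 * `|U w - V w| ^+ 2 +
     2 `^ (2 * a) * (weight (U w) `^ (2 * a) + weight (V w) `^ (2 * a)))).
    by apply: L1D => //; exact: L1_cst.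
  have LG : L1 P G by exact: L1Z.
  have hG w : `|h (U w) - h (V w)| <= G w.
    rewrite (le_trans (hh _ _))// /G -mulrA ler_wpM2l//.
    have B0 : 0 <= weight2 (U w) (V w) `^ (2 * a) by exact: powR_ge0.
    have g01' : 0 <= g <= 1 by case/andP: g01 => /ltW -> ->.
    have sq : (weight2 (U w) (V w) `^ (2 * a)) `^ 2^-1 = weight2 (U w) (V w) `^ a.
      by rewrite -powRrM; congr (_ `^ _); field.
    have := min1_powR_young (normr_ge0 (U w - V w)) B0 e'0 g01'.
    rewrite sq => /le_trans; apply.
    rewrite ler_wpM2l ?powR_ge0// -addrA lerD2l lerD//.
      by rewrite exprMn exprVn mulrC.
    by apply: weight2_powR; rewrite mulr_ge0.
  have Lh : L1 P (fun w => `|h (U w) - h (V w)|).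
    by apply: L1_le LG _ => // w; rewrite normr_id.
  split=> //; apply: (le_trans (ER_le Lh LG hG)).
  rewrite /G ERZ// ERD//; last exact: L1_cst.
  rewrite ERD; [|exact: L1Z|exact: L1Z].
  rewrite !ERZ// ERD// ER_cst -/moments add0r.
  have b1 : e' ^- 2 * \int[P]_w (`|U w - V w| ^+ 2) <= 1.
    by rewrite mulrC ler_pdivrMr ?exprn_gt0// mul1r.
  have -> : C * (2 + 2 `^ (2 * a) * moments) * e' `^ g =
    C * e' `^ g * (2 + 2 `^ (2 * a) * moments) by ring.
  rewrite ler_wpM2l ?mulr_ge0 ?powR_ge0//; lra.
have e1 : 0 < e + 1 by rewrite ltr_wpDl.
have e2 : e <= e + 1 by rewrite lerDl.
have [L _] := key _ e1 e2.
split=> //; rewrite -[leRHS]add0r mulrAC.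
case/andP: g01 => g0 _; apply: powR_limit0 => //.
  by rewrite mulr_ge0// addr_ge0// mulr_ge0// powR_ge0.
by move=> e' e'0 ee'; exact: (key e' e'0 ee').2.
Qed.

(** Where the weight Q = weight2^a is at most [K], it is replaced by [K]; elsewhere Q <= Q^2 / K.
    The moments thus appear without the factor e^g, so the two can be averaged over the starting
    points separately. *)
Lemma coupling_truncated K : 0 < K ->
  \int[P]_w `|h (U w) - h (V w)| <=
    C * (2 `^ (2 * a) * moments / K) + C * (3 * K) * e `^ g.
Proof.
move=> K0; have [Lh _] := coupling_holder; case/andP: g01 => g0 g1.
have K3 : 0 <= C * (3 * K) by rewrite !mulr_ge0// ltW.
apply: powR_limit0 => // e' e'0 ee'.
have [LD D2] : L1 P (fun w => `|U w - V w| ^+ 2) /\ \int[P]_w (`|U w - V w| ^+ 2) <= e' ^+ 2.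
    by apply: L2norm_sqr; [exact: ltW|rewrite (le_trans De)// lee_fin].
pose G w := C * (K^-1 * (2 `^ (2 * a) * (weight (U w) `^ (2 * a) + weight (V w) `^ (2 * a))) +
  K * e' `^ g * (2 + e' ^- 2 * `|U w - V w| ^+ 2)).
have LW : L1 P (fun w => weight (U w) `^ (2 * a) + weight (V w) `^ (2 * a)) by exact: L1D.
have LW2 : L1 P (fun w => 2 `^ (2 * a) * (weight (U w) `^ (2 * a) + weight (V w) `^ (2 * a))) by exact: L1Z.
have LD2 : L1 P (fun w => 2 + e' ^- 2 * `|U w - V w| ^+ 2).
  by apply: L1D; [exact: L1_cst|exact: L1Z].
have LG1 : L1 P (fun w => K^-1 * (2 `^ (2 * a) * (weight (U w) `^ (2 * a) + weight (V w) `^ (2 * a))) +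
  K * e' `^ g * (2 + e' ^- 2 * `|U w - V w| ^+ 2)).
  by apply: L1D; exact: L1Z.
have LG : L1 P G by exact: L1Z.
have hG w : `|h (U w) - h (V w)| <= G w.
  rewrite (le_trans (hh _ _))// /G ler_wpM2l//.
  set Q := weight2 _ _ `^ a; have Q0 : 0 <= Q by exact: powR_ge0.
  have Q2 : Q ^+ 2 <= 2 `^ (2 * a) * (weight (U w) `^ (2 * a) + weight (V w) `^ (2 * a)).
    rewrite /Q -powR_mulrn ?powR_ge0// -powRrM mulrC.
    by apply: weight2_powR; rewrite mulr_ge0.
  have D0 : 0 <= K * e' `^ g * (2 + e' ^- 2 * `|U w - V w| ^+ 2).
    rewrite !mulr_ge0 ?powR_ge0 ?(ltW K0)// addr_ge0// mulr_ge0 ?sqr_ge0//.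
    by rewrite invr_ge0 exprn_ge0// ltW.
  have W0 : 0 <= K^-1 * (2 `^ (2 * a) * (weight (U w) `^ (2 * a) + weight (V w) `^ (2 * a))).
    by rewrite mulr_ge0 ?invr_ge0 ?(ltW K0)// (le_trans _ Q2)// sqr_ge0.
  case: (leP Q K) => QK.
    rewrite ler_wpDl//.
    have g01' : 0 <= g <= 1 by rewrite (ltW g0).
    have := min1_powR_young (normr_ge0 (U w - V w)) ler01 e'0 g01'.
    rewrite powR1 mulr1 => hm.
    rewrite (@le_trans _ _ (Num.min 1 (`|U w - V w| `^ g) * K))//.
      by rewrite ler_wpM2l.
    rewrite mulrC -mulrA ler_wpM2l ?(ltW K0)// (le_trans hm)//.
    rewrite ler_wpM2l ?powR_ge0// exprMn exprVn; lra.
  rewrite ler_wpDr// (@le_trans _ _ Q)//.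
    by rewrite ler_piMl// ge_min lexx.
  rewrite (@le_trans _ _ (K^-1 * Q ^+ 2))//; last by rewrite ler_wpM2l// invr_ge0 ltW.
  by rewrite mulrC ler_pdivlMr// expr2 ler_wpM2l// ltW.
apply: (le_trans (ER_le Lh LG hG)).
rewrite /G ERZ// ERD; [|exact: L1Z|exact: L1Z].
rewrite ERZ// ERZ// ERD// ERZ// ERD; [|exact: L1_cst|exact: L1Z].
rewrite ER_cst ERZ// -/moments.
have b1 : e' ^- 2 * \int[P]_w (`|U w - V w| ^+ 2) <= 1.
  by rewrite mulrC ler_pdivrMr ?exprn_gt0// mul1r.
have -> : C * (2 `^ (2 * a) * moments / K) + C * (3 * K) * e' `^ g =
  C * (K^-1 * (2 `^ (2 * a) * moments) + K * e' `^ g * 3) by ring.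
rewrite ler_wpM2l// lerD2l ler_wpM2l ?mulr_ge0 ?powR_ge0 ?(ltW K0)//; lra.
Qed.

End coupling.

(** * Moments and mixing *)

Section moments.
Context d (Omega : measurableType d) (R : realType) (P : probability Omega R).

(** After normalizing y = (1 + Z) / c, the inequality y^a <= 1 + y^r gives lower moments with the
    right power c^a of the scale. *)
Lemma moment_powR (Z : Omega -> R) (r c K : R) :
  measurable_fun setT Z -> (forall w, 0 <= Z w) -> 0 <= r -> 1 <= c -> 0 <= K ->
  ('E_P[fun w => (Z w `^ r)%R] <= (K * c `^ r)%:E)%E ->
  forall a, 0 <= a <= r -> L1 P (fun w => (1 + Z w) `^ a) /\
    \int[P]_w ((1 + Z w) `^ a) <= (1 + 2 `^ r * (1 + K)) * c `^ a.
Proof.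
move=> mZ Z0 r0 c1 K0; rewrite unlock => hE a /andP[a0 ar].
have c0 : 0 < c by exact: lt_le_trans c1.
have cr0 : 0 < c `^ r by rewrite powR_gt0.
have mZr : measurable_fun setT (fun w => Z w `^ r).
  exact: (measurableT_comp (measurable_powR r) mZ).
have [Lr Ir] := L1_ge0 mZr (fun w => powR_ge0 _ _) hE.
pose G w := c `^ a * ((1 + 2 `^ r) + 2 `^ r / c `^ r * Z w `^ r).
have LG1 : L1 P (fun w => (1 + 2 `^ r) + 2 `^ r / c `^ r * Z w `^ r).
  by apply: L1D; [exact: L1_cst|exact: L1Z].
have LG : L1 P G by exact: L1Z.
have hG w : `|(1 + Z w) `^ a| <= G w.
  rewrite ger0_norm ?powR_ge0//; have Z1 : 0 <= 1 + Z w by rewrite addr_ge0.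
  have -> : (1 + Z w) `^ a = c `^ a * ((1 + Z w) / c) `^ a.
    by rewrite -powRM ?(ltW c0) ?divr_ge0 ?(ltW c0)// mulrC divfK ?gt_eqF.
  rewrite /G ler_wpM2l ?powR_ge0//.
  set y := (1 + Z w) / c; have y0 : 0 <= y by rewrite divr_ge0// ltW.
  have ya : y `^ a <= 1 + y `^ r.
    case: (leP y 1) => y1.
      rewrite (@le_trans _ _ 1) ?lerDl ?powR_ge0//.
      by have := powR_mono a0 y0 y1; rewrite powR1.
    by rewrite (@le_trans _ _ (y `^ r)) ?lerDr//; apply: powR_le_of_ge1 => //; exact: ltW.
  rewrite (le_trans ya)// -addrA lerD2l.
  have h1 : (1 + Z w) `^ r <= 2 `^ r * (1 `^ r + Z w `^ r) by exact: powR_sum2.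
  rewrite powR1 in h1.
  have -> : y `^ r = (1 + Z w) `^ r / c `^ r.
    by rewrite /y powRM// ?invr_ge0 ?(ltW c0)// -powR_inv1 ?(ltW c0)// -powRrM mulN1r powRN.
  rewrite (@le_trans _ _ (2 `^ r * (1 + Z w `^ r) / c `^ r))//.
    by rewrite ler_wpM2r// invr_ge0 ltW.
  have -> : 2 `^ r * (1 + Z w `^ r) / c `^ r = 2 `^ r * (c `^ r)^-1 + 2 `^ r / c `^ r * Z w `^ r by ring.
  rewrite lerD2r ler_piMr ?powR_ge0// invf_le1//; exact: powR_ge1.
have La : L1 P (fun w => (1 + Z w) `^ a).
  apply: L1_le LG hG; apply: (measurableT_comp (measurable_powR a)).
  by apply: measurable_funD => //; exact: measurable_cst.
split=> //; apply: (le_trans (ER_le La LG _)).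
  by move=> w; rewrite (le_trans (ler_norm _))// hG.
rewrite /G ERZ// ERD; [|exact: L1_cst|exact: L1Z].
rewrite ER_cst ERZ// mulrC ler_wpM2r ?powR_ge0//.
have : 2 `^ r / c `^ r * \int[P]_w (Z w `^ r) <= 2 `^ r * K.
  by rewrite -mulrA ler_wpM2l ?powR_ge0// mulrC ler_pdivrMr.
lra.
Qed.

End moments.

Section ergodic_estimates.
Context (R : realType) (E : completeNormedModType R) (E_sep : separable E).
Context d (Omega : measurableType d) (P : probability Omega R).
Context (F : R -> set (set Omega)) (F_filt : filtration F).
Context (X : E -> R -> Omega -> E) (X_markov : markov_family P `[0, +oo[ F setT X).
Context (r rt gamma1 beta : R) (rho : R -> R).
Hypothesis A1 : ergodic_process P X r rt gamma1 beta rho.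
Context (mu : probability (borelType E) R) (mu_inv : invariant_measure P X mu).

Let mX x t : 0 <= t -> measurable_fun setT (X x t : Omega -> borelType E).
Proof. by move=> t0; exact: (measurable_process F_filt X_markov). Qed.

Let mN x t : 0 <= t -> measurable_fun setT (fun w => `|X x t w|).
Proof.
move=> t0; apply: (measurableT_comp _ (mX x t0)).
by apply: continuous_borel_measurable => z; exact: norm_continuous.
Qed.

Lemma moment_process : exists2 C, 1 <= C & forall a x t, 0 <= a <= r -> 0 <= t ->
  L1 P (fun w => weight (X x t w) `^ a) /\
  \int[P]_w (weight (X x t w) `^ a) <= C * weight x `^ (rt * a).
Proof.
have [L1 L10 hL1] := ep_moment A1; have r2 := ep_r A1; have rt1 := ep_rt A1.
have r0 : 0 <= r by exact: le_trans r2.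
exists (1 + 2 `^ r * (1 + 2 * L1)).
  by rewrite lerDl mulr_ge0 ?powR_ge0// addr_ge0// mulr_ge0// ltW.
move=> a x t ar t0; rewrite [rt * a]mulrC mulrC mulrC powRrM.
have rt0 : 0 <= rt by exact: le_trans rt1.
have -> : (weight x `^ a) `^ rt = (weight x `^ rt) `^ a by exact: powRAC.
have c1 : 1 <= weight x `^ rt by apply: powR_ge1 => //; exact: weight_ge1.
apply: (moment_powR (mN x t0)) => //; first by rewrite mulr_ge0// ltW.
apply: (le_trans (hL1 x t t0)); rewrite lee_fin -mulrA mulrCA ler_wpM2l ?(ltW L10)//.
rewrite -powRrM mulr2n mulrDl mul1r lerD//.
  apply: powR_ge1; rewrite ?mulr_ge0//; exact: weight_ge1.
by apply: powR_mono; rewrite ?mulr_ge0// /weight lerDr.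
Qed.

(** Integrability of rho^gamma1 does not make rho tend to 0, but a positive lower bound on a
    half-line would make the integral infinite. One good time is enough for every later use. *)
Lemma rate_arbitrarily_small e : 0 < e -> exists2 t, 0 <= t & rho t < e.
Proof.
move=> e0; apply: contrapT => /forall2NP h.
have {}h t : 0 <= t -> e <= rho t.
  by move=> t0; have [//|/negP] := h t; rewrite -leNgt.
have /andP[g0 g1] := ep_gamma1 A1.
have := ep_rho_int A1; rewrite ltNge => /negP; apply.
have -> : (+oo = \int[lebesgue_measure]_(t in `[0%R, +oo[) (e `^ gamma1)%:E)%E.
  rewrite integral_cst//= lebesgue_measure_itv/= ltry addye//.
  by rewrite mulry gtr0_sg ?mul1e// powR_gt0.
apply: ge0_le_integral => //.
- by move=> t _; rewrite lee_fin powR_ge0.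
- apply/measurable_EFinP; apply: (measurableT_comp (measurable_powR gamma1)).
  by apply: subspace_continuous_measurable_fun => //; exact: ep_rho_cont A1.
- move=> t /=; rewrite in_itv/= andbT => t0; rewrite lee_fin.
  by apply: powR_mono; [exact: ltW|exact: ltW|exact: h].
Qed.

Let measurable_norm : measurable_fun setT ((fun u => `|u|) : borelType E -> R).
Proof. by apply: continuous_borel_measurable => z; exact: norm_continuous. Qed.

(* Coupling with the process started at 0: along times where [rho] is small,  *)
(* the law of the process started from any point has almost the moments of    *)
(* the one started at 0, which are bounded uniformly in time.                 *)
Let truncated_moment_invariant : exists2 C, 0 <= C & forall K, 0 < K ->
  \int[mu]_u (Num.min `|u| K `^ r) <= C.
Proof.
have [L1c L10 hL1] := ep_moment A1; have [L2 L20 hL2] := ep_contract A1.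
have r2 := ep_r A1; have r0 : 0 <= r by exact: le_trans r2.
pose C0 := L1c * (1 + `|0 : E| `^ (rt * r)).
have C00 : 0 <= C0 by rewrite mulr_ge0 ?(ltW L10)// addr_ge0// powR_ge0.
exists (2 `^ r * C0) => [|K K0]; first by rewrite mulr_ge0// powR_ge0.
have Kr0 : 0 <= K `^ r by exact: powR_ge0.
have min_K z : 0 <= z -> 0 <= Num.min z K by move=> z0; rewrite le_min z0 ltW.
pose hK (u : E) := Num.min `|u| K `^ r.
have mmin d' (T : measurableType d') (Z : T -> R) : measurable_fun setT Z ->
    measurable_fun setT (fun w => Num.min (Z w) K `^ r).
  move=> mZ; apply: (measurableT_comp (measurable_powR r)).
  by apply: measurable_minr => //; exact: measurable_cst.
have mhK : measurable_fun setT (hK : borelType E -> R) by exact: mmin.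
have hKb u : `|hK u| <= K `^ r.
  rewrite ger0_norm ?powR_ge0//; apply: powR_mono => //; first exact: min_K.
  by rewrite ge_min lexx orbT.
have LhK : L1 mu hK by exact: L1_bounded mhK hKb.
have LhKX y t : 0 <= t -> L1 P (fun w => hK (X y t w)).
  by move=> t0; apply: L1_bounded (fun w => hKb _); apply: (measurableT_comp mhK); exact: mX.
(* From min(D, K)^r <= K^(r-2) D^2, with D the distance of the two coupled processes, whose second
   moment is bounded by contraction. The other bound K^r dominates in [b n], so that its mean under
   [mu] tends to 0. *)
pose q (u : E) := K `^ (r - 2) * (L2 * `|u - 0| * (1 + `|u| `^ beta + `|0 : E| `^ beta)) ^+ 2.
have q0 u : 0 <= q u by rewrite mulr_ge0 ?powR_ge0// sqr_ge0.
pose b (n : nat) (u : E) := Num.min (K `^ r) (q u * (n.+1%:R^-1) ^+ 2).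
have mb n : measurable_fun setT (b n : borelType E -> R).
  apply: measurable_minr; first exact: measurable_cst.
  apply: measurable_funM; last exact: measurable_cst.
  apply: measurable_funM; first exact: measurable_cst.
  apply: measurable_funX; apply: measurable_funM.
    apply: measurable_funM; first exact: measurable_cst.
    by rewrite (_ : (fun u : borelType E => _) = fun u => `|u : E|)//; apply/funext => u; rewrite subr0.
  apply: measurable_funD; last exact: measurable_cst.
  apply: measurable_funD; first exact: measurable_cst.
  exact: (measurableT_comp (measurable_powR beta) measurable_norm).
have b0 n u : 0 <= b n u by rewrite le_min Kr0 mulr_ge0 ?q0 ?sqr_ge0.
have bK n u : `|b n u| <= K `^ r by rewrite ger0_norm// ge_min lexx.
have Lb n : L1 mu (b n) by exact: L1_bounded (mb n) (bK n).
have step n : \int[mu]_u hK u <= 2 `^ r * (C0 + \int[mu]_u b n u).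
  have n1 : 0 < (n.+1%:R^-1 : R) by rewrite invr_gt0.
  have [t t0 tn] := rate_arbitrarily_small n1.
  have [LPt <-] := invariant_expectation F_filt X_markov mu_inv t0 mhK LhK (fun y => LhKX y t t0).
  have LC : L1 mu (fun u => C0 + b n u) by apply: L1D => //; exact: L1_cst.
  rewrite -(ER_cst mu C0) -ERD//; last exact: L1_cst.
  rewrite -ERZ//; apply: ER_le => //; first exact: L1Z.
  move=> u; rewrite /semigroup.
  have mD : measurable_fun setT (fun w => `|X u t w - X 0 t w|).
    by apply: measurable_norm_sub => //; exact: mX.
  have e0 : 0 <= L2 * `|u - 0| * (1 + `|u| `^ beta + `|0 : E| `^ beta) * rho t.
    apply: mulr_ge0; last exact: (ep_rho_ge0 A1).
    by apply: mulr_ge0; [rewrite mulr_ge0// ltW|rewrite !addr_ge0 ?powR_ge0].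
  have [LD2 D2] := L2norm_sqr E_sep (mX u t0) (mX 0 t0) e0 (hL2 u 0 t t0).
  have mX0r : measurable_fun setT (fun w => `|X 0 t w| `^ r).
    exact: (measurableT_comp (measurable_powR r) (mN 0 t0)).
  have := hL1 0 t t0; rewrite unlock => h0.
  have [LX0 X0] := L1_ge0 mX0r (fun w => powR_ge0 _ _) h0.
  have LDK : L1 P (fun w => Num.min `|X u t w - X 0 t w| K `^ r).
    apply: (@L1_bounded _ _ _ _ _ (K `^ r)); first exact: mmin.
    move=> w; rewrite ger0_norm ?powR_ge0//; apply: powR_mono => //; first exact: min_K.
    by rewrite ge_min lexx orbT.
  apply: (@le_trans _ _ (\int[P]_w (2 `^ r * (`|X 0 t w| `^ r + Num.min `|X u t w - X 0 t w| K `^ r)))).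
    apply: ER_le; [exact: LhKX|by apply: L1Z; exact: L1D|move=> w].
    apply: powR_sum2; rewrite ?min_K// /Num.min.
    have := ler_normD (X 0 t w) (X u t w - X 0 t w); rewrite subrKC => tri.
    have := normr_ge0 (X 0 t w).
    by case: ltP => h1; case: ltP => h2; lra.
  rewrite ERZ ?ERD//; last exact: L1D.
  rewrite ler_wpM2l ?powR_ge0// lerD// le_min; apply/andP; split.
    rewrite -(ER_cst P (K `^ r)); apply: ER_le => //; first exact: L1_cst.
    move=> w; apply: powR_mono => //; first exact: min_K.
    by rewrite ge_min lexx orbT.
  apply: (@le_trans _ _ (\int[P]_w (K `^ (r - 2) * `|X u t w - X 0 t w| ^+ 2))).
    apply: ER_le => //; first exact: L1Z.
    move=> w; set D := `|_|.
    have D0 : 0 <= D by exact: normr_ge0.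
    have rE : r = (r - 2) + 2%:R by rewrite subrK.
    rewrite {1}rE powRD; last by rewrite subrK; apply/implyP => /eqP r00; move: r2; rewrite r00; lra.
    rewrite powR_mulrn ?min_K//; apply: ler_pM; rewrite ?powR_ge0 ?sqr_ge0//.
      by apply: powR_mono; rewrite ?min_K ?subr_ge0// ge_min lexx orbT.
    by rewrite lerXn2r ?nnegrE ?min_K// ge_min lexx.
  rewrite ERZ// /q -mulrA ler_wpM2l ?powR_ge0// (le_trans D2)// exprMn.
  rewrite ler_wpM2l ?sqr_ge0// lerXn2r ?nnegrE ?(ep_rho_ge0 A1)//; exact: ltW.
have bcvg u : b n u @[n --> \oo] --> (0 : R).
  have h1 : q u * (n.+1%:R^-1) ^+ 2 @[n --> \oo] --> (0 : R).
    rewrite -(mulr0 (q u)); apply: cvgM; first exact: cvg_cst.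
    rewrite -(mulr0 (0 : R)); under eq_fun do rewrite expr2.
    by apply: cvgM; exact: cvg_harmonic.
  apply: (squeeze_cvgr _ (cvg_cst 0) h1); near=> n.
  by rewrite b0/= ge_min lexx orbT.
have [_ Icvg] := ER_dominated mb bcvg (L1_cst mu (K `^ r)) bK.
rewrite Rintegral_cst// mul0r in Icvg.
have lim1 : 2 `^ r * (C0 + \int[mu]_u b n u) @[n --> \oo] --> 2 `^ r * (C0 + 0).
  by apply: cvgM; [exact: cvg_cst|apply: cvgD; [exact: cvg_cst|exact: Icvg]].
rewrite addr0 in lim1.
rewrite -(cvg_lim _ lim1)//; apply: limr_ge; first by apply/cvg_ex; exists (2 `^ r * C0).
by near=> n; exact: step.
Unshelve. all: by end_near. Qed.

Lemma moment_invariant : exists2 C, 0 <= C & forall a, 0 <= a <= r ->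
  L1 mu (fun u => weight u `^ a) /\ \int[mu]_u (weight u `^ a) <= C.
Proof.
have [C C0 hC] := truncated_moment_invariant.
have r2 := ep_r A1; have r0 : 0 <= r by exact: le_trans r2.
exists (1 + 2 `^ r * (1 + C)); first by rewrite addr_ge0// mulr_ge0 ?powR_ge0// addr_ge0.
move=> a ar.
have hE : ('E_mu[fun u => (`|u : E| `^ r)%R] <= (C * 1 `^ r)%:E)%E.
  rewrite powR1 mulr1 unlock.
  pose hn (n : nat) (u : borelType E) : \bar R := (Num.min `|u : E| n.+1%:R `^ r)%:E.
  have mn n : measurable_fun setT (fun u : borelType E => Num.min `|u : E| n.+1%:R `^ r).
    apply: (measurableT_comp (measurable_powR r)).
    by apply: measurable_minr => //; exact: measurable_cst.
  have min_K (n : nat) (z : R) : 0 <= z -> 0 <= Num.min z n.+1%:R by move=> z0; rewrite le_min z0 ler0n.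
  have hcvg (u : borelType E) : hn n u @[n --> \oo] --> (`|u : E| `^ r)%:E.
    apply: cvg_near_cst; near=> n; rewrite /hn min_l//.
    rewrite (@le_trans _ _ n%:R) ?ler_nat//; near: n; exact: nbhs_infty_ger.
  rewrite (_ : (\int[mu]_w (`|w : E| `^ r)%:E)%E = (\int[mu]_u limn (hn^~ u))%E); last first.
    by apply: eq_integral => u _; apply/esym/cvg_lim => //; exact: hcvg.
  have mono u : {homo hn^~ u : n m / (n <= m)%N >-> (n <= m)%E}.
    move=> n m nm; rewrite lee_fin; apply: powR_mono; rewrite ?min_K//.
    rewrite le_min ge_min lexx/= ge_min.
    by apply/orP; right; rewrite ler_nat ltnS.
  have mhn n : measurable_fun setT (hn n) by apply/measurable_EFinP; exact: mn.
  have hn0 n u : [set: borelType E] u -> (0 <= hn n u)%E by move=> _; rewrite lee_fin powR_ge0.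
  have mc := @cvg_monotone_convergence _ _ _ mu setT measurableT hn mhn hn0 (fun u _ => mono u).
  have hle n : (\int[mu]_u hn n u <= C%:E)%E.
    rewrite /hn -L1_EFin; first by rewrite lee_fin hC// ltr0n.
    apply: (@L1_bounded _ _ _ _ _ (n.+1%:R `^ r)); first exact: mn.
    move=> u; rewrite ger0_norm ?powR_ge0//; apply: powR_mono; rewrite ?min_K//.
    by rewrite ge_min lexx orbT.
  rewrite -(cvg_lim _ mc)//; apply: lime_le; first by apply/cvg_ex; eexists; exact: mc.
  by near=> n; exact: hle.
have := @moment_powR _ _ _ mu (fun u : borelType E => `|u : E|) r 1 C measurable_norm
  (fun u => normr_ge0 _) r0 (lexx 1) C0 hE a ar.
by rewrite powR1 mulr1.
Unshelve. all: by end_near. Qed.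

End ergodic_estimates.

(** * Regularity and decay of the semigroup, mixing along the path *)

Section semigroup_estimates.
Context (R : realType) (E : completeNormedModType R) (E_sep : separable E).
Context d (Omega : measurableType d) (P : probability Omega R).
Context (F : R -> set (set Omega)) (F_filt : filtration F).
Context (X : E -> R -> Omega -> E) (X_markov : markov_family P `[0, +oo[ F setT X).
Context (r rt gamma1 beta : R) (rho : R -> R).
Hypothesis A1 : ergodic_process P X r rt gamma1 beta rho.
Context (mu : probability (borelType E) R) (mu_inv : invariant_measure P X mu).

Let mX x t : 0 <= t -> measurable_fun setT (X x t : Omega -> borelType E).
Proof. by move=> t0; exact: (measurable_process F_filt X_markov). Qed.

Let gamma1_gt0 : 0 < gamma1. Proof. by case/andP: (ep_gamma1 A1). Qed.

Let r_ge0 : 0 <= r. Proof. exact: le_trans (ep_r A1). Qed.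

Let rt_ge0 : 0 <= rt. Proof. exact: le_trans (ep_rt A1). Qed.

Let beta_ge0 : 0 <= beta. Proof. by case/andP: (ep_beta A1). Qed.

Lemma holder_growth (a g C : R) (h : E -> R) u : 0 <= C ->
  holder_weight a g C h -> 0 <= a -> `|h u| <= (`|h 0| + C) * weight u `^ a.
Proof.
move=> C0 hh a0; have := hh u 0.
have -> : weight2 u 0 = weight u by rewrite /weight2 normr0 addr0.
move=> h1; have w1 : 1 <= weight u `^ a by apply: powR_ge1 => //; exact: weight_ge1.
have h2 : `|h u| <= `|h 0| + `|h u - h 0|.
  by rewrite -{1}(subrKC (h 0) (h u)) ler_normD.
rewrite (le_trans h2)// mulrDl lerD//; first by rewrite ler_peMr.
rewrite (le_trans h1)// ler_wpM2l// ler_piMl ?powR_ge0// ge_min lexx//.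
Qed.

Let mholder a C h : 0 <= a -> holder_weight a gamma1 C h ->
  measurable_fun setT (h : borelType E -> R).
Proof.
by move=> a0 hh; apply: continuous_borel_measurable; exact: holder_weight_continuous hh.
Qed.

Lemma L1_process_holder (a C : R) (h : E -> R) y t : 0 <= C ->
  holder_weight a gamma1 C h -> 0 <= a <= r -> 0 <= t -> L1 P (fun w => h (X y t w)).
Proof.
move=> C0 hh /andP[a0 ar] t0; have [CX CX1 hX] := moment_process F_filt X_markov A1.
have ar0 : 0 <= a <= r by rewrite a0 ar.
have [LX _] := hX a y t ar0 t0.
apply: (@L1_le _ _ _ _ _ (fun w => (`|h 0| + C) * weight (X y t w) `^ a)).
- exact: (measurableT_comp (mholder a0 hh) (mX y t0)).
- exact: L1Z.
- by move=> w; exact: (holder_growth _ C0 hh a0).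
Qed.

Lemma L1_invariant_holder (a C : R) (h : E -> R) : 0 <= C ->
  holder_weight a gamma1 C h -> 0 <= a <= r -> L1 mu h.
Proof.
move=> C0 hh /andP[a0 ar]; have [CX CX1 hX] := moment_invariant E_sep F_filt X_markov A1 mu_inv.
have ar0 : 0 <= a <= r by rewrite a0 ar.
have [LX _] := hX a ar0.
refine (@L1_le _ (borelType E) R mu h (fun w => (`|h 0| + C) * weight (w : E) `^ a) _ _ _).
- exact: mholder hh.
- exact: L1Z.
- by move=> w; exact: (holder_growth _ C0 hh a0).
Qed.

Let rate_exp : R := gamma1 * (1 + beta).

(** The distance |u - v|^gamma1 is truncated at 1 by moving the excess into the weight; together
    with the factor |u|^beta + |v|^beta this explains the exponent gamma1 (1 + beta). *)
Lemma contraction_rate : exists2 c : R, 0 <= c & forall u v t, 0 <= t ->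
  exists e : R, [/\ 0 <= e, (L2norm P (fun w => X u t w - X v t w)%R <= e%:E)%E &
    e `^ gamma1 <= c * rho t `^ gamma1 *
      (Num.min 1 (`|u - v| `^ gamma1) * weight2 u v `^ rate_exp)].
Proof.
have [L2 L20 hL2] := ep_contract A1.
exists (L2 `^ gamma1 * 3 `^ gamma1); first by rewrite mulr_ge0 ?powR_ge0.
move=> u v t t0; exists (L2 * `|u - v| * (1 + `|u| `^ beta + `|v| `^ beta) * rho t).
have rho0 := ep_rho_ge0 A1 t0; have M1 := weight2_ge1 u v; have M0 := weight2_ge0 u v.
have S0 : 0 <= 1 + `|u| `^ beta + `|v| `^ beta by rewrite !addr_ge0 ?powR_ge0.
have L2u : 0 <= L2 * `|u - v| by rewrite mulr_ge0// ltW.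
split; [by apply: mulr_ge0 => //; exact: mulr_ge0|exact: hL2|].
rewrite (powRM _ (mulr_ge0 L2u S0) rho0) (powRM _ L2u S0) (powRM _ (ltW L20) (normr_ge0 _)).
have S3 : (1 + `|u| `^ beta + `|v| `^ beta) `^ gamma1 <= 3 `^ gamma1 * weight2 u v `^ (beta * gamma1).
  rewrite powRrM -(powRM _ (ler0n _ 3) (powR_ge0 _ _)); apply: powR_mono; [exact: ltW|exact: S0|].
  have b1 : 1 <= weight2 u v `^ beta by exact: powR_ge1.
  have b2 : `|u| `^ beta <= weight2 u v `^ beta.
    by apply: powR_mono => //; rewrite /weight2; have := normr_ge0 v; have := normr_ge0 u; lra.
  have b3 : `|v| `^ beta <= weight2 u v `^ beta.
    by apply: powR_mono => //; rewrite /weight2; have := normr_ge0 v; have := normr_ge0 u; lra.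
  lra.
have D3 : `|u - v| `^ gamma1 <= Num.min 1 (`|u - v| `^ gamma1) * weight2 u v `^ gamma1.
  case: (leP 1 (`|u - v| `^ gamma1)) => h.
    rewrite mul1r; apply: powR_mono => //; [exact: ltW|exact: norm_sub_weight2].
  by rewrite ler_peMr ?powR_ge0//; apply: powR_ge1 => //; exact: ltW.
have -> : weight2 u v `^ rate_exp = weight2 u v `^ gamma1 * weight2 u v `^ (beta * gamma1).
  rewrite -powRD; first by congr (_ `^ _); rewrite /rate_exp; ring.
  by apply/implyP => _; rewrite gt_eqF// (lt_le_trans _ M1).
have m0 : 0 <= Num.min 1 (`|u - v| `^ gamma1) by rewrite le_min ler01 powR_ge0.
apply: (@le_trans _ _ (L2 `^ gamma1 * (Num.min 1 (`|u - v| `^ gamma1) * weight2 u v `^ gamma1) *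
   (3 `^ gamma1 * weight2 u v `^ (beta * gamma1)) * rho t `^ gamma1)).
  rewrite ler_wpM2r ?powR_ge0//; apply: ler_pM; rewrite ?mulr_ge0 ?powR_ge0//.
  by rewrite ler_wpM2l ?powR_ge0.
by rewrite le_eqVlt; apply/orP; left; apply/eqP; ring.
Qed.

Let semigroup_diff (a C : R) (h : E -> R) u v t : 0 <= C -> holder_weight a gamma1 C h ->
  0 <= a -> a <= r -> 0 <= t ->
  L1 P (fun w => `|h (X u t w) - h (X v t w)|) ->
  `|semigroup P X t h u - semigroup P X t h v| <=
    \int[P]_w `|h (X u t w) - h (X v t w)|.
Proof.
move=> C0 hh a0 ar t0 LD.
have Lh y : L1 P (fun w => h (X y t w)) by apply: (L1_process_holder _ C0 hh) => //; rewrite a0.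
by rewrite /semigroup -ERB//; apply: ER_abs => //; exact: L1B.
Qed.

(** Coupling of the processes started at u and v. The new exponent adds the cost [rate_exp] of the
    contraction to the cost rt 2a of the moments of order 2a. *)
Lemma semigroup_holder (a C : R) (h : E -> R) : 0 <= a -> 2 * a <= r -> 0 <= C ->
  holder_weight a gamma1 C h -> exists2 C' : R, 0 <= C' & forall t, 0 <= t ->
    holder_weight (rate_exp + rt * (2 * a)) gamma1 (C' * rho t `^ gamma1) (semigroup P X t h).
Proof.
move=> a0 ar C0 hh; have [c c0 hc] := contraction_rate.
have [CX CX1 hX] := moment_process F_filt X_markov A1.
have CX0 : 0 <= CX by exact: le_trans CX1.
have a20 : 0 <= 2 * a by rewrite mulr_ge0.
exists (C * c * (2 + 2 `^ (2 * a) * (CX + CX))).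
  by rewrite !mulr_ge0// addr_ge0// mulr_ge0 ?powR_ge0// addr_ge0.
move=> t t0 u v; have [e [e0 De eb]] := hc u v t t0.
have a2r : 0 <= 2 * a <= r by rewrite a20.
have [LU IU] := hX _ u t a2r t0; have [LV IV] := hX _ v t a2r t0.
have [LD ID] := coupling_holder E_sep (mX u t0) (mX v t0) a0 (ep_gamma1 A1) C0 hh LU LV e0 De.
have ar' : a <= r by rewrite (le_trans _ ar)// ler_peMl// ler1n.
rewrite (le_trans (semigroup_diff C0 hh a0 ar' t0 LD))// (le_trans ID)//.
have M1 := weight2_ge1 u v; have M0 := weight2_ge0 u v.
have mm0 : 0 <= Num.min 1 (`|u - v| `^ gamma1) by rewrite le_min ler01 powR_ge0.
have W1 : 1 <= weight2 u v `^ (rt * (2 * a)) by apply: powR_ge1 => //; rewrite mulr_ge0.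
have wU : weight u `^ (rt * (2 * a)) <= weight2 u v `^ (rt * (2 * a)).
  by apply: powR_mono; [rewrite mulr_ge0|exact: weight_ge0|exact: weight_le2].
have wV : weight v `^ (rt * (2 * a)) <= weight2 u v `^ (rt * (2 * a)).
  by apply: powR_mono; [rewrite mulr_ge0|exact: weight_ge0|rewrite weight2C; exact: weight_le2].
set W := weight2 u v `^ (rt * (2 * a)) in W1 wU wV *.
have mom : \int[P]_w (weight (X u t w) `^ (2 * a)) + \int[P]_w (weight (X v t w) `^ (2 * a)) <= (CX + CX) * W.
  rewrite (mulrDl CX CX W); apply: lerD.
    by rewrite (le_trans IU)// ler_wpM2l.
  by rewrite (le_trans IV)// ler_wpM2l.
have -> : weight2 u v `^ (rate_exp + rt * (2 * a)) = weight2 u v `^ rate_exp * W.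
  rewrite powRD//; by apply/implyP => _; rewrite gt_eqF// (lt_le_trans _ M1).
apply: (@le_trans _ _ (C * (c * rho t `^ gamma1 *
      (Num.min 1 (`|u - v| `^ gamma1) * weight2 u v `^ rate_exp)) *
      ((2 + 2 `^ (2 * a) * (CX + CX)) * W))).
  apply: ler_pM.
  - by rewrite mulr_ge0 ?powR_ge0.
  - rewrite addr_ge0// mulr_ge0 ?powR_ge0// addr_ge0//; apply: Rintegral_ge0 => w _; exact: powR_ge0.
  - by rewrite ler_wpM2l.
  - rewrite [leRHS](_ : _ = 2 * W + 2 `^ (2 * a) * ((CX + CX) * W)); last by ring.
    by apply: lerD; [rewrite ler_peMr|rewrite ler_wpM2l ?powR_ge0].
by rewrite le_eqVlt; apply/orP; left; apply/eqP; ring.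
Qed.

(** By invariance mu(h) = mu(P_t h), so P_t h(u) - mu(h) is the average over v of P_t h(u) - P_t
    h(v). The weight of the pair is at most the product of the weights, and the one in v integrates
    under mu. *)
Lemma semigroup_decay (a C : R) (h : E -> R) : 0 <= a -> 2 * a <= r -> 0 <= C ->
  holder_weight a gamma1 C h -> rate_exp + rt * (2 * a) <= r ->
  exists2 C' : R, 0 <= C' & forall t u, 0 <= t ->
    `|semigroup P X t h u - mean mu h| <=
      C' * rho t `^ gamma1 * weight u `^ (rate_exp + rt * (2 * a)).
Proof.
move=> a0 ar C0 hh mr; have [C1 C10 hC1] := semigroup_holder a0 ar C0 hh.
have [Cm Cm0 hCm] := moment_invariant E_sep F_filt X_markov A1 mu_inv.
set m := rate_exp + rt * (2 * a) in mr hC1 *.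
have rate0 : 0 <= rate_exp by rewrite /rate_exp mulr_ge0 ?(ltW gamma1_gt0)// addr_ge0.
have m0 : 0 <= m by rewrite addr_ge0// mulr_ge0// mulr_ge0.
have mr' : 0 <= m <= r by rewrite m0.
have [Lm Im] := hCm m mr'.
exists (C1 * Cm); first by rewrite mulr_ge0.
move=> t u t0; have ar' : 0 <= a <= r by rewrite a0/=; lra.
have [LP EP] := invariant_expectation F_filt X_markov mu_inv t0 (mholder a0 hh)
  (L1_invariant_holder C0 hh ar') (fun y => L1_process_holder y C0 hh ar' t0).
have LC : L1 mu (fun=> semigroup P X t h u) by exact: L1_cst.
rewrite /mean -EP -{1}(ER_cst mu (semigroup P X t h u)) -ERB//.
pose G (v : borelType E) := C1 * rho t `^ gamma1 * weight u `^ m * weight (v : E) `^ m.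
have LG : L1 mu G by exact: L1Z.
apply: (le_trans (ER_abs (L1B LC LP) LG _)); last first.
  rewrite /G ERZ//.
  have -> : C1 * Cm * rho t `^ gamma1 * weight u `^ m = C1 * rho t `^ gamma1 * weight u `^ m * Cm by ring.
  by rewrite ler_wpM2l// !mulr_ge0 ?powR_ge0.
move=> v; apply: (le_trans (hC1 t t0 u v)).
have -> : G v = C1 * rho t `^ gamma1 * (weight u `^ m * weight (v : E) `^ m) by rewrite /G; ring.
rewrite ler_wpM2l ?mulr_ge0 ?powR_ge0//.
rewrite -powRM ?weight_ge0// (@le_trans _ _ (weight2 u v `^ m))//.
  by rewrite ler_piMl ?powR_ge0// ge_min lexx.
by apply: powR_mono => //; [exact: weight2_ge0|exact: weight2_le_mul].
Qed.

(* Truncating the growth of [h] at level [K] avoids composing the moment bound *)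
(* of the process with itself, which would cost a factor [rt] in the exponents. *)
Lemma mixing_bound (a C : R) (h : E -> R) x : 0 <= a -> 2 * a <= r -> 0 <= C ->
  holder_weight a gamma1 C h ->
  exists2 C' : R, 0 <= C' & forall t s K, 0 <= t -> 0 <= s -> 0 < K ->
    L1 P (fun w => `|semigroup P X t h (X x s w) - mean mu h|) /\
    \int[P]_w `|semigroup P X t h (X x s w) - mean mu h| <=
      C' * (K * rho t `^ gamma1 + K^-1).
Proof.
move=> a0 ar C0 hh; have [c c0 hc] := contraction_rate.
have [CX CX1 hX] := moment_process F_filt X_markov A1.
have [Cm Cm0 hCm] := moment_invariant E_sep F_filt X_markov A1 mu_inv.
have CX0 : 0 <= CX by exact: le_trans CX1.
have a20 : 0 <= 2 * a by rewrite mulr_ge0.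
have a2r : 0 <= 2 * a <= r by rewrite a20.
have ar' : 0 <= a <= r by rewrite a0/=; lra.
have [beta0 betar] := andP (ep_beta A1); have [g0 g1] := andP (ep_gamma1 A1).
have rate0 : 0 <= rate_exp by rewrite /rate_exp mulr_ge0 ?(ltW gamma1_gt0)// addr_ge0.
have rater : 0 <= rate_exp <= r.
  rewrite rate0/= (@le_trans _ _ (1 + beta))//; last by lra.
  by rewrite /rate_exp ler_piMl// addr_ge0.
pose H t u := \int[P]_w (weight (X u t w) `^ (2 * a)).
pose A1c := C * 2 `^ (2 * a); pose A2c := C * 3 * c * Cm.
have A10 : 0 <= A1c by rewrite mulr_ge0 ?powR_ge0.
have A20 : 0 <= A2c by rewrite !mulr_ge0.
have [Lmu2 Imu2] := hCm _ a2r; have [Lmub Imub] := hCm _ rater.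
have mw : measurable_fun setT ((fun u : E => weight u `^ (2 * a)) : borelType E -> R).
  exact: measurable_weight_powR.
have ptw t u K : 0 <= t -> 0 < K -> `|semigroup P X t h u - mean mu h| <=
    A1c * K^-1 * (H t u + Cm) + A2c * K * rho t `^ gamma1 * weight u `^ rate_exp.
  move=> t0 K0.
  have [LP EP] := invariant_expectation F_filt X_markov mu_inv t0 (mholder a0 hh)
    (L1_invariant_holder C0 hh ar') (fun y => L1_process_holder y C0 hh ar' t0).
  have [LH IH] := invariant_expectation F_filt X_markov mu_inv t0 mw Lmu2 (fun y => (hX _ y t a2r t0).1).
  have LC : L1 mu (fun=> semigroup P X t h u) by exact: L1_cst.
  rewrite /mean -EP -{1}(ER_cst mu (semigroup P X t h u)) -ERB//.
  pose G (v : borelType E) := (A1c * K^-1 * H t u + A1c * K^-1 * H t v) +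
     C * 3 * c * K * rho t `^ gamma1 * weight u `^ rate_exp * weight (v : E) `^ rate_exp.
  have LG1 : L1 mu (fun v => A1c * K^-1 * H t u + A1c * K^-1 * H t v).
    by apply: L1D; [exact: L1_cst|exact: L1Z LH].
  have LG : L1 mu G by apply: L1D => //; exact: L1Z.
  apply: (le_trans (ER_abs (L1B LC LP) LG _)); last first.
    rewrite /G ERD//; last exact: L1Z.
    rewrite ERD; [|exact: L1_cst|exact: L1Z LH].
    rewrite ER_cst (ERZ _ LH) IH ERZ// (mulrDr (A1c * K^-1)); apply: lerD.
      by rewrite lerD2l ler_wpM2l// mulr_ge0// invr_ge0 ltW.
    have -> : A2c * K * rho t `^ gamma1 * weight u `^ rate_exp =
      C * 3 * c * K * rho t `^ gamma1 * weight u `^ rate_exp * Cm by rewrite /A2c; ring.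
    by rewrite ler_wpM2l// !mulr_ge0 ?powR_ge0 ?(ltW K0).
  move=> v; have [e [e0 De eb]] := hc u v t t0.
  have [LU IU] := hX _ u t a2r t0; have [LV IV] := hX _ v t a2r t0.
  have [LD _] := coupling_holder E_sep (mX u t0) (mX v t0) a0 (ep_gamma1 A1) C0 hh LU LV e0 De.
  have IT := coupling_truncated E_sep (mX u t0) (mX v t0) a0 (ep_gamma1 A1) C0 hh LU LV e0 De K0.
  rewrite (le_trans (semigroup_diff C0 hh a0 (andP ar').2 t0 LD))// (le_trans IT)// /G lerD//.
    have E1 y : C * (2 `^ (2 * a) * y / K) = A1c * K^-1 * y by rewrite /A1c; ring.
    by rewrite E1 mulrDr.
  have eb2 : e `^ gamma1 <= c * rho t `^ gamma1 * (weight u `^ rate_exp * weight v `^ rate_exp).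
    rewrite (le_trans eb)// ler_wpM2l ?mulr_ge0 ?powR_ge0//.
    rewrite -powRM ?weight_ge0// (@le_trans _ _ (weight2 u v `^ rate_exp))//.
      by rewrite ler_piMl ?powR_ge0// ge_min lexx.
    by apply: powR_mono => //; [exact: weight2_ge0|exact: weight2_le_mul].
  apply: (@le_trans _ _ (C * (3 * K) * (c * rho t `^ gamma1 * (weight u `^ rate_exp * weight v `^ rate_exp)))).
    by rewrite ler_wpM2l// !mulr_ge0// ltW.
  by rewrite le_eqVlt; apply/orP; left; apply/eqP; ring.
pose B1 := CX * weight x `^ (rt * (2 * a)); pose B2 := CX * weight x `^ (rt * rate_exp).
have B10 : 0 <= B1 by rewrite mulr_ge0 ?powR_ge0.
have B20 : 0 <= B2 by rewrite mulr_ge0 ?powR_ge0.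
exists (A1c * (B1 + Cm) + A2c * B2); first by rewrite addr_ge0// mulr_ge0// addr_ge0.
move=> t s K t0 s0 K0.
have st0 : 0 <= s + t by exact: addr_ge0.
have [Ls Is] := hX _ x s rater s0; have [Lst Ist] := hX _ x (s + t) a2r st0.
have a1 : adapted F s (fun=> 1) by exact: measurable_cst.
(* Averaged over X_s, the moment [H t] is by the Markov property a moment of X_(s+t), bounded
   uniformly in time. *)
have [LHs EHs] := markov_expectation F_filt X_markov s0 t0 a1 (M := 1)
   (fun=> (eq_ind_r (fun z => z <= 1) (lexx 1) (normr1 R))) mw Lst (fun y => (hX _ y t a2r t0).1).
have {}EHs : \int[P]_w H t (X x s w) <= B1.
  move: EHs; under eq_Rintegral do rewrite mul1r; under [in RHS]eq_Rintegral do rewrite mul1r.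
  by move=> <-.
pose G w := A1c * K^-1 * (H t (X x s w) + Cm) + A2c * K * rho t `^ gamma1 * weight (X x s w) `^ rate_exp.
have LG1 : L1 P (fun w => H t (X x s w) + Cm) by apply: L1D => //; exact: L1_cst.
have LG : L1 P G by apply: L1D; exact: L1Z.
have mP : measurable_fun setT (fun w => `|semigroup P X t h (X x s w) - mean mu h|).
  apply: measurableT_comp; first exact: normr_measurable.
  apply: measurable_funB; last exact: measurable_cst.
  apply: (measurableT_comp _ (mX x s0)).
  exact: (measurable_semigroup F_filt X_markov t0 (mholder a0 hh) (fun y => L1_process_holder y C0 hh ar' t0)).
have LP : L1 P (fun w => `|semigroup P X t h (X x s w) - mean mu h|).
  by apply: L1_le LG _ => // w; rewrite normr_id; exact: ptw.
split=> //; apply: (le_trans (ER_le LP LG (fun w => ptw t _ K t0 K0))).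
rewrite /G ERD; [|exact: L1Z|exact: L1Z].
rewrite ERZ// ERZ// ERD//; last exact: L1_cst.
rewrite ER_cst.
have rg0 : 0 <= rho t `^ gamma1 by exact: powR_ge0.
have Kv0 : 0 <= K^-1 by rewrite invr_ge0 ltW.
have h1 : A1c * K^-1 * (\int[P]_w H t (X x s w) + Cm) <= A1c * (B1 + Cm) * K^-1.
  by rewrite mulrAC ler_wpM2r// ler_wpM2l// lerD2r.
have h2 : A2c * K * rho t `^ gamma1 * \int[P]_w (weight (X x s w) `^ rate_exp) <= A2c * B2 * (K * rho t `^ gamma1).
  have -> : A2c * B2 * (K * rho t `^ gamma1) = A2c * K * rho t `^ gamma1 * B2 by ring.
  by rewrite ler_wpM2l// !mulr_ge0// ltW.
have h3 : 0 <= A1c * (B1 + Cm) * (K * rho t `^ gamma1).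
  by rewrite !mulr_ge0// ?addr_ge0// ltW.
have h4 : 0 <= A2c * B2 * K^-1 by apply: mulr_ge0 => //; exact: mulr_ge0.
apply: (le_trans (lerD h1 h2)).
set p1 := A1c * (B1 + Cm) in h3 *; set p2 := A2c * B2 in h4 *.
rewrite mulrDl !mulrDr; apply: lerD; first by rewrite lerDr; exact: h3.
by rewrite lerDl; exact: h4.
Qed.

End semigroup_estimates.

(** * The Poisson equation *)

Section fubini_domination.
Context d1 d2 (T1 : measurableType d1) (T2 : measurableType d2) (R : realType).
Variables (m1 : {sigma_finite_measure set T1 -> \bar R})
  (m2 : {sigma_finite_measure set T2 -> \bar R}).
Variables (H : T1 * T2 -> R) (U : T1 -> R) (q : T2 -> R).
Hypotheses (mH : measurable_fun setT H) (LU : L1 m1 U) (Lq : L1 m2 q)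
  (HUq : forall x y, `|H (x, y)| <= U x * q y).

Lemma ER_fubini : [/\ L1 m1 (fun x => \int[m2]_y H (x, y)),
  L1 m2 (fun y => \int[m1]_x H (x, y)) &
  \int[m1]_x (\int[m2]_y H (x, y)) = \int[m2]_y (\int[m1]_x H (x, y))].
Proof.
have mx y : measurable_fun setT (fun x => H (x, y)) by exact: (measurableT_comp mH (measurable_pair2 y)).
have my x : measurable_fun setT (fun y => H (x, y)) by exact: (measurableT_comp mH (measurable_pair1 x)).
have Lx y : L1 m1 (fun x => H (x, y)).
  apply: (@L1_le _ _ _ _ _ (fun x => q y * U x)) => //; first exact: L1Z.
  by move=> x; rewrite mulrC.
have Ly x : L1 m2 (fun y => H (x, y)).
  by apply: (@L1_le _ _ _ _ _ (fun y => U x * q y)) => //; exact: L1Z.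
have mHE : measurable_fun setT (EFin \o H) by exact/measurable_EFinP.
have IH : (m1 \x m2)%E.-integrable setT (EFin \o H).
  apply/(integrable12ltyP _ _ mHE).
  apply: (@le_lt_trans _ _ (\int[m1]_x (\int[m2]_y q y * U x)%:E)%E); last first.
    by rewrite -L1_EFin ?ltry//; exact: L1Z.
  apply: ge0_le_integral => //.
  - by move=> x _; apply: integral_ge0 => y _.
  - apply: (@measurable_fun_fubini_tonelli_F _ _ _ _ _ m2 (fun z => (`|(H z)%:E|)%E)) => //.
    by apply: measurableT_comp.
  - by apply/measurable_EFinP; exact: L1_measurable (L1Z _ LU).
  - move=> x _ /=.
    have Lb : L1 m2 (fun y => U x * q y) by exact: L1Z.
    rewrite mulrC -ERZ// (L1_EFin Lb); apply: ge0_le_integral => //.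
    + apply/measurable_EFinP; apply: measurableT_comp; [exact: normr_measurable|exact: my].
    + by apply/measurable_EFinP; exact: L1_measurable Lb.
    + by move=> y _; rewrite lee_fin.
have FE x : fubini_F m2 (EFin \o H) x = (\int[m2]_y H (x, y))%:E by rewrite /fubini_F L1_EFin.
have GE y : fubini_G m1 (EFin \o H) y = (\int[m1]_x H (x, y))%:E by rewrite /fubini_G L1_EFin.
have IF := integrable_fubini_F IH; have MG := measurable_fubini_G IH.
have LF : L1 m1 (fun x => \int[m2]_y H (x, y)).
  by rewrite /L1 (_ : EFin \o _ = fubini_F m2 (EFin \o H))//; apply/funext => x; rewrite FE.
have LG : L1 m2 (fun y => \int[m1]_x H (x, y)).
  apply: (@L1_le _ _ _ _ _ (fun y => (\int[m1]_x U x) * q y)); [|exact: L1Z|].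
    apply/measurable_EFinP; rewrite (_ : EFin \o _ = fubini_G m1 (EFin \o H))//.
    by apply/funext => y; rewrite GE.
  move=> y; rewrite mulrC -ERZ//; apply: ER_abs => //; first exact: L1Z.
  by move=> x; rewrite mulrC.
split=> //; apply: EFin_inj; rewrite (L1_EFin LF) (L1_EFin LG).
transitivity (\int[m1]_x fubini_F m2 (EFin \o H) x)%E; first by apply: eq_integral => x _; rewrite FE.
transitivity (\int[m2]_y fubini_G m1 (EFin \o H) y)%E; last by apply: eq_integral => y _; rewrite GE.
exact: Fubini.
Qed.

End fubini_domination.

Section translation.
Context (R : realType).
Local Notation leb := (@lebesgue_measure R).

Lemma measurable_addr (c : R) :
  @measurable_fun _ _ (measurableTypeR R) (measurableTypeR R) setT (fun t : R => t + c).
Proof. by apply: measurable_funD => //; exact: measurable_cst. Qed.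

Let addr_mfun (c : R) : {mfun (measurableTypeR R) >-> (measurableTypeR R)} :=
  @mfun_Sub _ _ (measurableTypeR R) (measurableTypeR R) (fun t : R => t + c)
    (mem_set (measurable_addr c)).

Lemma lebesgue_measure_addr (c : R) (A : set R) : measurable A ->
  leb A = pushforward leb (addr_mfun c) A.
Proof.
move=> mA; apply: lebesgue_measure_unique => //= _ [[a b]] _ <-.
rewrite /pushforward (_ : _ @^-1` _ = `](a - c), (b - c)]%classic); last first.
  by apply/seteqP; split => t /=; rewrite !in_itv/= ltrBlDr lerBrDr.
rewrite !lebesgue_measure_itv/= !lte_fin ltrD2r; case: ifP => // _.
by rewrite -!EFinB; congr EFin; ring.
Qed.

Lemma ER_translation (c : R) (g : R -> R) : L1 leb g ->
  L1 leb (fun t => g (t + c)) /\ \int[leb]_t g (t + c) = \int[leb]_t g t.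
Proof.
move=> Lg; have mg : measurable_fun setT g by exact: L1_measurable Lg.
have mgc : measurable_fun setT (fun t : R => g (t + c)).
  exact: (measurableT_comp mg (measurable_addr c)).
have mgE : measurable_fun setT (EFin \o g) by exact/measurable_EFinP.
have ge0 (h : R -> \bar R) : measurable_fun setT h -> (forall t, 0 <= h t)%E ->
    (\int[leb]_t h (t + c)%R = \int[leb]_t h t)%E.
  move=> mh h0; have := @ge0_integral_pushforward _ _ _ _ R (addr_mfun c)
    (measurable_addr c) leb setT h measurableT mh (fun t _ => h0 t).
  rewrite preimage_setT => /= <-.
  apply: eq_measure_integral => [|? A mA _]; first exact: measurable_addr.
  by apply/esym; exact: lebesgue_measure_addr.
have Lgc : L1 leb (fun t => g (t + c)).
  apply/integrableP; split; first exact/measurable_EFinP.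
  have /integrableP[_] := Lg.
  by rewrite -(ge0 (fun t => `|(g t)%:E|)%E)//; exact: measurableT_comp.
split=> //; rewrite /Rintegral; congr fine.
have Ep := ge0 ((EFin \o g)^\+)%E (measurable_funepos mgE) (fun t => funepos_ge0 _ t).
have En := ge0 ((EFin \o g)^\-)%E (measurable_funeneg mgE) (fun t => funeneg_ge0 _ t).
rewrite [LHS]integralE [RHS]integralE -Ep -En; congr (_ - _)%E; apply: eq_integral => t _.
  by rewrite !funeposE.
by rewrite !funenegE.
Qed.

End translation.

Section poisson_equation.
Context (R : realType) (E : completeNormedModType R) (E_sep : separable E).
Context d (Omega : measurableType d) (P : probability Omega R).
Context (F : R -> set (set Omega)) (F_filt : filtration F).
Context (X : E -> R -> Omega -> E) (X_markov : markov_family P `[0, +oo[ F setT X).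
Context (r rt gamma1 beta : R) (rho : R -> R).
Hypothesis A1 : ergodic_process P X r rt gamma1 beta rho.
Context (mu : probability (borelType E) R) (mu_inv : invariant_measure P X mu).
Context (f : E -> R) (a Cf : R).
Hypotheses (a0 : 0 <= a) (Cf0 : 0 <= Cf) (f_holder : holder_weight a gamma1 Cf f).
Hypothesis a2r : 2 * a <= r.
Hypothesis growth_r : gamma1 * (1 + beta) + rt * (2 * a) <= r.
Context (taut eta : R) (taut0 : 0 < taut) (eta0 : 0 < eta).

(** Regularity in time, to be deduced from the strong error bound. It serves both for the
    measurability of P_t f(u) in (u, t) and for the error of the Poisson equation over one step. *)
Hypothesis cell_regular : forall x, exists2 C, 0 <= C & forall s t,
  0 < s <= taut -> 0 <= t ->
  \int[P]_w `|f (X x t w) - f (X x ((Num.truncn (t / s))%:R * s) w)| <= C * s `^ eta.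

Local Notation leb := (@lebesgue_measure R).
Local Notation growth := (gamma1 * (1 + beta) + rt * (2 * a)).

Let mX x t : 0 <= t -> measurable_fun setT (X x t : Omega -> borelType E).
Proof. by move=> t0; exact: (measurable_process F_filt X_markov). Qed.

Let gamma1_gt0 : 0 < gamma1. Proof. by case/andP: (ep_gamma1 A1). Qed.

Let ar : 0 <= a <= r.
Proof. by rewrite a0 (le_trans _ a2r)// ler_peMl// ler1n. Qed.

Let growth0 : 0 <= growth.
Proof.
have [b0 _] := andP (ep_beta A1); have rt0 : 0 <= rt by exact: le_trans (ep_rt A1).
by rewrite addr_ge0 ?mulr_ge0 ?(ltW gamma1_gt0)// addr_ge0.
Qed.

Let mf : measurable_fun setT (f : borelType E -> R).
Proof. by apply: continuous_borel_measurable; exact: holder_weight_continuous f_holder. Qed.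

Let Lf y t : 0 <= t -> L1 P (fun w => f (X y t w)).
Proof. exact: (L1_process_holder F_filt X_markov A1 y Cf0 f_holder ar). Qed.

Definition centered (u : E) : R := f u - mean mu f.

(** Extended by 0 to negative times, so that the Poisson solution is an integral over the whole
    line, on which translation by [tau] acts. *)
Definition drift (t : R) (u : E) : R :=
  if 0 <= t then semigroup P X t f u - mean mu f else 0.

Definition rate (t : R) : R := if 0 <= t then rho t `^ gamma1 else 0.

Definition poisson (u : E) : R := \int[leb]_t drift t u.

Lemma rate_ge0 t : 0 <= rate t.
Proof. by rewrite /rate; case: ifP => // _; exact: powR_ge0. Qed.

Lemma L1_rate : L1 leb rate.
Proof.
have Er : rate = (fun t => rho t `^ gamma1) \_ `[0, +oo[.
  by apply/funext => t; rewrite patchE /rate mem_setE in_itv/= andbT.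
have mr : measurable_fun (`[0%R, +oo[%classic : set R) (fun t => rho t `^ gamma1).
  apply: (measurableT_comp (measurable_powR gamma1)).
  by apply: subspace_continuous_measurable_fun => //; exact: ep_rho_cont A1.
apply/integrableP; split.
  apply/measurable_EFinP; rewrite Er.
  by apply/(measurable_restrictT _ _).1 => //; exact: mr.
apply: le_lt_trans (ep_rho_int A1).
rewrite [leRHS]integral_mkcond le_eqVlt; apply/orP; left; apply/eqP.
apply: eq_integral => t _; rewrite patchE mem_setE in_itv/= andbT /rate.
by case: ifP => t0 /=; rewrite ?normr0// ger0_norm ?powR_ge0.
Qed.

Lemma poissonE u : poisson u =
  \int[leb]_(t in `[0, +oo[) (semigroup P X t f u - mean mu f).
Proof.
rewrite Rintegral_mkcond; apply: eq_Rintegral => t _.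
by rewrite patchE mem_setE in_itv/= andbT.
Qed.

Lemma drift_bound : exists2 C, 0 <= C & forall t u,
  `|drift t u| <= C * weight u `^ growth * rate t.
Proof.
have [C C0 hC] := semigroup_decay E_sep F_filt X_markov A1 mu_inv a0 a2r Cf0 f_holder growth_r.
exists C => // t u; rewrite /drift /rate; case: ifP => t0; last by rewrite normr0 mulr0.
by rewrite mulrAC; exact: hC.
Qed.

Lemma drift_holder : exists2 C, 0 <= C & forall t u v,
  `|drift t u - drift t v| <=
    C * (Num.min 1 (`|u - v| `^ gamma1) * weight2 u v `^ growth) * rate t.
Proof.
have [C C0 hC] := semigroup_holder E_sep F_filt X_markov A1 a0 a2r Cf0 f_holder.
exists C => // t u v; rewrite /drift /rate; case: ifP => t0.
  rewrite opprB addrA subrK mulrAC; exact: hC.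
by rewrite subrr normr0 mulr0.
Qed.

Let cell_bound u : exists2 C, 0 <= C & forall s t, 0 < s <= taut -> 0 <= t ->
  `|semigroup P X t f u - semigroup P X ((Num.truncn (t / s))%:R * s) f u| <= C * s `^ eta.
Proof.
have [C C0 hC] := cell_regular u; exists C => // s t sT t0.
have s0 : 0 <= s by case/andP: sT => /ltW.
have k0 : 0 <= (Num.truncn (t / s))%:R * s by rewrite mulr_ge0.
have L1d : L1 P (fun w => f (X u t w) - f (X u ((Num.truncn (t / s))%:R * s) w)).
  by apply: L1B; exact: Lf.
rewrite /semigroup -ERB; [|exact: Lf|exact: Lf].
rewrite (le_trans (ER_abs L1d (L1_norm L1d) (fun w => lexx _)))//.
exact: hC.
Qed.

(** Joint measurability in state and time comes from approximation: freezing t at the left end of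
    its cell in a grid of step taut / (n+1) gives functions measurable on each slab, and cell
    regularity makes them converge. *)
Lemma measurable_drift :
  measurable_fun setT (fun z : borelType E * measurableTypeR R => drift z.2 z.1).
Proof.
pose s n : R := taut / n.+1%:R.
have s0 n : 0 < s n by rewrite divr_gt0.
have sT n : 0 < s n <= taut by rewrite s0 ler_pdivrMr// ler_peMr ?(ltW taut0)// ler1n.
pose J n (z : borelType E * measurableTypeR R) : R := if 0 <= z.2 then
  semigroup P X ((Num.truncn (z.2 / s n))%:R * s n) f z.1 - mean mu f else 0.
have mJ n : measurable_fun setT (J n).
  pose A (k : nat) : set (borelType E * measurableTypeR R) :=
    if k is k'.+1 then setT `*` `[k'%:R * s n, k'.+1%:R * s n[ else setT `*` `]-oo, 0[.
  have mA k : measurable (A k) by case: k => [|k]; apply: measurableX => //; exact: measurable_itv.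
  have -> : [set: borelType E * measurableTypeR R] = \bigcup_k A k.
    apply/esym/seteqP; split => // z _; case: (ltP z.2 0) => z0.
      by exists 0%N => //; split => //=; rewrite in_itv.
    exists (Num.truncn (z.2 / s n)).+1 => //; split => //=; rewrite in_itv/=.
    by rewrite -ler_pdivlMr// -ltr_pdivrMr// truncn_itv// divr_ge0// ltW.
  apply/(measurable_fun_bigcup _ mA) => -[|k].
    have h0 : {in A 0%N, (fun=> 0) =1 J n}.
      by move=> z; rewrite inE => -[_] /=; rewrite in_itv/= /J => z0; rewrite leNgt z0.
    by refine (@eq_measurable_fun _ _ _ _ _ _ _ h0 _); exact: measurable_cst.
  have hk : {in A k.+1, (fun z => semigroup P X (k%:R * s n) f z.1 - mean mu f) =1 J n}.
    move=> z; rewrite inE => -[_] /=; rewrite in_itv/= => /andP[kz zk].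
    have z0 : 0 <= z.2 by rewrite (le_trans _ kz)// mulr_ge0// ltW.
    rewrite /J z0 (_ : Num.truncn (z.2 / s n) = k)//.
    apply/eqP; rewrite truncn_eq; last by rewrite divr_ge0// ltW.
    by rewrite ler_pdivlMr// ltr_pdivrMr// kz zk.
  refine (@eq_measurable_fun _ _ _ _ _ _ _ hk _).
  apply: measurable_funTS; apply: measurable_funB; last exact: measurable_cst.
  have k0 : 0 <= k%:R * s n by rewrite mulr_ge0// ltW.
  apply: (measurableT_comp (measurable_semigroup F_filt X_markov k0 mf (fun y => Lf y k0))).
  exact: measurable_fst.
have cvgJ z : J n z @[n --> \oo] --> drift z.2 z.1.
  rewrite /J /drift; case: ifP => z0; last exact: cvg_cst.
  have [C C0 hC] := cell_bound z.1.
  have s_cvg : s n @[n --> \oo] --> (0 : R).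
    by rewrite -(mulr0 taut); apply: cvgM; [exact: cvg_cst|exact: cvg_harmonic].
  apply/cvgrPdist_le => e e0.
  have C1 : 0 < C + 1 by rewrite ltr_wpDl.
  near=> n.
  have sn : s n <= (e / (C + 1)) `^ eta^-1.
    near: n; have pos : 0 < (e / (C + 1)) `^ eta^-1 by rewrite powR_gt0// divr_gt0.
    by move/cvgrPdist_le : s_cvg => /(_ _ pos); apply: filterS => n; rewrite sub0r normrN gtr0_norm.
  rewrite opprB addrA subrK (le_trans (hC _ _ (sT n) z0))//.
  apply: (@le_trans _ _ (C * (e / (C + 1)))).
    rewrite ler_wpM2l// (@le_trans _ _ (((e / (C + 1)) `^ eta^-1) `^ eta))//.
      by apply: powR_mono; rewrite ?(ltW eta0) ?(ltW (s0 n)).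
    by rewrite -powRrM mulVf ?gt_eqF// powRr1// divr_ge0// ltW.
  by rewrite mulrCA ler_piMr ?(ltW e0)// ler_pdivrMr// mul1r lerDl.
apply/measurable_EFinP.
apply: (emeasurable_fun_cvg (fun n z => (J n z)%:E)) => [n|z _].
  by apply/measurable_EFinP; exact: mJ.
by apply: cvg_EFin; [exact: nearW|exact: cvgJ].
Unshelve. all: by end_near. Qed.

Let growth_range : 0 <= growth <= r. Proof. by rewrite growth0 growth_r. Qed.

Lemma L1_drift u : L1 leb (drift^~ u).
Proof.
have [C C0 hC] := drift_bound.
refine (@L1_le _ _ _ leb (drift^~ u) (fun t => C * weight u `^ growth * rate t) _ _ _).
- exact: (measurableT_comp measurable_drift (measurable_pair1 (u : borelType E))).
- exact: L1Z L1_rate.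
- by move=> t; exact: hC.
Qed.

Let poisson_bound_of (g : E -> E -> R) (C : R) (u v : E) :
  0 <= C -> (forall t, `|drift t u - drift t v| <= C * g u v * rate t) ->
  `|poisson u - poisson v| <= C * (\int[leb]_t rate t) * g u v.
Proof.
move=> C0 hC; have Lr := L1_rate.
rewrite /poisson -ERB; [|exact: L1_drift|exact: L1_drift].
rewrite mulrAC -ERZ//.
apply: ER_abs => //; last exact: L1Z.
by apply: L1B; exact: L1_drift.
Qed.

Lemma poisson_holder : exists2 C, 0 <= C & holder_weight growth gamma1 C poisson.
Proof.
have [C C0 hC] := drift_holder.
exists (C * \int[leb]_t rate t) => [|u v].
  by rewrite mulr_ge0// Rintegral_ge0// => t _; exact: rate_ge0.
exact: (poisson_bound_of
  (g := fun u v => Num.min 1 (`|u - v| `^ gamma1) * weight2 u v `^ growth)).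
Qed.

Lemma measurable_centered : measurable_fun setT (centered : borelType E -> R).
Proof. by apply: measurable_funB => //; exact: measurable_cst. Qed.

Lemma L1_centered y t : 0 <= t -> L1 P (fun w => centered (X y t w)).
Proof. by move=> t0; apply: L1B; [exact: Lf|exact: L1_cst]. Qed.

Lemma drift_semigroup t u : 0 <= t -> drift t u = semigroup P X t centered u.
Proof.
move=> t0; rewrite /drift t0 /semigroup /centered ERB ?ER_cst//; first exact: Lf.
exact: L1_cst.
Qed.

Lemma drift_expectation x s t (V : Omega -> R) (M : R) : 0 <= s -> 0 <= t -> adapted F s V ->
  (forall w, `|V w| <= M) ->
  \int[P]_w (V w * drift t (X x s w)) = \int[P]_w (V w * centered (X x (s + t) w)).
Proof.
move=> s0 t0 aV VM.
have [_ ->] := markov_expectation F_filt X_markov s0 t0 aV VM measurable_centered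
  (L1_centered x (addr_ge0 s0 t0)) (fun y => L1_centered y t0).
by apply: eq_Rintegral => w _; rewrite drift_semigroup.
Qed.

Lemma poisson_expectation x s (V : Omega -> R) (M : R) : 0 <= s -> measurable_fun setT V ->
  0 <= M -> (forall w, `|V w| <= M) ->
  [/\ L1 P (fun w => V w * poisson (X x s w)),
   L1 leb (fun t => \int[P]_w (V w * drift t (X x s w))) &
   \int[P]_w (V w * poisson (X x s w)) =
   \int[leb]_t (\int[P]_w (V w * drift t (X x s w)))].
Proof.
move=> s0 mV M0 VM; have [C C0 hC] := drift_bound.
have [CX _ hX] := moment_process F_filt X_markov A1.
have [LX _] := hX growth x s growth_range s0.
pose H (z : Omega * measurableTypeR R) := V z.1 * drift z.2 (X x s z.1).
have mH : measurable_fun setT H.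
  apply: measurable_funM; first exact: (measurableT_comp mV measurable_fst).
  exact: (measurableT_comp measurable_drift (measurable_fun_pair
    (measurableT_comp (mX x s0) measurable_fst) measurable_snd)).
have HU w t : `|H (w, t)| <= M * C * weight (X x s w) `^ growth * rate t.
  rewrite /H/= normrM -!mulrA ler_pM// mulrA; exact: hC.
have [L1H L2H EH] := @ER_fubini _ _ _ (measurableTypeR R) R P leb H _ rate mH
  (L1Z _ LX) L1_rate HU.
have E1 : (fun w => V w * poisson (X x s w)) = fun w => \int[leb]_t H (w, t).
  apply/funext => w; rewrite /poisson -ERZ//; exact: L1_drift.
by rewrite E1.
Qed.

Let L1_weighted (V : Omega -> R) (M t : R) y : 0 <= t -> (forall w, `|V w| <= M) ->
  measurable_fun setT V -> L1 P (fun w => V w * centered (X y t w)).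
Proof.
move=> t0 VM mV; apply: (@L1_le _ _ _ _ _ (fun w => M * `|centered (X y t w)|)).
- by apply: measurable_funM => //; exact: (measurableT_comp measurable_centered (mX y t0)).
- by apply: L1Z; apply: L1_norm; exact: L1_centered.
- by move=> w; rewrite normrM ler_wpM2r.
Qed.

Let truncn_cell (i : nat) (tau t : R) : 0 <= t < tau -> Num.truncn ((i%:R * tau + t) / tau) = i.
Proof.
move=> /andP[t0 tt]; have tau0 : 0 < tau by exact: le_lt_trans tt.
have p0 : 0 <= (i%:R * tau + t) / tau by rewrite divr_ge0 ?addr_ge0 ?mulr_ge0 ?(ltW tau0).
have Es : i.+1%:R * tau = i%:R * tau + tau by rewrite -natr1 mulrDl mul1r.
apply/eqP; rewrite (truncn_eq _ p0) (ler_pdivlMr _ _ tau0) (ltr_pdivrMr _ _ tau0) Es.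
by rewrite ltrD2l tt andbT lerDl.
Qed.

Let cell_expectation x : exists2 C, 0 <= C & forall i tau t (V : Omega -> R) (M : R),
  0 < tau <= taut -> 0 <= t < tau -> 0 <= M -> (forall w, `|V w| <= M) ->
  measurable_fun setT V ->
  `|\int[P]_w (V w * centered (X x (i%:R * tau) w)) -
    \int[P]_w (V w * centered (X x (i%:R * tau + t) w))| <= M * (C * tau `^ eta).
Proof.
have [C C0 hC] := cell_regular x; exists C => // i tau t V M tauT tt M0 VM mV.
have t0 : 0 <= t by case/andP: tt.
have s0 : 0 <= i%:R * tau by rewrite mulr_ge0//; case/andP: tauT => /ltW.
have st0 := addr_ge0 s0 t0.
have := hC _ _ tauT st0; rewrite (truncn_cell _ tt) => hCt.
have Ld : L1 P (fun w => f (X x (i%:R * tau + t) w) - f (X x (i%:R * tau) w)).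
  by apply: L1B; exact: Lf.
have La := L1_weighted x s0 VM mV; have Lb := L1_weighted x st0 VM mV.
rewrite -(ERB La Lb).
have Lg := L1Z M (L1_norm Ld).
rewrite (le_trans (ER_abs (L1B La Lb) Lg _))//.
  move=> w; rewrite -mulrBr normrM /centered opprB addrA subrK distrC.
  by rewrite ler_wpM2r.
by rewrite (ERZ M (L1_norm Ld)) ler_wpM2l.
Qed.

(** With s = i tau and t >= 0, the first two expectations both equal that of V g(X_(s+t+tau)) by the
    Markov property. They differ only for t in [-tau, 0[, where the first vanishes and the second is
    the expectation of V g at a time of the cell [s, s + tau[, hence close to its value at s. *)
Let drift_increment x : exists2 C, 0 <= C & forall i tau t (V : Omega -> R) (M : R),
  0 < tau <= taut -> adapted F (i%:R * tau) V -> 0 <= M -> (forall w, `|V w| <= M) ->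
  `|\int[P]_w (V w * drift t (X x (i%:R * tau + tau) w)) -
    \int[P]_w (V w * drift (t + tau) (X x (i%:R * tau) w)) +
    \int[P]_w (V w * centered (X x (i%:R * tau) w)) * (\1_(`[- tau, 0[ : set R) t : R)| <=
  M * (C * tau `^ eta) * (\1_(`[- tau, 0[ : set R) t : R).
Proof.
have [C C0 hC] := cell_expectation x; exists C => // i tau t V M tauT aV M0 VM.
have tau0 : 0 < tau by case/andP: tauT.
have s0 : 0 <= i%:R * tau by exact: mulr_ge0 (ltW tau0).
have st0 := addr_ge0 s0 (ltW tau0).
have mV := measurable_adapted F_filt s0 aV.
have aV' : adapted F (i%:R * tau + tau) V by apply: adapted_le aV => //; rewrite lerDl ltW.
rewrite indicE; case: (leP 0 t) => t0.
  rewrite memNset ?mulr0 ?addr0; last by rewrite /= in_itv/= [t < 0]ltNge t0 andbF.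
  rewrite (drift_expectation x st0 t0 aV' VM).
  rewrite (drift_expectation x s0 (addr_ge0 t0 (ltW tau0)) aV VM).
  by rewrite addrAC addrA subrr normr0.
have -> : \int[P]_w (V w * drift t (X x (i%:R * tau + tau) w)) = 0.
  rewrite (_ : (fun w => _) = fun=> 0) ?ER_cst//.
  by apply/funext => w; rewrite /drift leNgt t0 mulr0.
case: (leP (- tau) t) => tt.
  have t1 : 0 <= t + tau by rewrite -lerBlDr sub0r.
  rewrite mem_set ?mulr1; last by rewrite /= in_itv/= tt t0.
  rewrite (drift_expectation x s0 t1 aV VM) sub0r addrC.
  by apply: hC => //; rewrite t1 -ltrBrDr subrr.
rewrite memNset ?mulr0 ?addr0; last by rewrite /= in_itv/= [- tau <= t]leNgt tt.
rewrite (_ : (fun w => _) = fun=> 0) ?ER_cst ?subr0 ?normr0//.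
apply/funext => w; rewrite /drift leNgt (_ : t + tau < 0) ?mulr0//.
by rewrite -ltrBrDr sub0r.
Qed.

(** The discrete form of - L phi = g, obtained by integrating [drift_increment] over t: translation
    invariance turns the shifted drift into phi(X_s), and the indicator of [-tau, 0[ has integral
    tau. *)
Lemma corrector_identity x : exists2 C, 0 <= C & forall i tau (V : Omega -> R) (M : R),
  0 < tau <= taut -> adapted F (i%:R * tau) V -> 0 <= M -> (forall w, `|V w| <= M) ->
  `|\int[P]_w (V w * (poisson (X x (i.+1%:R * tau) w) - poisson (X x (i%:R * tau) w)
      + tau * centered (X x (i%:R * tau) w)))| <= M * (tau * (C * tau `^ eta)).
Proof.
have [C C0 hC] := drift_increment x; exists C => // i tau V M tauT aV M0 VM.
have tau0 : 0 < tau by case/andP: tauT.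
pose s := i%:R * tau; have s0 : 0 <= s by rewrite mulr_ge0// ltW.
have -> : i.+1%:R * tau = s + tau by rewrite -natr1 mulrDl mul1r.
rewrite -/s in aV *.
have st0 : 0 <= s + tau by rewrite addr_ge0// ltW.
have aV' : adapted F (s + tau) V by apply: adapted_le aV => //; rewrite lerDl ltW.
have mV := measurable_adapted F_filt s0 aV.
have [La LBa Ea] := poisson_expectation x s0 mV M0 VM.
have [Lb LBb Eb] := poisson_expectation x st0 mV M0 VM.
have Lc := L1_weighted x s0 VM mV.
pose B (t' : R) := \int[P]_w (V w * centered (X x t' w)).
pose D1 t := \int[P]_w (V w * drift t (X x (s + tau) w)).
pose D2 t := \int[P]_w (V w * drift (t + tau) (X x s w)).
pose D3 t := B s * (\1_(`[- tau, 0[ : set R) t : R).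
pose D t := D1 t - D2 t + D3 t.
have [LBa' Ea'] := ER_translation tau LBa.
have mI : measurable (`[- tau, 0[%classic : set R) by exact: measurable_itv.
have leb_I : leb `[- tau, 0[%classic = tau%:E.
  by rewrite lebesgue_measure_itv/= lte_fin oppr_lt0 tau0 -EFinB sub0r opprK.
have LI : L1 leb (\1_(`[- tau, 0[ : set R) : R -> R).
  exact: (integrable_indic_itv (- tau) 0 true true).
have EI : \int[leb]_t (\1_(`[- tau, 0[ : set R) t : R) = tau.
  have := @integral_indic _ _ _ leb setT measurableT _ mI.
  rewrite setIT => h; rewrite /Rintegral h; exact: (congr1 fine leb_I).
have LD12 : L1 leb (fun t => D1 t - D2 t) by exact: (@L1B _ _ _ leb D1 D2 LBb LBa').
have LD3 : L1 leb D3 by exact: L1Z LI.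
have LD : L1 leb D by exact: (@L1D _ _ _ leb (fun t => D1 t - D2 t) D3 LD12 LD3).
have E1 : \int[leb]_t D1 t = \int[P]_w (V w * poisson (X x (s + tau) w)) by exact: esym Eb.
have E2 : \int[leb]_t D2 t = \int[P]_w (V w * poisson (X x s w)) by exact: etrans Ea' (esym Ea).
have ED : \int[leb]_t D t = \int[P]_w (V w * poisson (X x (s + tau) w)) -
    \int[P]_w (V w * poisson (X x s w)) + B s * tau.
  transitivity (\int[leb]_t (D1 t - D2 t) + \int[leb]_t D3 t).
    exact: (@ERD _ _ _ leb (fun t => D1 t - D2 t) D3 LD12 LD3).
  congr (_ + _).
    exact: etrans (@ERB _ _ _ leb D1 D2 LBb LBa') (f_equal2 (fun a b => a - b) E1 E2).
  by rewrite -[in RHS]EI; exact: (@ERZ _ _ _ leb _ (B s) LI).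
have -> : \int[P]_w (V w * (poisson (X x (s + tau) w) - poisson (X x s w)
    + tau * centered (X x s w))) = \int[leb]_t D t.
  refine (etrans _ (esym ED)).
  rewrite (_ : (fun w => _) = fun w => (V w * poisson (X x (s + tau) w) - V w * poisson (X x s w))
    + tau * (V w * centered (X x s w))); last by apply/funext => w; ring.
  by rewrite (ERD (L1B Lb La) (L1Z _ Lc)) (ERB Lb La) (ERZ _ Lc) [B s * tau]mulrC.
have D_bound t : `|D t| <= M * (C * tau `^ eta) * (\1_(`[- tau, 0[ : set R) t : R).
  exact: hC.
have EZ := @ERZ _ _ _ leb _ (M * (C * tau `^ eta)) LI; rewrite EI in EZ.
rewrite (_ : M * (tau * (C * tau `^ eta)) = M * (C * tau `^ eta) * tau); last by ring.
rewrite -EZ.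
exact: (@ER_abs _ _ _ leb D _ LD (@L1Z _ _ _ leb _ (M * (C * tau `^ eta)) LI) D_bound).
Qed.

End poisson_equation.

(** * Error of the scheme *)

Section holder_functions.
Context (R : realType) (E : normedModType R).
Implicit Types (f : E -> R) (p g a C : R).

Lemma dist_pg_le p g (u v : E) : 0 <= p ->
  dist_pg p g u v <= 3 `^ 2^-1 * (Num.min 1 (`|u - v| `^ g) * weight2 u v `^ (p / 2)).
Proof.
move=> p0; rewrite /dist_pg mulrCA ler_wpM2l ?le_min ?ler01 ?powR_ge0//.
have w1 := weight2_ge1 u v; have w0 := weight2_ge0 u v.
have Nw (z : R) : 0 <= z -> z <= weight2 u v -> z `^ p <= weight2 u v `^ p.
  by move=> z0 zw; exact: powR_mono.
rewrite [weight2 u v `^ _]powRrM -(powRM _ (ler0n _ 3) (powR_ge0 _ _)).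
apply: powR_mono; [by []|by rewrite !addr_ge0 ?powR_ge0|].
have h1 : 1 <= weight2 u v `^ p by exact: powR_ge1.
have h2 : `|u| `^ p <= weight2 u v `^ p.
  by apply: Nw => //; rewrite /weight2 addrAC lerDr addr_ge0.
have h3 : `|v| `^ p <= weight2 u v `^ p.
  by apply: Nw => //; rewrite /weight2 lerDr addr_ge0.
lra.
Qed.

Lemma space_C_holder p g f : 0 <= p -> space_C p g f ->
  exists2 C, 0 <= C & holder_weight (p / 2) g C f.
Proof.
move=> p0 [_]; rewrite /norm_pg; set A := ereal_sup _; set B := ereal_sup _ => AB.
have A0 : (0 <= A)%E.
  apply: le_trans (ereal_sup_ubound _); last by exists 0.
  by rewrite lee_fin divr_ge0// addr_ge0// powR_ge0.
have Bfin : (B < +oo)%E.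
  rewrite ltey; apply/negP => /eqP B1; move: AB; rewrite B1.
  by rewrite addey// gt_eqF// (lt_le_trans _ A0)// ltNye.
have ub u v : u != v -> (`|f u - f v| / dist_pg p g u v)%:E%E \is a fin_num /\
    ((`|f u - f v| / dist_pg p g u v)%:E <= B)%E.
  by move=> uv; split => //; apply: ereal_sup_ubound; exists (u, v).
exists (`|fine B| * 3 `^ 2^-1); first by rewrite mulr_ge0// powR_ge0.
move=> u v; have [->|uv] := eqVneq u v.
  by rewrite subrr normr0 !mulr_ge0 ?powR_ge0 ?le_min ?ler01 ?powR_ge0.
have [_ h] := ub _ _ uv.
have Bf : B \is a fin_num by rewrite ge0_fin_numE// (le_trans _ h)// lee_fin divr_ge0// mulr_ge0 ?powR_ge0 ?le_min ?ler01 ?powR_ge0.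
have d0 : 0 < dist_pg p g u v.
  apply: mulr_gt0; last by rewrite powR_gt0// -addrA ltr_wpDr// addr_ge0 ?powR_ge0.
  by rewrite lt_min ltr01/= powR_gt0// normr_gt0 subr_eq0.
move: h; rewrite -(fineK Bf) lee_fin ler_pdivrMr// => h.
rewrite (le_trans h)// -mulrA (@le_trans _ _ (`|fine B| * dist_pg p g u v))//.
  by rewrite ler_wpM2r ?(ltW d0)// ler_norm.
by rewrite ler_wpM2l// dist_pg_le.
Qed.

(** Lets f be used with two exponents: gamma for the error of the scheme, and gamma1 for mixing,
    where rho^gamma1 is the integrable rate. *)
Lemma holder_weight_exponent a g g' C f : 0 <= C -> 0 < g' <= g ->
  holder_weight a g C f -> holder_weight a g' C f.
Proof.
move=> C0 /andP[g'0 gg] hf u v; rewrite (le_trans (hf u v))//.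
rewrite ler_wpM2l// ler_wpM2r ?powR_ge0//.
set z := `|u - v|; have z0 : 0 <= z by rewrite /z.
case: (leP z 1) => z1.
  rewrite le_min; apply/andP; split; first by rewrite ge_min lexx.
  rewrite ge_min; apply/orP; right; move: z0; rewrite le_eqVlt => /predU1P[<-|z0].
    by rewrite !powR0// gt_eqF// (lt_le_trans g'0).
  by apply: ger_powR => //; rewrite z0.
have pg b : 0 < b -> Num.min 1 (z `^ b) = 1.
  by move=> b0; apply/min_idPl; apply: powR_ge1; exact: ltW.
by rewrite !pg// (lt_le_trans g'0).
Qed.

End holder_functions.

Section scheme_error.
Context (R : realType) (E : completeNormedModType R) (E_sep : separable E).
Context d (Omega : measurableType d) (P : probability Omega R).
Context (F : R -> set (set Omega)) (F_filt : filtration F).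
Context (X : E -> R -> Omega -> E) (X_markov : markov_family P `[0, +oo[ F setT X).
Context (ht taut : R) (Eh : R -> set E) (xh : R -> E -> E).
Hypothesis Eh_spaces : state_spaces ht Eh xh.
Context (Y : R -> R -> E -> nat -> Omega -> E).
Context (r rt gamma1 beta : R) (rho : R -> R).
Hypothesis A1 : ergodic_process P X r rt gamma1 beta rho.
Context (q qt gamma2 kappa : R) (rhoD : R -> R -> R -> R).
Hypothesis A2 : ergodic_scheme P F Eh Y ht taut q qt gamma2 kappa rhoD.
Context (alpha1 alpha2 : R) (alpha1_gt0 : 0 < alpha1) (alpha2_gt0 : 0 < alpha2).
Hypothesis A3 : strong_order P X xh Y ht taut rt qt alpha1 alpha2.

Lemma measurable_scheme h tau y k : 0 <= h <= ht -> 0 < tau <= taut -> Eh h y ->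
  measurable_fun setT (Y h tau y k : Omega -> borelType E).
Proof.
move=> hh htau hy _ B mB; rewrite setTI.
have [_ hF _] := F_filt; apply: (hF (k%:R * tau)).
  by case/andP : htau => /ltW t0 _; rewrite mulr_ge0.
exact: (markov_adapted (es_markov A2 hh htau) hy).
Qed.

Lemma step_size_le h tau : 0 <= h <= ht -> 0 < tau <= taut ->
  0 <= h `^ alpha1 + tau `^ alpha2 <= 2.
Proof.
move=> /andP[h0 h1] /andP[t0 t1]; have /andP[_ ht1] := es_ht A2.
have /andP[_ taut1] := es_taut A2.
rewrite addr_ge0 ?powR_ge0//=.
have p1 (z b : R) : 0 < b -> 0 <= z -> z <= 1 -> z `^ b <= 1.
  by move=> b0 z0 z1; have := powR_mono (ltW b0) z0 z1; rewrite powR1.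
have p2 := p1 _ _ alpha1_gt0 h0 (le_trans h1 ht1).
have p3 := p1 _ _ alpha2_gt0 (ltW t0) (le_trans t1 taut1).
lra.
Qed.

(** The strong error bound at time 0 compares the two deterministic starting points [x] and
    [xh h x], so it bounds the latter uniformly in h. *)
Lemma projection_bounded x : exists2 K, 0 <= K & forall h, 0 <= h <= ht -> `|xh h x| <= K.
Proof.
have [L5 L50 hL] := A3; have tT : 0 < taut <= taut by case/andP: (es_taut A2) => ->/=.
pose e0 := L5 * (1 + `|x| `^ Num.max rt qt).
have e00 : 0 <= e0 by rewrite mulr_ge0 ?(ltW L50)// addr_ge0// powR_ge0.
exists (`|x| + e0 * 2); first by rewrite addr_ge0// mulr_ge0.
move=> h hh; have /andP[s0 s2] := step_size_le hh tT.
have xE := ss_xh Eh_spaces x hh.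
have E1 w : X x 0 w - Y h taut (xh h x) (Num.truncn (0 / taut)) w = x - xh h x.
  rewrite mul0r truncn0 (markov_init X_markov)// (markov_init (es_markov A2 hh tT))//.
have e1 : 0 <= e0 * (h `^ alpha1 + taut `^ alpha2) by rewrite mulr_ge0.
have mX0 : measurable_fun setT (X x 0 : Omega -> borelType E).
  exact: (measurable_process F_filt X_markov).
have mY0 := measurable_scheme (Num.truncn (0 / taut : R)) hh tT xE.
have [_] := L2norm_sqr E_sep mX0 mY0 e1 (hL h taut x 0 hh tT (lexx _)).
under eq_Rintegral do rewrite E1.
rewrite ER_cst ler_sqr ?nnegrE// => he.
have {}he : `|x - xh h x| <= e0 * 2 by rewrite (le_trans he)// ler_wpM2l.
have : `|xh h x| <= `|x| + `|x - xh h x|.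
  by rewrite -[X in `|X| <= _](subKr x) (le_trans (ler_normB _ _)).
lra.
Qed.

Lemma scheme_moment x : exists2 C, 0 <= C & forall a h tau k,
  0 <= a <= q -> 0 <= h <= ht -> 0 < tau <= taut ->
  L1 P (fun w => weight (Y h tau (xh h x) k w) `^ a) /\
  \int[P]_w (weight (Y h tau (xh h x) k w) `^ a) <= C.
Proof.
have [L3 L30 hL] := es_moment A2; have [K K0 hK] := projection_bounded x.
have q0 : 0 <= q by exact: le_trans (es_q A2).
have qt0 : 0 <= qt * q by rewrite mulr_ge0// (le_trans _ (es_qt A2)).
pose M := L3 * (1 + K `^ (qt * q)).
have M0 : 0 <= M by rewrite mulr_ge0 ?(ltW L30)// addr_ge0// powR_ge0.
exists ((1 + 2 `^ q * (1 + M))).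
  by rewrite addr_ge0// mulr_ge0 ?powR_ge0// addr_ge0.
move=> a h tau k aq hh htau; have xE := ss_xh Eh_spaces x hh.
have mY := measurable_scheme k hh htau xE.
have mN : measurable_fun setT (fun w => `|Y h tau (xh h x) k w|).
  apply: (measurableT_comp _ mY).
  by apply: continuous_borel_measurable => z; exact: norm_continuous.
have hE : ('E_P[fun w => (`|Y h tau (xh h x) k w| `^ q)%R] <= (M * 1 `^ q)%:E)%E.
  rewrite powR1 mulr1 (le_trans (hL _ _ _ k hh htau xE))// lee_fin.
  by rewrite ler_wpM2l ?(ltW L30)// lerD2l powR_mono// hK.
have [L I] := moment_powR mN (fun w => normr_ge0 _) q0 (lexx 1) M0 hE aq.
by split=> //; rewrite (le_trans I)// powR1 mulr1.
Qed.

Context (f : E -> R) (a gamma Cf : R).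
Hypotheses (a0 : 0 <= a) (aq : 2 * a <= q) (ar : 2 * a <= r) (gamma01 : 0 < gamma <= 1).
Hypotheses (Cf0 : 0 <= Cf) (f_holder : holder_weight a gamma Cf f).

Lemma scheme_error x : exists2 C, 0 <= C & forall h tau t,
  0 <= h <= ht -> 0 < tau <= taut -> 0 <= t ->
  L1 P (fun w => `|f (X x t w) - f (Y h tau (xh h x) (Num.truncn (t / tau)) w)|) /\
  \int[P]_w `|f (X x t w) - f (Y h tau (xh h x) (Num.truncn (t / tau)) w)| <=
    C * (h `^ alpha1 + tau `^ alpha2) `^ gamma.
Proof.
have [CY CY0 hY] := scheme_moment x.
have [CX CX1 hX] := moment_process F_filt X_markov A1.
have [L5 L50 hL] := A3.
pose e0 := L5 * (1 + `|x| `^ Num.max rt qt).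
have e00 : 0 <= e0 by rewrite mulr_ge0 ?(ltW L50)// addr_ge0// powR_ge0.
pose MX := CX * weight x `^ (rt * (2 * a)).
have MX0 : 0 <= MX by rewrite mulr_ge0 ?powR_ge0// (le_trans _ CX1).
have K0 : 0 <= 2 + 2 `^ (2 * a) * (MX + CY).
  by rewrite addr_ge0// mulr_ge0 ?powR_ge0// addr_ge0.
exists (Cf * e0 `^ gamma * (2 + 2 `^ (2 * a) * (MX + CY))).
  by rewrite !mulr_ge0// powR_ge0.
move=> h tau t hh htau t0; have /andP[s0 _] := step_size_le hh htau.
have a20 : 0 <= 2 * a by rewrite mulr_ge0.
have arr : 0 <= 2 * a <= r by rewrite a20.
have aqq : 0 <= 2 * a <= q by rewrite a20.
have [LX IX] := hX _ x t arr t0.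
have [LY IY] := hY _ h tau (Num.truncn (t / tau)) aqq hh htau.
have mX : measurable_fun setT (X x t : Omega -> borelType E).
  exact: (measurable_process F_filt X_markov).
have mY := measurable_scheme (Num.truncn (t / tau)) hh htau (ss_xh Eh_spaces x hh).
have e1 : 0 <= e0 * (h `^ alpha1 + tau `^ alpha2) by rewrite mulr_ge0.
have [L I] := coupling_holder E_sep mX mY a0 gamma01 Cf0 f_holder LX LY e1
  (hL h tau x t hh htau t0).
split=> //; rewrite (le_trans I)//.
have -> : Cf * e0 `^ gamma * (2 + 2 `^ (2 * a) * (MX + CY)) * (h `^ alpha1 + tau `^ alpha2) `^ gamma =
  Cf * (e0 `^ gamma * (h `^ alpha1 + tau `^ alpha2) `^ gamma) * (2 + 2 `^ (2 * a) * (MX + CY)) by ring.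
rewrite -powRM// ler_wpM2l ?mulr_ge0 ?powR_ge0//.
by rewrite lerD2l ler_wpM2l ?powR_ge0// lerD.
Qed.

(* Only time is discretized ([h = 0]): [X] at times [t] and [i s] of the same *)
(* cell are both compared with the same value of the scheme.                  *)
Lemma cell_regularity x : exists2 C, 0 <= C & forall s t,
  0 < s <= taut -> 0 <= t ->
  \int[P]_w `|f (X x t w) - f (X x ((Num.truncn (t / s))%:R * s) w)| <=
    C * s `^ (alpha2 * gamma).
Proof.
have [C C0 hC] := scheme_error x; exists (C + C); first by rewrite addr_ge0.
move=> s t sT t0; have s0 : 0 < s by case/andP: sT.
have h0 : 0 <= (0 : R) <= ht by rewrite lexx; case/andP: (es_ht A2).
set i := Num.truncn (t / s); have i0 : 0 <= i%:R * s by rewrite mulr_ge0// ltW.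
have [L1t I1] := hC 0 s t h0 sT t0; have [L2t I2] := hC 0 s (i%:R * s) h0 sT i0.
rewrite mulfK ?gt_eqF// natrK in L2t I2.
have Ea : (0 `^ alpha1 + s `^ alpha2) `^ gamma = s `^ (alpha2 * gamma).
  by rewrite powR0 ?gt_eqF// add0r powRrM.
rewrite Ea in I1 I2; rewrite mulrDl (le_trans _ (lerD I1 I2))// -ERD//.
have [C' C'0 hX] := moment_process F_filt X_markov A1.
have mf : measurable_fun setT (f : borelType E -> R).
  by apply: continuous_borel_measurable; apply: holder_weight_continuous f_holder => //; case/andP: gamma01.
have LD : L1 P (fun w => `|f (X x t w) - f (Y 0 s (xh 0 x) i w)| +
    `|f (X x (i%:R * s) w) - f (Y 0 s (xh 0 x) i w)|) by exact: L1D.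
have bd w : `|f (X x t w) - f (X x (i%:R * s) w)| <= `|f (X x t w) - f (Y 0 s (xh 0 x) i w)| +
    `|f (X x (i%:R * s) w) - f (Y 0 s (xh 0 x) i w)|.
  by rewrite (distrC (f (X x (i%:R * s) w))) -(subrKA (f (Y 0 s (xh 0 x) i w))) ler_normD.
apply: ER_le => //; apply: L1_le LD _ => [|w]; last by rewrite normr_id.
apply: measurableT_comp; first exact: normr_measurable.
apply: measurable_funB; apply: (measurableT_comp mf);
  exact: (measurable_process F_filt X_markov).
Qed.

End scheme_error.

(** * Limit theorems on the grid *)

Section smooth_tests.
Context (R : realType).
Implicit Types (psi : R -> R) (c L th b y : R).

Lemma smooth_test_of_derive psi psi1 psi2 psi3 c :
  (forall y, is_derive y 1 psi (psi1 y)) ->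
  (forall y, is_derive y 1 psi1 (psi2 y)) ->
  (forall y, is_derive y 1 psi2 (psi3 y)) ->
  (forall y, [/\ `|psi y| <= c, `|psi1 y| <= c, `|psi2 y| <= c & `|psi3 y| <= c]) ->
  smooth_test psi psi1 psi2 c.
Proof.
move=> d0 d1 d2 bd.
have cont g g1 : (forall y, is_derive y 1 g (g1 y)) -> continuous g.
  by move=> dg z; apply/differentiable_continuous/derivable1_diffP.
have l0 : forall x y, `|psi y - psi x| <= c * `|y - x|.
  by apply: (lipschitz_of_bounded_derive d0) => y; have [] := bd y.
have l1 : forall x y, `|psi1 y - psi1 x| <= c * `|y - x|.
  by apply: (lipschitz_of_bounded_derive d1) => y; have [] := bd y.
have l2 : forall x y, `|psi2 y - psi2 x| <= c * `|y - x|.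
  by apply: (lipschitz_of_bounded_derive d2) => y; have [] := bd y.
split=> //; try by move=> y; have [] := bd y.
- exact: cont d0.
- exact: cont d1.
- exact: cont d2.
- exact: taylor1 d0 l1.
- exact: taylor1 d1 l2.
Qed.

Lemma smooth_test_scale psi psi1 psi2 c L : 1 <= L -> smooth_test psi psi1 psi2 c ->
  smooth_test (fun y => psi (L^-1 * y)) (fun y => L^-1 * psi1 (L^-1 * y))
    (fun y => L^-1 ^+ 2 * psi2 (L^-1 * y)) c.
Proof.
move=> L1 [c0 c1 c2 b0 b1 b2 l0 l2 t0 t1].
have Li0 : 0 <= L^-1 by rewrite invr_ge0 (le_trans ler01).
have Li1 : L^-1 <= 1 by rewrite invf_le1// (lt_le_trans ltr01).
have c_ge0 : 0 <= c by exact: le_trans (b0 0).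
have cL : continuous (fun y => L^-1 * y) by move=> y; apply: cvgM; [exact: cvg_cst|exact: cvg_id].
have sh n (z M : R) : 0 <= M -> `|z| <= M -> `|L^-1 ^+ n * z| <= M.
  move=> M0 zM; rewrite normrM ger0_norm ?exprn_ge0// -[M]mul1r ler_pM ?exprn_ge0//.
  exact: exprn_ile1.
have comp (g : R -> R) : continuous g -> continuous (fun y => g (L^-1 * y)).
  by move=> cg y; apply: continuous_comp; [exact: cL|exact: cg].
have sd x y : `|L^-1 * y - L^-1 * x| = L^-1 * `|y - x|.
  by rewrite -mulrBr normrM ger0_norm.
split=> //.
- exact: comp.
- by move=> y; apply: cvgM; [exact: cvg_cst|exact: comp].
- by move=> y; apply: cvgM; [exact: cvg_cst|exact: comp].
- by move=> y; apply: (sh 1%N).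
- by move=> y; apply: (sh 2%N).
- move=> x y; rewrite (le_trans (l0 _ _))// sd ler_wpM2l//.
  by rewrite -[leRHS]mul1r ler_wpM2r.
- move=> x y; rewrite -mulrBr; apply: sh; first by rewrite mulr_ge0.
  rewrite (le_trans (l2 _ _))// sd ler_wpM2l//.
  by rewrite -[leRHS]mul1r ler_wpM2r.
- move=> x y; have := t0 (L^-1 * x) (L^-1 * y).
  rewrite -mulrBr => h.
  rewrite (_ : L^-1 * psi1 (L^-1 * x) * (y - x) = psi1 (L^-1 * x) * (L^-1 * (y - x))); last by ring.
  rewrite (le_trans h)// ler_wpM2l// exprMn -[leRHS]mul1r ler_wpM2r ?sqr_ge0//.
  exact: exprn_ile1.
- move=> x y; have := t1 (L^-1 * x) (L^-1 * y).
  rewrite -mulrBr => h.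
  have -> : L^-1 * psi1 (L^-1 * y) - L^-1 * psi1 (L^-1 * x) - L^-1 ^+ 2 * psi2 (L^-1 * x) * (y - x) =
    L^-1 ^+ 1 * (psi1 (L^-1 * y) - psi1 (L^-1 * x) - psi2 (L^-1 * x) * (L^-1 * (y - x))) by ring.
  apply: sh; first by rewrite mulr_ge0// sqr_ge0.
  rewrite (le_trans h)// ler_wpM2l// exprMn -[leRHS]mul1r ler_wpM2r ?sqr_ge0//.
  exact: exprn_ile1.
Qed.

Lemma smooth_test_cos th b :
  smooth_test (fun y => cos (th * y + b)) (fun y => - th * sin (th * y + b))
    (fun y => - th ^+ 2 * cos (th * y + b)) (1 + `|th| + `|th| ^+ 2 + `|th| ^+ 3).
Proof.
have t1 : 0 <= `|th| by []; have t2 : 0 <= `|th| ^+ 2 by rewrite exprn_ge0.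
have t3 : 0 <= `|th| ^+ 3 by rewrite exprn_ge0.
have cos1 (z : R) : `|cos z| <= 1 by rewrite ler_norml cos_geN1 cos_le1.
have sin1 (z : R) : `|sin z| <= 1 by rewrite ler_norml sin_geN1 sin_le1.
refine (@smooth_test_of_derive (fun y => cos (th * y + b)) (fun y => - th * sin (th * y + b))
  (fun y => - th ^+ 2 * cos (th * y + b)) (fun y => th ^+ 3 * sin (th * y + b)) _ _ _ _ _).
- by move=> y; apply: is_derive_eq; rewrite /GRing.scale/=; ring.
- by move=> y; apply: is_derive_eq; rewrite /GRing.scale/=; ring.
- by move=> y; apply: is_derive_eq; rewrite /GRing.scale/=; ring.
- move=> y; have C := cos1 (th * y + b); have S := sin1 (th * y + b).
  have S1 : `|th| * `|sin (th * y + b)| <= `|th| by rewrite ler_piMr.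
  have S3 : `|th| ^+ 3 * `|sin (th * y + b)| <= `|th| ^+ 3 by rewrite ler_piMr.
  have C2 : `|th| ^+ 2 * `|cos (th * y + b)| <= `|th| ^+ 2 by rewrite ler_piMr.
  split; rewrite ?normrM ?normrN ?normrX; lra.
Qed.

Let v y : R := (1 + y ^+ 2)^-1.

Let v_pos y : 0 < 1 + y ^+ 2. Proof. by rewrite ltr_pwDl ?sqr_ge0. Qed.

Let is_derive_v y : is_derive y 1 v (- (2 * y) * v y ^+ 2).
Proof.
have n0 : 1 + y ^+ 2 != 0 by rewrite gt_eqF.
have dq : is_derive y 1 (fun z : R => 1 + z ^+ 2) (2 * y).
  by apply: is_derive_eq; rewrite /GRing.scale/=; ring.
have h := @is_deriveV _ (fun z : R => 1 + z ^+ 2) y _ 1 n0 dq.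
by apply: is_derive_eq; rewrite /v /GRing.scale/= exprVn; ring.
Qed.

(** The constant is 72 = 24 + 48, from the two terms of the third derivative; writing v = 1 / (1 +
    y^2), each term is a product of factors v, |y| v and y^2 v, all at most 1. *)
Lemma smooth_test_tail_fun1 : exists psi1 psi2, smooth_test (tail_fun 1) psi1 psi2 (72 : R).
Proof.
exists (fun y => 2 * y * v y ^+ 2), (fun y => 2 * v y ^+ 2 - 8 * y ^+ 2 * v y ^+ 3).
have -> : tail_fun 1 = fun y => 1 - v y.
  apply/funext => y; rewrite /tail_fun /v expr1n.
  by have := v_pos y => y0; field; rewrite gt_eqF.
refine (@smooth_test_of_derive (fun y => 1 - v y) (fun y => 2 * y * v y ^+ 2)
  (fun y => 2 * v y ^+ 2 - 8 * y ^+ 2 * v y ^+ 3)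
  (fun y => - 24 * y * v y ^+ 3 + 48 * y ^+ 3 * v y ^+ 4) 72 _ _ _ _).
- by move=> y; have dv := is_derive_v y; apply: is_derive_eq; rewrite /GRing.scale/=; ring.
- by move=> y; have dv := is_derive_v y; apply: is_derive_eq; rewrite /GRing.scale/=; ring.
- by move=> y; have dv := is_derive_v y; apply: is_derive_eq; rewrite /GRing.scale/=; ring.
- move=> y; have y2 := sqr_ge0 y.
  have v0 : 0 <= v y by rewrite invr_ge0 ltW.
  have v1 : v y <= 1 by rewrite invf_le1 ?v_pos// lerDl.
  have y2v : y ^+ 2 * v y <= 1 by rewrite ler_pdivrMr ?v_pos// mul1r lerDr.
  have yv : `|y| * v y <= 1.
    rewrite ler_pdivrMr ?v_pos// mul1r -(real_normK (num_real y)).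
    have := sqr_ge0 (`|y| - 1); have := normr_ge0 y; nra.
  have ny2 : `|y| ^+ 2 = y ^+ 2 by rewrite real_normK ?num_real.
  set w := v y in v0 v1 y2v yv *.
  have a1 : 0 <= `|y| * w by rewrite mulr_ge0.
  have a2 : 0 <= y ^+ 2 * w by rewrite mulr_ge0.
  have w2 : w ^+ 2 <= 1 by exact: exprn_ile1.
  have w20 : 0 <= w ^+ 2 by exact: sqr_ge0.
  have m1 (p q : R) : 0 <= p -> p <= 1 -> 0 <= q -> q <= 1 -> 0 <= p * q <= 1.
    move=> p0 p1 q0 q1; rewrite mulr_ge0//= -[leRHS]mulr1 ler_pM//.
  have /andP[b10 b1] := m1 _ _ a1 yv v0 v1.
  have /andP[b20 b2] := m1 _ _ a2 y2v w20 w2.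
  have /andP[b30 b3] := m1 _ _ a1 yv w20 w2.
  have /andP[b40 b4] := m1 _ _ b10 b1 a2 y2v.
  have /andP[b50 b5] := m1 _ _ b40 b4 v0 v1.
  split.
  + by rewrite ger0_norm; lra.
  + have -> : `|2 * y * w ^+ 2| = 2 * (`|y| * w * w).
      by rewrite !normrM (ger0_norm v0) ger0_norm//; ring.
    lra.
  + rewrite (_ : _ - _ = 2 * w ^+ 2 - 8 * (y ^+ 2 * w * w ^+ 2)); last by ring.
    by rewrite ler_norml; apply/andP; split; lra.
  + rewrite (le_trans (ler_normD _ _))//.
    rewrite (_ : `|- 24 * y * w ^+ 3| = 24 * (`|y| * w * w ^+ 2)); last first.
      by rewrite !normrM normrN (ger0_norm v0) (ger0_norm (ler0n _ 24)); ring.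
    rewrite (_ : `|48 * y ^+ 3 * w ^+ 4| = 48 * (`|y| * w * w * (y ^+ 2 * w) * w)); last first.
      rewrite !normrM (ger0_norm v0) (ger0_norm (ler0n _ 48)) -ny2; ring.
    lra.
Qed.

(** Rescaling of [tail_fun 1]. The factor L^(-2) on the second derivative is what makes the tails
    small for large L. *)
Lemma smooth_test_tail_fun L : 1 <= L -> exists psi1 psi2,
  smooth_test (tail_fun L) psi1 psi2 72 /\ forall y, `|psi2 y| <= 72 / L ^+ 2.
Proof.
move=> L1; have [psi1 [psi2 h]] := smooth_test_tail_fun1.
exists (fun y => L^-1 * psi1 (L^-1 * y)), (fun y => L^-1 ^+ 2 * psi2 (L^-1 * y)).
have L0 : 0 < L by exact: lt_le_trans L1.
have -> : tail_fun L = fun y => tail_fun 1 (L^-1 * y).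
  apply/funext => y; rewrite /tail_fun expr1n.
  have n1 : L ^+ 2 + y ^+ 2 != 0 by rewrite gt_eqF// ltr_pwDl ?sqr_ge0// exprn_gt0.
  have n2 : 1 + (L^-1 * y) ^+ 2 != 0 by rewrite gt_eqF// ltr_pwDl ?sqr_ge0.
  have n3 : L != 0 by rewrite gt_eqF.
  have n4 : L ^+ 2 != 0 by rewrite expf_neq0.
  have -> : 1 + (L^-1 * y) ^+ 2 = (L ^+ 2 + y ^+ 2) / L ^+ 2 by field.
  by field; rewrite n3.
split; first exact: smooth_test_scale.
move=> y; rewrite normrM ger0_norm ?exprn_ge0 ?invr_ge0 ?(ltW L0)// exprVn mulrC.
by rewrite ler_wpM2r ?invr_ge0 ?sqr_ge0//; exact: test2_bound h _.
Qed.

End smooth_tests.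

Section weighted_products.
Context (R : realType) (E : completeNormedModType R).

Lemma holder_weightM (a b g C C' : R) (h h' : E -> R) : 0 <= C -> 0 <= C' ->
  0 <= a -> 0 <= b -> holder_weight a g C h -> holder_weight b g C' h' ->
  exists2 C'', 0 <= C'' & holder_weight (a + b) g C'' (fun u => h u * h' u).
Proof.
move=> C0 C'0 a0 b0 hh hh'; pose K := `|h 0| + C; pose K' := `|h' 0| + C'.
have K0 : 0 <= K by rewrite addr_ge0. have K'0 : 0 <= K' by rewrite addr_ge0.
exists (K * C' + K' * C); first by rewrite addr_ge0 ?mulr_ge0.
move=> u v.
have hu : `|h u| <= K * weight2 u v `^ a.
  rewrite (le_trans (holder_growth u C0 hh a0))// ler_wpM2l//.
  by rewrite powR_mono ?weight_ge0 ?weight_le2.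
have hv : `|h' v| <= K' * weight2 u v `^ b.
  rewrite (le_trans (holder_growth v C'0 hh' b0))// ler_wpM2l//.
  by rewrite powR_mono ?weight_ge0// weight2C weight_le2.
have -> : h u * h' u - h v * h' v = h u * (h' u - h' v) + h' v * (h u - h v) by ring.
rewrite (le_trans (ler_normD _ _))// !normrM.
have w0 : weight2 u v != 0 by rewrite gt_eqF// (lt_le_trans _ (weight2_ge1 u v)).
rewrite powRD; last by rewrite w0 implybT.
have h1 := ler_pM (normr_ge0 _) (normr_ge0 _) hu (hh' u v).
have h2 := ler_pM (normr_ge0 _) (normr_ge0 _) hv (hh u v).
rewrite (le_trans (lerD h1 h2))// le_eqVlt; apply/orP; left; apply/eqP; ring.
Qed.

End weighted_products.

(** * Averaging along the grid: moments and decoupling *)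

Section grid_clt.
Context (R : realType) (E : completeNormedModType R) (E_sep : separable E).
Context d (Omega : measurableType d) (P : probability Omega R).
Context (F : R -> set (set Omega)) (F_filt : filtration F).
Context (X : E -> R -> Omega -> E) (X_markov : markov_family P `[0, +oo[ F setT X).
Context (r rt gamma1 beta : R) (rho : R -> R).
Hypothesis A1 : ergodic_process P X r rt gamma1 beta rho.
Context (mu : probability (borelType E) R) (mu_inv : invariant_measure P X mu).
Context (f : E -> R) (a Cf : R).
Hypotheses (a0 : 0 <= a) (Cf0 : 0 <= Cf) (f_holder : holder_weight a gamma1 Cf f).
Local Notation growth := (gamma1 * (1 + beta) + rt * (2 * a)).
Hypothesis growth_r : 2 * (a + growth) <= r.
Context (taut eta : R) (taut0 : 0 < taut) (eta0 : 0 < eta).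
Hypothesis cell_regular : forall x, exists2 C, 0 <= C & forall s t,
  0 < s <= taut -> 0 <= t ->
  \int[P]_w `|f (X x t w) - f (X x ((Num.truncn (t / s))%:R * s) w)| <= C * s `^ eta.

Local Notation g := (centered mu f).
Local Notation phi := (poisson P X mu f).

(** Its mean under [mu] is half of the asymptotic variance. *)
Definition variance_density (u : E) : R := g u * phi u.

Local Notation D := (mean mu variance_density).

Let mX x t : 0 <= t -> measurable_fun setT (X x t : Omega -> borelType E).
Proof. by move=> t0; exact: (measurable_process F_filt X_markov). Qed.

Let gamma1_gt0 : 0 < gamma1. Proof. by case/andP: (ep_gamma1 A1). Qed.

Let growth0 : 0 <= growth.
Proof.
have [b0 _] := andP (ep_beta A1); have rt0 : 0 <= rt by exact: le_trans (ep_rt A1).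
by rewrite addr_ge0 ?mulr_ge0 ?(ltW gamma1_gt0)// addr_ge0.
Qed.

Let g1 : growth <= r. Proof. by move: growth_r growth0 a0; lra. Qed.

Let a2r : 2 * a <= r. Proof. by move: growth_r growth0 a0; lra. Qed.

Let phi_holder : exists2 C, 0 <= C & holder_weight growth gamma1 C phi.
Proof.
exact: (poisson_holder E_sep F_filt X_markov A1 mu_inv a0 Cf0 f_holder a2r g1
  taut0 eta0 cell_regular).
Qed.

Let g_holder : holder_weight a gamma1 Cf g.
Proof. by move=> u v; rewrite /centered opprB addrA subrK. Qed.

Let F_holder : exists2 C, 0 <= C & holder_weight (a + growth) gamma1 C variance_density.
Proof.
have [C C0 hC] := phi_holder.
exact: holder_weightM Cf0 C0 a0 growth0 g_holder hC.
Qed.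

Let mh (h : E -> R) (b : R) : 0 <= b ->
  (exists2 C, 0 <= C & holder_weight b gamma1 C h) ->
  measurable_fun setT (h : borelType E -> R).
Proof.
move=> b0 [C C0 hC]; apply: continuous_borel_measurable.
exact: holder_weight_continuous hC.
Qed.

Let mg : measurable_fun setT (g : borelType E -> R).
Proof. by apply: (mh a0); exists Cf. Qed.

Let mphi : measurable_fun setT (phi : borelType E -> R).
Proof. exact: (mh growth0 phi_holder). Qed.

Let mF : measurable_fun setT (variance_density : borelType E -> R).
Proof. exact: measurable_funM. Qed.

Let growth_moment (h : E -> R) (b C : R) x : 0 <= C -> 0 <= b <= r ->
  measurable_fun setT (h : borelType E -> R) ->
  (forall u, `|h u| <= C * weight u `^ b) ->
  exists2 B, 0 <= B & forall t, 0 <= t ->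
    L1 P (fun w => h (X x t w)) /\ \int[P]_w `|h (X x t w)| <= B.
Proof.
move=> C0 br mhh hC; have [CX CX1 hX] := moment_process F_filt X_markov A1.
have CX0 : 0 <= CX by exact: le_trans CX1.
exists (C * (CX * weight x `^ (rt * b))); first by rewrite !mulr_ge0 ?powR_ge0.
move=> t t0; have [LX IX] := hX b x t br t0.
have Lh : L1 P (fun w => h (X x t w)).
  apply: (@L1_le _ _ _ _ _ (fun w => C * weight (X x t w) `^ b)) => //.
    exact: (measurableT_comp mhh (mX x t0)).
  exact: L1Z.
split=> //; apply: (@le_trans _ _ (\int[P]_w (C * weight (X x t w) `^ b))).
  by apply: ER_le => //; [exact: L1_norm|exact: L1Z].
by rewrite ERZ// ler_wpM2l.
Qed.

Let holder_bound (h : E -> R) (b : R) : 0 <= b ->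
  (exists2 C, 0 <= C & holder_weight b gamma1 C h) ->
  exists2 C, 0 <= C & forall u, `|h u| <= C * weight u `^ b.
Proof.
move=> b0 [C C0 hC]; exists (`|h 0| + C); first by rewrite addr_ge0.
by move=> u; exact: holder_growth.
Qed.

Let bound_mul (h h' : E -> R) (b b' C C' : R) u : 0 <= b -> 0 <= b' ->
  `|h u| <= C * weight u `^ b -> `|h' u| <= C' * weight u `^ b' ->
  `|h u * h' u| <= C * C' * weight u `^ (b + b').
Proof.
move=> b0 b'0 hu hu'; rewrite normrM.
have w0 : weight u != 0 by rewrite gt_eqF// (lt_le_trans _ (weight_ge1 u)).
rewrite powRD; last by rewrite w0 implybT.
rewrite (le_trans (ler_pM (normr_ge0 _) (normr_ge0 _) hu hu'))//.
by rewrite mulrACA.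
Qed.

Record moment_bounds x (B : R) : Prop := {
  L1_phi : forall t, 0 <= t -> L1 P (fun w => phi (X x t w)) ;
  L1_g : forall t, 0 <= t -> L1 P (fun w => g (X x t w)) ;
  L1_gg : forall t, 0 <= t -> L1 P (fun w => g (X x t w) ^+ 2) ;
  L1_gphi : forall t, 0 <= t -> L1 P (fun w => g (X x t w) * phi (X x t w)) ;
  L1_ggphi : forall t, 0 <= t -> L1 P (fun w => g (X x t w) ^+ 2 * `|phi (X x t w)|) ;
  L1_FF : forall t, 0 <= t -> L1 P (fun w => (variance_density (X x t w) - D) ^+ 2) ;
  bound_phi : forall t, 0 <= t -> \int[P]_w `|phi (X x t w)| <= B ;
  bound_gg : forall t, 0 <= t -> \int[P]_w (g (X x t w) ^+ 2) <= B ;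
  bound_ggphi : forall t, 0 <= t -> \int[P]_w (g (X x t w) ^+ 2 * `|phi (X x t w)|) <= B ;
  bound_F : forall t, 0 <= t -> \int[P]_w `|variance_density (X x t w) - D| <= B ;
  bound_FF : forall t, 0 <= t -> \int[P]_w ((variance_density (X x t w) - D) ^+ 2) <= B }.

Lemma process_moments x : exists2 B, 0 <= B & moment_bounds x B.
Proof.
have [Cp Cp0 hp] := holder_bound growth0 phi_holder.
have [Cg Cg0 hg] : exists2 C, 0 <= C & forall u, `|g u| <= C * weight u `^ a.
  by apply: (holder_bound a0); exists Cf.
have FD : exists2 C, 0 <= C & holder_weight (a + growth) gamma1 C (fun u => variance_density u - D).
  have [C C0 hC] := F_holder; exists C => // u v.
  by rewrite opprB addrA subrK.
have ag0 : 0 <= a + growth by rewrite addr_ge0.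
have [CF CF0 hF] := holder_bound ag0 FD.
have mFD := mh ag0 FD.
have hgg u : `|g u ^+ 2| <= Cg * Cg * weight u `^ (a + a) by exact: bound_mul.
have hgp u : `|g u * phi u| <= Cg * Cp * weight u `^ (a + growth) by exact: bound_mul.
have hggp u : `|g u ^+ 2 * `|phi u| | <= Cg * Cg * Cp * weight u `^ (a + a + growth).
  rewrite normrM normr_id -normrM.
  by apply: (@bound_mul (fun u => g u ^+ 2) phi) => //; rewrite addr_ge0.
have hFF u : `|(variance_density u - D) ^+ 2| <= CF * CF * weight u `^ ((a + growth) + (a + growth)).
  exact: (@bound_mul (fun u => variance_density u - D) (fun u => variance_density u - D)).
have mgg : measurable_fun setT ((fun u => g u ^+ 2) : borelType E -> R) by exact: measurable_funX.
have mnphi : measurable_fun setT ((fun u => `|phi u|) : borelType E -> R).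
  by apply: measurableT_comp => //; exact: normr_measurable.
have mggp : measurable_fun setT ((fun u => g u ^+ 2 * `|phi u|) : borelType E -> R).
  exact: measurable_funM.
have mFF : measurable_fun setT ((fun u => (variance_density u - D) ^+ 2) : borelType E -> R).
  exact: measurable_funX.
have rg : 0 <= growth <= r by rewrite growth0.
have r1 : 0 <= a <= r by rewrite a0/=; move: growth_r growth0 a0; lra.
have r2 : 0 <= a + a <= r by rewrite addr_ge0//=; move: growth_r growth0 a0; lra.
have r3 : 0 <= a + growth <= r by rewrite ag0/=; move: growth_r growth0 a0; lra.
have r4 : 0 <= a + a + growth <= r by rewrite (addr_ge0 (addr_ge0 a0 a0) growth0)/=; move: growth_r growth0 a0; lra.
have r5 : 0 <= (a + growth) + (a + growth) <= r.
  by rewrite (addr_ge0 ag0 ag0)/=; move: growth_r; lra.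
have CC0 : 0 <= Cg * Cg by rewrite mulr_ge0.
have [B1 B10 b1] := growth_moment x Cp0 rg mphi hp.
have [B2 B20 b2] := growth_moment x Cg0 r1 mg hg.
have [B3 B30 b3] := growth_moment x CC0 r2 mgg hgg.
have [B4 B40 b4] := growth_moment x (mulr_ge0 Cg0 Cp0) r3 mF hgp.
have [B5 B50 b5] := growth_moment x (mulr_ge0 CC0 Cp0) r4 mggp hggp.
have [B6 B60 b6] := growth_moment x CF0 r3 mFD hF.
have [B7 B70 b7] := growth_moment x (mulr_ge0 CF0 CF0) r5 mFF hFF.
exists (B1 + B3 + B5 + B6 + B7); first by rewrite !addr_ge0.
have sqr (h : Omega -> R) : \int[P]_w (h w ^+ 2) = \int[P]_w `|h w ^+ 2|.
  by apply: eq_Rintegral => w _; rewrite ger0_norm ?sqr_ge0.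
split=> t t0.
- exact: (b1 t t0).1.
- exact: (b2 t t0).1.
- exact: (b3 t t0).1.
- exact: (b4 t t0).1.
- exact: (b5 t t0).1.
- exact: (b7 t t0).1.
- by have := (b1 t t0).2; lra.
- by have := (b3 t t0).2; rewrite -sqr; lra.
- have := (b5 t t0).2; rewrite (_ : (fun w => `|_ * _|) = fun w => g (X x t w) ^+ 2 * `|phi (X x t w)|).
    by lra.
  by apply/funext => w; rewrite ger0_norm// mulr_ge0 ?sqr_ge0.
- by have := (b6 t t0).2; lra.
- by have := (b7 t t0).2; rewrite -sqr; lra.
Qed.

Context (x : E).

Definition grid_obs (tau : R) (i : nat) (w : Omega) : R := g (X x (i%:R * tau) w).

Definition grid_sum (s tau : R) (n : nat) : Omega -> R := partial_sum (grid_obs tau) s tau n.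

Local Notation W := grid_sum.
Local Notation Fx t w := (variance_density (X x t w)).

(** The last observation in a sum of n terms is at time (n - 1) tau, hence the extra [tau] on the
    right; the corrector identity relies on this step. *)
Lemma adapted_grid_sum s tau n t : 0 <= tau -> 0 <= t -> n%:R * tau <= t + tau ->
  adapted F t (W s tau n).
Proof.
move=> tau0 t0 nt; apply: measurable_funM; first exact: measurable_cst.
suff h k : (k <= n)%N -> adapted F t (fun w => \sum_(j < k) grid_obs tau j w) by exact: h.
elim: k => [|k IH] kn.
  rewrite (_ : (fun w => _) = fun=> 0); first exact: measurable_cst.
  by apply/funext => w; rewrite big_ord0.
rewrite (_ : (fun w => _) = fun w => \sum_(j < k) grid_obs tau j w + grid_obs tau k w); last first.
  by apply/funext => w; rewrite big_ord_recr.
apply: measurable_funD; first exact: IH (ltnW kn).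
have k0 : 0 <= k%:R * tau by rewrite mulr_ge0.
apply: (adapted_le F_filt k0 _ (adapted_process F_filt X_markov x k0 mg)).
rewrite -(lerD2r tau) (le_trans _ nt)// -[X in _ + X]mul1r -mulrDl natr1.
by rewrite ler_wpM2r// ler_nat.
Qed.

Lemma measurable_grid_sum s tau n : 0 <= tau -> measurable_fun setT (W s tau n).
Proof.
move=> tau0; have t0 : 0 <= n%:R * tau by rewrite mulr_ge0.
by apply: (measurable_adapted F_filt t0); apply: adapted_grid_sum => //; rewrite lerDl.
Qed.

Lemma grid_sum_increment s tau j l w : 0 <= s -> 0 <= tau ->
  `|W s tau (j + l) w - W s tau j w| <= s * tau * \sum_(m < l) `|grid_obs tau (j + m) w|.
Proof.
move=> s0 tau0; elim: l => [|l IH]; first by rewrite addn0 subrr normr0 big_ord0 mulr0.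
rewrite addnS big_ord_recr/= mulrDr.
have -> : W s tau (j + l).+1 w - W s tau j w =
    (W s tau (j + l) w - W s tau j w) + s * tau * grid_obs tau (j + l) w.
  by rewrite -(partial_sumS (grid_obs tau)) /grid_sum; ring.
rewrite (le_trans (ler_normD _ _))// lerD//.
by rewrite normrM (ger0_norm (mulr_ge0 s0 tau0)).
Qed.

Let L1_Fc t : 0 <= t -> L1 P (fun w => Fx t w - D).
Proof.
move=> t0; have [B B0 hB] := process_moments x.
by apply: L1B; [exact: (L1_gphi hB)|exact: L1_cst].
Qed.

Let obs_bound s tau n (h : R -> R) c t : 0 <= tau -> 0 <= t -> continuous h ->
  (forall y, `|h y| <= c) ->
  L1 P (fun w => h (W s tau n w) * (Fx t w - D)).
Proof.
move=> tau0 t0 ch hc; have c0 : 0 <= c by exact: le_trans (hc 0).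
have LF := L1_Fc t0.
apply: (@L1_le _ _ _ _ _ (fun w => c * `|Fx t w - D|)).
- apply: measurable_funM; last exact: L1_measurable LF.
  exact: (measurableT_comp (continuous_measurable_fun ch) (measurable_grid_sum s n tau0)).
- by apply: L1Z; exact: L1_norm.
- by move=> w; rewrite normrM ler_wpM2r.
Qed.

Lemma trivial_estimate : exists2 C, 0 <= C & forall s tau i (h : R -> R) c,
  0 <= tau -> continuous h -> (forall y, `|h y| <= c) ->
  `|\int[P]_w (h (W s tau i w) * (Fx (i%:R * tau) w - D))| <= c * C.
Proof.
have [B B0 hB] := process_moments x; exists B => // s tau i h c tau0 ch hc.
have c0 : 0 <= c by exact: le_trans (hc 0).
have t0 : 0 <= i%:R * tau by rewrite mulr_ge0.
have LF := L1_norm (L1_Fc t0).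
rewrite (le_trans (ER_abs (obs_bound s i tau0 t0 ch hc) (L1Z c LF) _))//.
  by move=> w; rewrite normrM ler_wpM2r.
by rewrite (ERZ c LF) ler_wpM2l//; exact: (bound_F hB).
Qed.

(* Freezing the weight [h (W _)] a time [t] in the past costs little because  *)
(* [s] is small; the frozen weight is then decoupled by mixing over time [t]. *)
Lemma lag_estimate : exists2 C, 0 <= C & forall s tau j l (h : R -> R) c t K,
  0 <= s -> 0 <= tau -> 0 <= t -> t <= l%:R * tau -> 0 < K ->
  continuous h -> (forall y, `|h y| <= c) ->
  (forall y z, `|h z - h y| <= c * `|z - y|) ->
  `|\int[P]_w (h (W s tau (j + l) w) * (Fx ((j + l)%:R * tau) w - D))| <=
    c * (C * (s * (l%:R * tau) + K * rho t `^ gamma1 + K^-1)).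
Proof.
have [B B0 hB] := process_moments x; have [CF CF0 hF] := F_holder.
have ag0 : 0 <= a + growth by rewrite addr_ge0.
have [C C0 hC] := mixing_bound E_sep F_filt X_markov A1 mu_inv x ag0 growth_r CF0 hF.
exists (C + (B + B)); first by rewrite !addr_ge0.
move=> s tau j l h c t K s0 tau0 t0 tl K0 ch hc hl.
have c0 : 0 <= c by exact: le_trans (hc 0).
pose T := (j + l)%:R * tau.
have j0 : 0 <= j%:R * tau by rewrite mulr_ge0.
have T0 : 0 <= T by rewrite mulr_ge0.
have jT : j%:R * tau <= T - t by rewrite /T natrD mulrDl; move: tl; lra.
have Tt : 0 <= T - t by exact: le_trans jT.
have Lj := obs_bound s j tau0 T0 ch hc.
have Li := obs_bound s (j + l) tau0 T0 ch hc.
have -> : \int[P]_w (h (W s tau (j + l) w) * (Fx T w - D)) =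
    \int[P]_w (h (W s tau (j + l) w) * (Fx T w - D) - h (W s tau j w) * (Fx T w - D)) +
    \int[P]_w (h (W s tau j w) * (Fx T w - D)) by rewrite (ERB Li Lj) subrK.
rewrite (le_trans (ler_normD _ _))//.
have freeze : `|\int[P]_w (h (W s tau (j + l) w) * (Fx T w - D) - h (W s tau j w) * (Fx T w - D))|
    <= c * ((B + B) * (s * (l%:R * tau))).
  (* Products of an observation and the centered density are bounded by sums of squares, whose
     moments are uniform in time. *)
  pose G (m : 'I_l) w := grid_obs tau (j + m) w ^+ 2 + (Fx T w - D) ^+ 2.
  have LG m : L1 P (G m).
    apply: L1D; last exact: (L1_FF hB).
    by apply: (L1_gg hB); rewrite mulr_ge0.
  have LS : L1 P (fun w => \sum_(m < l) G m w) by exact: L1_sum.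
  rewrite (le_trans (ER_abs (L1B Li Lj) (L1Z (c * (s * tau)) LS) _))//.
    move=> w; rewrite -mulrBl normrM.
    rewrite (le_trans (ler_wpM2r (normr_ge0 _) (hl _ _)))// -!mulrA ler_wpM2l//.
    rewrite (le_trans (ler_wpM2r (normr_ge0 _) (grid_sum_increment _ _ _ s0 tau0)))//.
    rewrite -!mulrA ler_wpM2l// ler_wpM2l// mulr_suml ler_sum// => m _.
    rewrite /G -(real_normK (num_real (grid_obs _ _ _))) -(real_normK (num_real (Fx T w - D))).
    set p := `|grid_obs _ _ _|; set p' := `|_ - D|.
    have p0 : 0 <= p by rewrite /p. have p'0 : 0 <= p' by rewrite /p'.
    by have := sqr_ge0 (p - p'); have := mulr_ge0 p0 p'0; rewrite sqrrB; lra.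
  rewrite (ERZ _ LS) -mulrA ler_wpM2l// ER_sum//.
  have : \sum_(m < l) \int[P]_w G m w <= \sum_(m < l) (B + B).
    apply: ler_sum => m _; rewrite ERD; [|by apply: (L1_gg hB); rewrite mulr_ge0|exact: (L1_FF hB)].
    by rewrite lerD//; [apply: (bound_gg hB); rewrite mulr_ge0|exact: (bound_FF hB)].
  rewrite sumr_const card_ord => hS.
  rewrite (le_trans (ler_wpM2l (mulr_ge0 s0 tau0) hS))// -[(B + B) *+ l]mulr_natr.
  by rewrite le_eqVlt; apply/orP; left; apply/eqP; ring.
have decouple : `|\int[P]_w (h (W s tau j w) * (Fx T w - D))| <= c * (C * (K * rho t `^ gamma1 + K^-1)).
  have aV : adapted F (T - t) (fun w => h (W s tau j w)).
    apply: (measurableT_comp (continuous_measurable_fun ch)).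
    by apply: adapted_grid_sum => //; rewrite (le_trans jT)// lerDl.
  have VM w : `|h (W s tau j w)| <= c by exact: hc.
  have mFc : measurable_fun setT ((fun u => variance_density u - D) : borelType E -> R).
    by apply: measurable_funB; [exact: mF|exact: measurable_cst].
  have LT : L1 P (fun w => Fx (T - t + t) w - D) by apply: L1_Fc; rewrite subrK.
  have Ly y : L1 P (fun w => variance_density (X y t w)).
    by have [By By0 hBy] := process_moments y; exact: (L1_gphi hBy).
  have Lyc y : L1 P (fun w => variance_density (X y t w) - D) by apply: L1B => //; exact: L1_cst.
  have [_] := markov_expectation F_filt X_markov Tt t0 aV VM mFc LT Lyc.
  rewrite subrK => ->.
  have [Ls Is] := hC t (T - t) K t0 Tt K0.
  have Es u : semigroup P X t (fun u => variance_density u - D) u =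
      semigroup P X t variance_density u - D.
    by rewrite /semigroup (ERB (Ly u) (L1_cst P D)) ER_cst.
  under eq_Rintegral do rewrite Es.
  apply: (@le_trans _ _ (\int[P]_w (c * `|semigroup P X t variance_density (X x (T - t) w) - D|))).
    apply: ER_abs; [|exact: L1Z|by move=> w; rewrite normrM ler_wpM2r].
    apply: (@L1_le _ _ _ _ _ (fun w => c * `|semigroup P X t variance_density (X x (T - t) w) - D|)).
    - apply: measurable_funM; first exact: measurable_adapted aV.
      apply: measurable_funB; last exact: measurable_cst.
      apply: (measurableT_comp _ (mX x Tt)).
      exact: (measurable_semigroup F_filt X_markov t0 mF Ly).
    - exact: L1Z.
    - by move=> w; rewrite normrM ler_wpM2r.
  by rewrite ERZ// ler_wpM2l.
rewrite (le_trans (lerD freeze decouple))// -mulrDr ler_wpM2l//.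
have q1 : 0 <= s * (l%:R * tau) by rewrite !mulr_ge0.
have q2 : 0 <= K * rho t `^ gamma1 + K^-1.
  by rewrite addr_ge0 ?mulr_ge0 ?powR_ge0 ?invr_ge0 ?(ltW K0).
have := mulr_ge0 C0 q1; have := mulr_ge0 (addr_ge0 B0 B0) q2.
rewrite -addrA [(C + _) * _]mulrDl !(mulrDr C) !(mulrDr (B + B)); lra.
Qed.

End grid_clt.

Section grid_limits.
Context (R : realType) (E : completeNormedModType R) (E_sep : separable E).
Context d (Omega : measurableType d) (P : probability Omega R).
Context (F : R -> set (set Omega)) (F_filt : filtration F).
Context (X : E -> R -> Omega -> E) (X_markov : markov_family P `[0, +oo[ F setT X).
Context (r rt gamma1 beta : R) (rho : R -> R).
Hypothesis A1 : ergodic_process P X r rt gamma1 beta rho.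
Context (mu : probability (borelType E) R) (mu_inv : invariant_measure P X mu).
Context (f : E -> R) (a Cf : R).
Hypotheses (a0 : 0 <= a) (Cf0 : 0 <= Cf) (f_holder : holder_weight a gamma1 Cf f).
Local Notation growth := (gamma1 * (1 + beta) + rt * (2 * a)).
Hypothesis growth_r : 2 * (a + growth) <= r.
Context (taut eta : R) (taut0 : 0 < taut) (eta0 : 0 < eta).
Hypothesis cell_regular : forall x, exists2 C, 0 <= C & forall s t,
  0 < s <= taut -> 0 <= t ->
  \int[P]_w `|f (X x t w) - f (X x ((Num.truncn (t / s))%:R * s) w)| <= C * s `^ eta.
Context (x : E).

Local Notation phi := (poisson P X mu f).
Local Notation Fd := (variance_density P X mu f).
Local Notation D := (mean mu Fd).
Local Notation W := (grid_sum X mu f x).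

Let mW s tau n : 0 <= tau -> measurable_fun setT (W s tau n).
Proof. exact: (measurable_grid_sum F_filt X_markov A1 mu a0 Cf0 f_holder). Qed.

(** The first l indices, l tau being the first grid time after t, have no room for a lag and are
    bounded trivially, at total cost s^2 l tau. All others use [lag_estimate], and the weights s^2
    tau sum to at most 1. *)
Lemma averaging : exists2 C, 0 <= C & forall s tau k n (h : R -> R) c t K,
  0 <= s -> 0 < tau -> s ^+ 2 * tau * k%:R <= 1 -> (n <= k)%N -> 0 <= t -> 0 < K ->
  continuous h -> (forall y, `|h y| <= c) ->
  (forall y z, `|h z - h y| <= c * `|z - y|) ->
  s ^+ 2 * tau * `|\sum_(i < n) \int[P]_w (h (W s tau i w) * (Fd (X x (i%:R * tau) w) - D))| <=
    c * (C * ((s + s ^+ 2) * (t + tau) + K * rho t `^ gamma1 + K^-1)).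
Proof.
have [C1 C10 h1] := trivial_estimate E_sep F_filt X_markov A1 mu_inv a0 Cf0 f_holder
  growth_r taut0 eta0 cell_regular x.
have [C2 C20 h2] := lag_estimate E_sep F_filt X_markov A1 mu_inv a0 Cf0 f_holder
  growth_r taut0 eta0 cell_regular x.
exists (C1 + C2); first by rewrite addr_ge0.
move=> s tau k n h c t K s0 tau0 sk nk t0 K0 ch hc hl.
have c0 : 0 <= c by exact: le_trans (hc 0).
have tauW := ltW tau0.
pose z i := \int[P]_w (h (W s tau i w) * (Fd (X x (i%:R * tau) w) - D)).
pose l := (Num.truncn (t / tau)).+1.
have tt : 0 <= t / tau by rewrite divr_ge0.
have /andP[lo hi] := truncn_itv tt.
have l1 : t <= l%:R * tau by rewrite -ler_pdivrMr// ltW.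
have l2 : l%:R * tau <= t + tau.
  by rewrite /l -natr1 mulrDl mul1r lerD2r -ler_pdivlMr.
pose de := s * (l%:R * tau) + K * rho t `^ gamma1 + K^-1.
have de0 : 0 <= de.
  by rewrite !addr_ge0 ?mulr_ge0 ?powR_ge0 ?invr_ge0 ?(ltW K0).
have zS m : `|\sum_(i < m) z i| <= (minn m l)%:R * (c * C1) + m%:R * (c * (C2 * de)).
  elim: m => [|m IH]; first by rewrite big_ord0 normr0 min0n !mul0r addr0.
  rewrite big_ord_recr/= (le_trans (ler_normD _ _))// (le_trans (lerD IH (lexx _)))//.
  have d0 : 0 <= c * (C2 * de) by rewrite !mulr_ge0.
  rewrite -[m.+1%:R]natr1 mulrDl mul1r.
  case: (ltnP m l) => ml.
    have -> : minn m.+1 l = m.+1 by apply/minn_idPl.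
    rewrite -[m.+1%:R]natr1 mulrDl mul1r.
    by have := h1 s tau m h c tauW ch hc; rewrite -/(z m); lra.
  have -> : minn m.+1 l = l by apply/minn_idPr; rewrite leqW.
  have := h2 s tau (m - l)%N l h c t K s0 tauW t0 l1 K0 ch hc hl.
  by rewrite subnK// -/(z m) -/de; lra.
have st0 : 0 <= s ^+ 2 * tau by rewrite mulr_ge0 ?exprn_ge0.
rewrite (le_trans (ler_wpM2l st0 (zS n)))// mulrDr.
have e1 : s ^+ 2 * tau * ((minn n l)%:R * (c * C1)) <= c * (C1 * (s ^+ 2 * (t + tau))).
  have -> : s ^+ 2 * tau * ((minn n l)%:R * (c * C1)) = c * (C1 * (s ^+ 2 * ((minn n l)%:R * tau))) by ring.
  rewrite ler_wpM2l// ler_wpM2l// ler_wpM2l ?exprn_ge0// (le_trans _ l2)//.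
  by rewrite ler_wpM2r// ler_nat geq_minr.
have e2 : s ^+ 2 * tau * (n%:R * (c * (C2 * de))) <= c * (C2 * de).
  rewrite mulrA ler_piMl ?mulr_ge0// (le_trans _ sk)//.
  by rewrite ler_wpM2l// ler_nat.
have e3 : c * (C2 * de) <= c * (C2 * (s * (t + tau) + K * rho t `^ gamma1 + K^-1)).
  rewrite ler_wpM2l// ler_wpM2l// /de -2!addrA lerD2r.
  by rewrite ler_wpM2l.
have e4 : 0 <= c * (C1 * (s * (t + tau) + K * rho t `^ gamma1 + K^-1)).
  by rewrite !mulr_ge0// !addr_ge0 ?mulr_ge0 ?powR_ge0 ?invr_ge0 ?(ltW K0)// addr_ge0.
have e5 : 0 <= c * (C2 * (s ^+ 2 * (t + tau))).
  by rewrite !mulr_ge0 ?exprn_ge0 ?addr_ge0.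
rewrite (le_trans (lerD e1 (le_trans e2 e3)))//.
rewrite (_ : c * ((C1 + C2) * _) = c * (C1 * (s ^+ 2 * (t + tau))) +
   c * (C2 * (s * (t + tau) + K * rho t `^ gamma1 + K^-1)) +
   (c * (C1 * (s * (t + tau) + K * rho t `^ gamma1 + K^-1)) +
    c * (C2 * (s ^+ 2 * (t + tau))))); last by ring.
by rewrite lerDl addr_ge0.
Qed.

(** In the last group of errors, s comes from the corrector at both ends, tau^eta / s from the
    Poisson equation over k steps, and tau and s tau from the Taylor remainders; all use s^2 tau k =
    1. The other terms are those of [averaging]. *)
Lemma grid_expansion : exists2 C, 0 <= C & forall s tau k n psi psi1 psi2 c t K,
  0 < s -> 0 < tau <= taut -> s ^+ 2 * tau * k%:R = 1 -> (n <= k)%N -> 0 <= t -> 0 < K ->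
  smooth_test psi psi1 psi2 c ->
  `|\int[P]_w psi (W s tau n w) - psi 0 -
    D * (s ^+ 2 * tau) * \sum_(i < n) \int[P]_w psi2 (W s tau i w)| <=
  c * (C * ((s + s ^+ 2) * (t + tau) + K * rho t `^ gamma1 + K^-1 +
    (s + tau `^ eta / s + tau + s * tau))).
Proof.
have [C1 C10 h1] := averaging.
have [B B0 hB] := process_moments E_sep F_filt X_markov A1 mu_inv a0 Cf0 f_holder
  growth_r taut0 eta0 cell_regular x.
have growth0 : 0 <= growth.
  have [b0 _] := andP (ep_beta A1); have rt0 : 0 <= rt by exact: le_trans (ep_rt A1).
  have [/ltW g0 _] := andP (ep_gamma1 A1).
  by rewrite addr_ge0 ?mulr_ge0// addr_ge0.
have a2r : 2 * a <= r by move: growth_r growth0; lra.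
have gr : growth <= r by move: growth_r growth0 a0; lra.
have [C2 C20 h2] := corrector_identity E_sep F_filt X_markov A1 mu_inv a0 Cf0 f_holder
  a2r gr taut0 eta0 cell_regular x.
exists (C1 + (B + B) + C2); first by rewrite !addr_ge0.
move=> s tau k n psi psi1 psi2 c t K s0 tauT sk nk t0 K0 psiP.
have [tau0 _] := andP tauT; have tauW := ltW tau0; have sW := ltW s0.
have [cp cp1 cp2 bp b1 b2 _ l2 _ _] := psiP.
have c0 : 0 <= c by exact: le_trans (bp 0).
have g0 i : 0 <= i%:R * tau by rewrite mulr_ge0.
have L_phi i := L1_phi hB (g0 i); have L_xi i := L1_g hB (g0 i).
have L_xi2 i := L1_gg hB (g0 i); have L_xiphi i := L1_gphi hB (g0 i).
have L_xi2phi i := L1_ggphi hB (g0 i).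
have corr i : (i < k)%N -> `|\int[P]_w (psi1 (partial_sum (grid_obs X mu f x tau) s tau i.+1 w) *
    (phi (X x (i.+1%:R * tau) w) - phi (X x (i%:R * tau) w) + tau * grid_obs X mu f x tau i w))| <=
    c * (tau * (C2 * tau `^ eta)).
  move=> _; apply: (h2 i tau _ c tauT) => //.
  apply: (measurableT_comp (continuous_measurable_fun cp1)).
  apply: (adapted_grid_sum F_filt X_markov A1 mu a0 Cf0 f_holder) => //.
  by rewrite -natr1 mulrDl mul1r.
have main := @corrector_expansion _ _ _ P (grid_obs X mu f x tau)
  (fun i w => phi (X x (i%:R * tau) w)) s tau k
  (fun i => L1_measurable (L_xi i)) (fun i => L1_measurable (L_phi i)) sW tauW B
  L_phi L_xi L_xi2 L_xiphi L_xi2phi (fun i => bound_phi hB (g0 i))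
  (fun i => bound_gg hB (g0 i)) (fun i => bound_ggphi hB (g0 i)) psi psi1 psi2 c _ psiP corr n nk.
have st0 : 0 <= s ^+ 2 * tau by rewrite mulr_ge0 ?exprn_ge0.
have avg := h1 s tau k n psi2 c t K sW tau0 (eq_ind_r (fun z => z <= 1) (lexx 1) sk) nk t0 K0 cp2 b2 l2.
have split_i i : \int[P]_w (psi2 (W s tau i w) * (grid_obs X mu f x tau i w * phi (X x (i%:R * tau) w))) =
    \int[P]_w (psi2 (W s tau i w) * (Fd (X x (i%:R * tau) w) - D)) + D * \int[P]_w psi2 (W s tau i w).
  have Lp : L1 P (fun w => psi2 (W s tau i w)).
    apply: (@L1_bounded _ _ _ _ _ c) => //.
    exact: (measurableT_comp (continuous_measurable_fun cp2) (mW s i tauW)).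
  have LF : L1 P (fun w => Fd (X x (i%:R * tau) w) - D) by apply: L1B; [exact: L_xiphi|exact: L1_cst].
  have Lq : L1 P (fun w => psi2 (W s tau i w) * (Fd (X x (i%:R * tau) w) - D)).
    apply: (@L1_le _ _ _ _ _ (fun w => c * `|Fd (X x (i%:R * tau) w) - D|)).
    - by apply: measurable_funM; [exact: L1_measurable Lp|exact: L1_measurable LF].
    - by apply: L1Z; exact: L1_norm.
    - by move=> w; rewrite normrM ler_wpM2r.
  rewrite -(ERZ D Lp) -(ERD Lq (L1Z D Lp)); apply: eq_Rintegral => w _.
  by rewrite /variance_density /grid_obs; ring.
move: main; under eq_bigr do rewrite -/(W s tau _ _) split_i.
rewrite big_split/= -mulr_sumr => main.
set S1 := \sum_(i < n) _ in main; set S2 := \sum_(i < n) _ in main *.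
have -> : \int[P]_w psi (W s tau n w) - psi 0 - D * (s ^+ 2 * tau) * S2 =
  (\int[P]_w psi (W s tau n w) - psi 0 - s ^+ 2 * tau * (S1 + D * S2)) + s ^+ 2 * tau * S1 by ring.
rewrite (le_trans (ler_normD _ _))// [`|s ^+ 2 * tau * S1|]normrM (ger0_norm st0).
rewrite (le_trans (lerD main avg))// -mulrDr ler_wpM2l//.
have nk1 : s ^+ 2 * tau * n%:R <= 1 by rewrite -[leRHS]sk ler_wpM2l// ler_nat.
have p1 : n%:R * (s * tau * (C2 * tau `^ eta)) <= C2 * (tau `^ eta / s).
  have -> : n%:R * (s * tau * (C2 * tau `^ eta)) = (s ^+ 2 * tau * n%:R) * (C2 * (tau `^ eta / s)).
    by field; rewrite gt_eqF.
  by rewrite ler_piMl// !mulr_ge0 ?powR_ge0 ?invr_ge0.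
have p2 : n%:R * (s ^+ 2 * tau ^+ 2 * B) <= B * tau.
  have -> : n%:R * (s ^+ 2 * tau ^+ 2 * B) = (s ^+ 2 * tau * n%:R) * (B * tau) by ring.
  by rewrite ler_piMl// !mulr_ge0.
have p3 : n%:R * (s ^+ 3 * tau ^+ 2 * B) <= B * (s * tau).
  have -> : n%:R * (s ^+ 3 * tau ^+ 2 * B) = (s ^+ 2 * tau * n%:R) * (B * (s * tau)) by ring.
  by rewrite ler_piMl// !mulr_ge0.
set A := (s + s ^+ 2) * (t + tau) + K * rho t `^ gamma1 + K^-1.
have A0 : 0 <= A.
  by rewrite !addr_ge0 ?mulr_ge0 ?powR_ge0 ?invr_ge0 ?(ltW K0)// ?addr_ge0// exprn_ge0.
set p := tau `^ eta / s in p1 *; have p0 : 0 <= p by rewrite divr_ge0 ?powR_ge0.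
have st : 0 <= s * tau by rewrite mulr_ge0.
clearbody A p; apply: (@le_trans _ _ (2 * (B * s) + C2 * p + B * tau + B * (s * tau) + C1 * A)).
  rewrite lerD2r [2 * s * B](_ : _ = 2 * (B * s)); last by ring.
  by rewrite -!addrA lerD2l !mulrDr !addrA !lerD.
rewrite -subr_ge0 (_ : _ - _ = (B + B + C2) * A + (C1 + C2) * s + (C1 + B + B) * p +
  (C1 + B + C2) * tau + (C1 + B + C2) * (s * tau)); last by ring.
by rewrite !addr_ge0 ?mulr_ge0 ?addr_ge0.
Qed.

End grid_limits.

(** * Characteristic functions and tails of the sums on the grid *)

Section grid_limits.
Context (R : realType) (E : completeNormedModType R) (E_sep : separable E).
Context d (Omega : measurableType d) (P : probability Omega R).
Context (F : R -> set (set Omega)) (F_filt : filtration F).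
Context (X : E -> R -> Omega -> E) (X_markov : markov_family P `[0, +oo[ F setT X).
Context (r rt gamma1 beta : R) (rho : R -> R).
Hypothesis A1 : ergodic_process P X r rt gamma1 beta rho.
Context (mu : probability (borelType E) R) (mu_inv : invariant_measure P X mu).
Context (f : E -> R) (a Cf : R).
Hypotheses (a0 : 0 <= a) (Cf0 : 0 <= Cf) (f_holder : holder_weight a gamma1 Cf f).
Local Notation growth := (gamma1 * (1 + beta) + rt * (2 * a)).
Hypothesis growth_r : 2 * (a + growth) <= r.
Context (taut eta : R) (taut0 : 0 < taut) (eta0 : 0 < eta).
Hypothesis cell_regular : forall x, exists2 C, 0 <= C & forall s t,
  0 < s <= taut -> 0 <= t ->
  \int[P]_w `|f (X x t w) - f (X x ((Num.truncn (t / s))%:R * s) w)| <= C * s `^ eta.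
Context (x : E).

Local Notation phi := (poisson P X mu f).
Local Notation Fd := (variance_density P X mu f).
Local Notation D := (mean mu Fd).
Local Notation W := (grid_sum X mu f x).

Let mW s tau n : 0 <= tau -> measurable_fun setT (W s tau n).
Proof. exact: (measurable_grid_sum F_filt X_markov A1 mu a0 Cf0 f_holder). Qed.

(** All that the limit uses of the step sizes. The last equation says s = (k tau)^(-1/2); the
    condition on tau^eta makes negligible both the corrector error and the passage from Y to X. *)
Definition small_grid (de s tau : R) (k : nat) : Prop :=
  [/\ 0 < s <= de, 0 < tau <= taut, tau <= de, tau `^ eta <= de * s &
      s ^+ 2 * tau * k%:R = 1].

Lemma small_grid_le de de' s tau k : de <= de' -> small_grid de s tau k ->
  small_grid de' s tau k.
Proof.
move=> dd [/andP[s0 sd] tT td th sk]; split=> //.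
- by rewrite s0 (le_trans sd).
- exact: le_trans dd.
- by rewrite (le_trans th)// ler_wpM2r// ltW.
Qed.

Lemma small_grid_inv de s tau k : de <= 1 -> small_grid de s tau k ->
  [/\ (0 < k)%N, s ^+ 2 * tau = k%:R^-1 & k%:R^-1 <= de].
Proof.
move=> d1 [/andP[s0 sd] /andP[tau0 _] td _ sk].
have k0 : (0 < k)%N.
  by rewrite lt0n; apply/eqP => k0; move: sk; rewrite k0 mulr0 => /esym/eqP; rewrite oner_eq0.
have kn : k%:R != 0 :> R by rewrite pnatr_eq0 -lt0n.
have E1 : s ^+ 2 * tau = k%:R^-1 by apply: (mulIf kn); rewrite sk mulVf.
split=> //; rewrite -E1 -[de]mul1r ler_pM ?exprn_ge0 ?(ltW s0) ?(ltW tau0)//.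
by rewrite exprn_ile1 ?(ltW s0)// (le_trans sd).
Qed.

(** Order of the choices: K makes 1 / K small, then t makes K rho(t)^gamma1 small, and only then
    [de] makes s (t + tau) and the remaining errors small. *)
Lemma expansion_limit e : 0 < e -> exists2 de, 0 < de <= 1 &
  forall s tau k n psi psi1 psi2 c, small_grid de s tau k -> (n <= k)%N ->
    smooth_test psi psi1 psi2 c ->
    `|\int[P]_w psi (W s tau n w) - psi 0 -
      D * (s ^+ 2 * tau) * \sum_(i < n) \int[P]_w psi2 (W s tau i w)| <= c * e.
Proof.
move=> e0; have [C C0 hC] := grid_expansion E_sep F_filt X_markov A1 mu_inv a0 Cf0 f_holder
  growth_r taut0 eta0 cell_regular x.
have [g0 _] := andP (ep_gamma1 A1).
have C1 : 0 < C + 1 by rewrite ltr_wpDl.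
pose e1 := e / (C + 1) / 4; have e10 : 0 < e1 by rewrite !divr_gt0.
pose K := e1^-1; have K0 : 0 < K by rewrite invr_gt0.
have eK : 0 < (e1 / K) `^ gamma1^-1 by rewrite powR_gt0// divr_gt0.
have [t t0 rt_small] := rate_arbitrarily_small A1 eK.
have Kr : K * rho t `^ gamma1 <= e1.
  rewrite -ler_pdivlMl// mulrC (@le_trans _ _ (((e1 / K) `^ gamma1^-1) `^ gamma1))//.
    by apply: powR_mono; [exact: ltW|exact: (ep_rho_ge0 A1)|exact: ltW].
  by rewrite -powRrM mulVf ?gt_eqF// powRr1// divr_ge0// ltW.
have T0 : 0 < 2 * t + 6 by rewrite ltr_wpDl// mulr_ge0.
pose de := Num.min 1 (e1 / (2 * t + 6)).
have de0 : 0 < de by rewrite lt_min ltr01 divr_gt0.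
have de1 : de <= 1 by rewrite ge_min lexx.
have deT : de * (2 * t + 6) <= e1 by rewrite -ler_pdivlMr// ge_min lexx orbT.
exists de; first by rewrite de0.
move=> s tau k n psi psi1 psi2 c [/andP[s0 sd] tT td th sk] nk psiP.
have c0 : 0 <= c by exact: le_trans (test_bound psiP 0).
have [tau0 _] := andP tT.
rewrite (le_trans (hC s tau k n psi psi1 psi2 c t K s0 tT sk nk t0 K0 psiP))//.
rewrite ler_wpM2l//.
have s2 : s ^+ 2 <= de by rewrite (le_trans _ sd)// expr2 ler_piMl ?(ltW s0)// (le_trans sd).
have st : s * tau <= de by rewrite -[de]mul1r ler_pM ?(ltW s0) ?(ltW tau0)// (le_trans sd).
have p : tau `^ eta / s <= de by rewrite ler_pdivrMr.
have sst : (s + s ^+ 2) * (t + tau) <= (de + de) * (t + 1).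
  rewrite ler_pM ?addr_ge0 ?exprn_ge0 ?(ltW s0) ?(ltW tau0)// ?lerD//.
  by rewrite (le_trans td).
have err : (s + s ^+ 2) * (t + tau) + K * rho t `^ gamma1 + K^-1 +
    (s + tau `^ eta / s + tau + s * tau) <= e / (C + 1).
  have -> : e / (C + 1) = 4 * e1 by rewrite /e1; field; rewrite gt_eqF.
  have Ke : K^-1 = e1 by rewrite invrK.
  have := deT; rewrite mulrDr => deT'.
  have : (de + de) * (t + 1) = de * (2 * t) + 2 * de by ring.
  by rewrite Ke; move: sst Kr s2 st p sd td e10; lra.
rewrite (le_trans (ler_wpM2l C0 err))// mulrCA ler_piMr ?(ltW e0)//.
by rewrite ler_pdivrMr// mul1r lerDl.
Qed.

Let W0 s tau w : W s tau 0 w = 0.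
Proof. by rewrite /grid_sum /partial_sum big_ord0 mulr0. Qed.

(** The second derivative of a cosine is - th^2 times itself and s^2 tau = 1 / k, so the expansion
    becomes the linear recursion with a = - th^2 D, whose solution after k steps is close to cos b
    exp(a). *)
Lemma charfun_limit th b e : 0 < e -> exists2 de, 0 < de & forall s tau k,
  small_grid de s tau k ->
  `|\int[P]_w cos (th * W s tau k w + b) - cos b * expR (- (th ^+ 2 * D))| <= e.
Proof.
move=> e0; have psiP := smooth_test_cos th b.
set c := 1 + _ + _ + _ in psiP; have c0 : 0 <= c by exact: le_trans (test_bound psiP 0).
pose A := - (th ^+ 2 * D); pose M := expR `|A|; have M0 : 0 < M by exact: expR_gt0.
pose N := 2 * M * A ^+ 2.
have N0 : 0 <= N by exact: mulr_ge0 (mulr_ge0 (ler0n _ 2) (ltW M0)) (sqr_ge0 A).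
pose e1 := e / (2 * M * (c + 1)).
have c1 : 0 < c + 1 by rewrite ltr_wpDl.
have N1 : 0 < N + 1 by rewrite ltr_wpDl.
have e10 : 0 < e1 by rewrite divr_gt0 ?mulr_gt0.
have [de1 /andP[de10 de11] hde] := expansion_limit e10.
pose de := Num.min de1 (Num.min (2 * (`|A| + 1))^-1 (e / (2 * M * (N + 1)))).
have A1' : 0 < 2 * (`|A| + 1) by rewrite mulr_gt0// ltr_wpDl.
have de0 : 0 < de by rewrite !lt_min de10 invr_gt0 A1'/= divr_gt0// !mulr_gt0.
exists de => // s tau k sg.
have dle : de <= de1 by rewrite ge_min lexx.
have [k0 sk ki] := small_grid_inv (le_trans dle de11) sg.
have sg1 := small_grid_le dle sg.
pose u n := \int[P]_w cos (th * W s tau n w + b).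
have u0 : u 0%N = cos b.
  rewrite /u (_ : (fun w => _) = fun=> cos b) ?ER_cst//.
  by apply/funext => w; rewrite W0 mulr0 add0r.
have tau0 : 0 <= tau by case: sg => _ /andP[/ltW].
have uE n : \int[P]_w (- th ^+ 2 * cos (th * W s tau n w + b)) = - th ^+ 2 * u n.
  rewrite ERZ//; apply: (@L1_bounded _ _ _ _ _ c).
    exact: (measurableT_comp (continuous_measurable_fun (test_cont psiP)) (mW s n tau0)).
  by move=> w; exact: (test_bound psiP).
have rec n : (n <= k)%N -> `|u n - u 0%N - A / k%:R * \sum_(i < n) u i| <= c * e1.
  move=> nk; have := hde s tau k n _ _ _ c sg1 nk psiP.
  under eq_bigr do rewrite uE.
  rewrite -mulr_sumr sk mulr0 add0r -/(u n) u0 /A.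
  by rewrite (_ : D / k%:R * _ = - (th ^+ 2 * D) / k%:R * \sum_(i < n) u i)//; ring.
have Ak : `|A / k%:R| <= 2^-1.
  rewrite normrM (ger0_norm (_ : 0 <= k%:R^-1)) ?invr_ge0//.
  rewrite (@le_trans _ _ (`|A| * (2 * (`|A| + 1))^-1))//.
    by rewrite ler_wpM2l// (le_trans ki)// !ge_min lexx orbT.
  by rewrite ler_pdivrMr// mulrA mulVf ?pnatr_eq0// mul1r lerDl.
have ce0 : 0 <= c * e1 by rewrite mulr_ge0// ltW.
have := linear_recursion_expR k0 Ak ce0 rec; rewrite u0 -/M => h.
rewrite (le_trans h)//.
have cb : `|cos b| <= 1 by rewrite ler_norml cos_geN1 cos_le1.
have h1 : c * e1 * M <= e / 2.
  have -> : c * e1 * M = (c / (c + 1)) * (e / 2).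
    by rewrite /e1; field; rewrite !gt_eqF.
  by rewrite ler_piMl ?divr_ge0 ?(ltW e0)// ler_pdivrMr// mul1r lerDl.
have h2 : `|cos b| * (2 * M * A ^+ 2 / k%:R) * M <= e / 2.
  rewrite -/N (@le_trans _ _ (1 * (N * (e / (2 * M * (N + 1)))) * M))//.
    rewrite ler_wpM2r ?(ltW M0)// ler_pM ?divr_ge0//.
    by rewrite ler_wpM2l// (le_trans ki)// !ge_min lexx !orbT.
  have -> : 1 * (N * (e / (2 * M * (N + 1)))) * M = (N / (N + 1)) * (e / 2).
    by field; rewrite !gt_eqF.
  by rewrite ler_piMl ?divr_ge0 ?(ltW e0)// ler_pdivrMr// mul1r lerDl.
by rewrite mulrDl; move: h1 h2; lra.
Qed.

(** [tail_fun] vanishes at 0, so its expectation is at most the expansion error e / 2 plus 72 |D| /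
    L^2. The threshold makes L, hence L^2, at least [Q], and the second term is at most e / 2
    too. *)
Lemma tail_limit e : 0 < e -> exists2 L0, 1 <= L0 & forall L, L0 <= L ->
  exists2 de, 0 < de & forall s tau k, small_grid de s tau k ->
    \int[P]_w tail_fun L (W s tau k w) <= e.
Proof.
move=> e0; pose Q := 72 * `|D| / (e / 2).
have Q0 : 0 <= Q by rewrite !mulr_ge0// invr_ge0 divr_ge0// ltW.
exists (1 + Q); first by rewrite lerDl.
move=> L LQ; have L1' : 1 <= L by rewrite (le_trans _ LQ)// lerDl.
have [psi1 [psi2 [psiP b2]]] := smooth_test_tail_fun L1'.
have e10 : 0 < e / 2 / 72 by rewrite !divr_gt0.
have [de /andP[de0 de1] hde] := expansion_limit e10.
exists de => // s tau k sg; have [k0 sk _] := small_grid_inv de1 sg.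
have tau0 : 0 <= tau by case: sg => _ /andP[/ltW].
have := hde s tau k k _ _ _ _ sg (leqnn k) psiP.
have -> : tail_fun L 0 = 0 by rewrite /tail_fun expr0n mul0r.
rewrite subr0 sk (_ : 72 * (e / 2 / 72) = e / 2); last by field.
have L2 : 0 < L ^+ 2 by rewrite exprn_gt0// (lt_le_trans _ L1').
have hs : `|\sum_(i < k) \int[P]_w psi2 (W s tau i w)| <= k%:R * (72 / L ^+ 2).
  have -> : k%:R * (72 / L ^+ 2) = \sum_(i < k) (72 / L ^+ 2).
    by rewrite sumr_const card_ord -[RHS]mulr_natl.
  rewrite (le_trans (ler_norm_sum _ _ _))// ler_sum// => i _.
  have Lp : L1 P (fun w => psi2 (W s tau i w)).
    apply: (@L1_bounded _ _ _ _ _ (72 / L ^+ 2)) => //.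
    exact: (measurableT_comp (continuous_measurable_fun (test2_cont psiP)) (mW s i tau0)).
  by rewrite (le_trans (ER_abs Lp (L1_cst P (72 / L ^+ 2)) _))// ER_cst.
have hD : `|D / k%:R * \sum_(i < k) \int[P]_w psi2 (W s tau i w)| <= e / 2.
  rewrite normrM normrM (ger0_norm (_ : 0 <= k%:R^-1)) ?invr_ge0//.
  have kn : k%:R != 0 :> R by rewrite pnatr_eq0 -lt0n.
  rewrite (@le_trans _ _ (`|D| / k%:R * (k%:R * (72 / L ^+ 2))))//.
    by rewrite ler_wpM2l// divr_ge0.
  have -> : `|D| / k%:R * (k%:R * (72 / L ^+ 2)) = 72 * `|D| / L ^+ 2.
    by field; rewrite kn gt_eqF// (lt_le_trans _ L1').
  rewrite ler_pdivrMr//.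
  have -> : 72 * `|D| = e / 2 * Q by rewrite /Q mulrCA divff ?mulr1// gt_eqF// divr_gt0.
  rewrite ler_wpM2l ?divr_ge0 ?(ltW e0)// (@le_trans _ _ L)//.
    by rewrite (le_trans _ LQ)// lerDr.
  by rewrite expr2 ler_peMl// (le_trans _ L1').
move=> h; have := le_trans (ler_norm _) h; have := le_trans (ler_norm _) hD.
lra.
Qed.

End grid_limits.

(** * Step sizes and limit law *)

Section step_sizes.
Context (R : realType).

Lemma powR_eventually_le (b e : R) : 0 < b -> 0 < e ->
  \forall t \near (0 : R)^'+, t `^ b <= e.
Proof.
move=> b0 e0; have e1 : 0 < e `^ b^-1 by rewrite powR_gt0.
near=> t.
have t0 : 0 < t by near: t; exact: nbhs_right_gt.
have te : t <= e `^ b^-1 by near: t; exact: nbhs_right_le.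
by have := powR_mono (ltW b0) (ltW t0) te; rewrite -powRrM mulVf ?gt_eqF// powRr1// ltW.
Unshelve. all: by end_near. Qed.

Lemma natceil_itv (y : R) : 0 < y -> y <= (natceil y)%:R < y + 1.
Proof.
move=> y0; have c0 : 0 <= Num.ceil y by rewrite ltW// ceil_gt0.
have E : (natceil y)%:R = (Num.ceil y)%:~R :> R.
  by rewrite /natceil -[in RHS](gez0_abs c0).
rewrite E; have /andP[h1 ->] := ceil_itv y.
by move: h1; rewrite intrD mulrNz mulr1z ltrBlDr.
Qed.

Lemma num_steps_horizon (lambda tau : R) : 0 < lambda -> 0 < tau <= 1 ->
  tau `^ (- (2 * lambda)) <= (num_steps lambda tau)%:R * tau <= 2 * tau `^ (- (2 * lambda)).
Proof.
move=> l0 /andP[t0 t1]; have y0 : 0 < tau `^ (- 1 - 2 * lambda) by rewrite powR_gt0.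
have /andP[h1 h2] := natceil_itv y0.
have E : tau `^ (- 1 - 2 * lambda) * tau = tau `^ (- (2 * lambda)).
  rewrite -[X in _ * X](powRr1 (ltW t0)) -powRD ?(gt_eqF t0) ?implybT//.
  by rewrite addrAC addNr add0r.
have p1 : 1 <= tau `^ (- (2 * lambda)).
  rewrite powRN -[leLHS]invr1 lef_pV2 ?posrE ?powR_gt0//.
  have l20 : 0 <= 2 * lambda by rewrite mulr_ge0// ltW.
  by have := powR_mono l20 (ltW t0) t1; rewrite powR1.
rewrite -E in p1 *; rewrite /num_steps; set y := tau `^ _ in y0 h1 h2 p1 *.
rewrite ler_wpM2r ?(ltW t0)//= (@le_trans _ _ ((y + 1) * tau))//.
  by rewrite ler_wpM2r ?(ltW t0)// ltW.
by rewrite mulrDl mul1r; lra.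
Qed.

(** The horizon k tau is of order tau^(-2 lambda), so s is of order tau^lambda and tau^eta / s of
    order tau^(eta - lambda): here lambda < eta is decisive. *)
Lemma small_grid_eventually (taut eta lambda de : R) : 0 < taut ->
  0 < lambda < eta -> 0 < de ->
  \forall tau \near (0 : R)^'+,
    small_grid taut eta de (Num.sqrt ((num_steps lambda tau)%:R * tau))^-1 tau
      (num_steps lambda tau).
Proof.
move=> taut0 /andP[l0 le] de0; have el : 0 < eta - lambda by rewrite subr_gt0.
near=> tau.
have t0 : 0 < tau by near: tau; exact: nbhs_right_gt.
have t1 : tau <= 1 by near: tau; exact: nbhs_right_le.
have tT : tau <= taut by near: tau; exact: nbhs_right_le.
have td : tau <= de by near: tau; exact: nbhs_right_le.
have tl : tau `^ lambda <= de by near: tau; exact: powR_eventually_le.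
have te : tau `^ (eta - lambda) <= de / 2.
  by near: tau; apply: powR_eventually_le => //; rewrite divr_gt0.
set k := num_steps lambda tau; pose T := k%:R * tau; rewrite -/T.
have /andP[T1 T2] : tau `^ (- (2 * lambda)) <= T <= 2 * tau `^ (- (2 * lambda)).
  by apply: num_steps_horizon => //; rewrite t0.
have p0 : 0 < tau `^ (- lambda) by rewrite powR_gt0.
have p2 : tau `^ (- (2 * lambda)) = (tau `^ (- lambda)) ^+ 2.
  by rewrite -powR_mulrn ?powR_ge0// -powRrM; congr (_ `^ _); ring.
have T0 : 0 < T by rewrite (lt_le_trans _ T1)// powR_gt0.
have sT0 : 0 < Num.sqrt T by rewrite sqrtr_gt0.
have sT1 : tau `^ (- lambda) <= Num.sqrt T.
  by rewrite -(ger0_norm (ltW p0)) -sqrtr_sqr -p2 ler_sqrt// ltW.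
have sT2 : Num.sqrt T <= 2 * tau `^ (- lambda).
  have q0 : 0 <= 2 * tau `^ (- lambda) by rewrite mulr_ge0// ltW.
  rewrite -[leRHS](ger0_norm q0) -sqrtr_sqr ler_sqrt ?sqr_ge0// (le_trans T2)//.
  by rewrite exprMn -p2 ler_wpM2r ?powR_ge0// expr2 ler_peMl// ler1n.
split=> //.
- by rewrite invr_gt0 sT0 (le_trans _ tl)// -[leRHS]invrK -powRN lef_pV2 ?posrE.
- by rewrite t0.
- rewrite ler_pdivlMr//.
  apply: (@le_trans _ _ (tau `^ eta * (2 * tau `^ (- lambda)))).
    by rewrite ler_wpM2l ?powR_ge0.
  rewrite mulrCA -powRD; last by rewrite (gt_eqF t0) implybT.
  by rewrite mulrC -ler_pdivlMr.
- rewrite exprVn sqr_sqrtr ?(ltW T0)// -mulrA [tau * _]mulrC mulVf// gt_eqF//.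
Unshelve. all: by end_near. Qed.

End step_sizes.

Section limit_law.
Context (R : realType).

Lemma tail_fun_tight (nu : probability (measurableTypeR R) R) (e : R) : 0 < e ->
  \forall n \near \oo, \int[nu]_y tail_fun n.+1%:R y <= e.
Proof.
move=> e0.
have n0 n : 0 < n.+1%:R :> R by [].
have tcvg y : tail_fun n.+1%:R y @[n --> \oo] --> (0 : R).
  have up : y ^+ 2 * n.+1%:R^-1 @[n --> \oo] --> (0 : R).
    by rewrite -(mulr0 (y ^+ 2)); apply: cvgM; [exact: cvg_cst|exact: cvg_harmonic].
  apply: (squeeze_cvgr _ (cvg_cst 0) up).
  near=> n; have /andP[-> _] /= := tail_fun_itv y (n0 n).
  rewrite /tail_fun ler_wpM2l ?sqr_ge0// lef_pV2 ?posrE//; last by rewrite ltr_pwDl ?sqr_ge0// exprn_gt0.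
  rewrite -[leLHS]addr0 lerD ?sqr_ge0// expr2 ler_peMl// ler1n//.
have [_] := @ER_dominated _ _ _ nu (fun n y => tail_fun n.+1%:R y) (fun=> 0) (fun=> 1)
  (fun n => continuous_measurable_fun (continuous_tail_fun (n0 n))) tcvg (L1_cst nu 1)
  (fun n y => tail_fun_norm y (n0 n)).
rewrite ER_cst => /cvgrPdist_le/(_ e e0); apply: filterS => n.
rewrite sub0r normrN; exact: le_trans (ler_norm _).
Unshelve. all: by end_near. Qed.

Lemma centered_gaussian_cos (v2 th b : R) : 0 <= v2 ->
  \int[centered_gaussian v2]_y cos (th * y + b) = cos b * expR (- (th ^+ 2 * (v2 / 2))).
Proof.
move=> v20; rewrite /centered_gaussian; case: eqP => [->|/eqP v2n].
  rewrite mul0r mulr0 oppr0 expR0 mulr1 /Rintegral integral_dirac//.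
    by rewrite diracT mul1e /= mulr0 add0r.
  apply/measurable_EFinP; apply: continuous_measurable_fun => y.
  apply: continuous_comp; last exact: continuous_cos.
  by apply: cvgD; [apply: cvgM; [exact: cvg_cst|exact: cvg_id]|exact: cvg_cst].
have v0 : 0 < v2 by rewrite lt_neqAle eq_sym v2n.
by rewrite normal_prob_cos ?sqrtr_gt0// sqr_sqrtr// mulrA.
Qed.

End limit_law.

(** The factor in front is at least 3, and three times the bracket dominates p + 2 gamma1 (1 + beta)
    + 2 p rt, the order of the moments needed to square the density g phi. *)
Lemma exponents_le (R : realType) (p q qt r rt beta kappa gamma1 gamma lambda : R) :
  1 <= p -> 1 <= qt -> 1 <= rt -> 0 <= beta -> 0 < gamma1 <= gamma ->
  qt ^+ 2 * Num.max 3 (lambda^-1 + 1) *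
    (p * Num.max qt rt + (3 + 4 * Num.max kappa beta) * gamma) <= Num.min q r ->
  [/\ 2 * (p / 2) <= q, 2 * (p / 2) <= r &
      2 * (p / 2 + (gamma1 * (1 + beta) + rt * (2 * (p / 2)))) <= r].
Proof.
move=> p1 qt1 rt1 b0 /andP[g0 gg] h.
have gam0 : 0 < gamma by exact: lt_le_trans gg.
have p0 : 0 <= p by exact: le_trans p1.
set M := Num.max qt rt in h; set N := Num.max kappa beta in h.
have M1 : rt <= M by rewrite le_max lexx orbT.
have N1 : beta <= N by rewrite le_max lexx orbT.
have pM : p * rt <= p * M by rewrite ler_wpM2l.
have prt : p <= p * rt by rewrite ler_peMr.
have Ng : (3 + 4 * beta) * gamma <= (3 + 4 * N) * gamma.
  by rewrite ler_wpM2r ?(ltW gam0)// lerD2l ler_wpM2l.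
have gb : gamma1 * (1 + beta) <= gamma * (1 + beta) by rewrite ler_wpM2r// addr_ge0.
have bg : 0 <= beta * gamma by rewrite mulr_ge0// ltW.
set S := p * M + (3 + 4 * N) * gamma in h.
have S0 : p * rt + (3 + 4 * beta) * gamma <= S by exact: lerD.
have E1 : (3 + 4 * beta) * gamma = 3 * gamma + 4 * (beta * gamma) by ring.
have E2 : gamma * (1 + beta) = gamma + beta * gamma by ring.
have S1 : 0 <= S by move: S0; rewrite E1; lra.
have c3 : 3 <= qt ^+ 2 * Num.max 3 (lambda^-1 + 1).
  rewrite -[leLHS]mul1r ler_pM//; first by rewrite expr2 (le_trans qt1)// ler_peMl// (le_trans _ qt1).
  by rewrite le_max lexx.
have : 3 * S <= Num.min q r by rewrite (le_trans _ h)// ler_wpM2r.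
rewrite le_min => /andP[h1 h2].
have -> : 2 * (p / 2) = p by field.
split; [by move: S0 h1; rewrite E1; lra|by move: S0 h2; rewrite E1; lra|].
have -> : 2 * (p / 2 + (gamma1 * (1 + beta) + rt * p)) = p + 2 * (gamma1 * (1 + beta)) + 2 * (p * rt) by field.
by move: S0 h2 gb; rewrite E1 E2; lra.
Qed.

(** * From the exact process back to the scheme *)

Section scheme_sums.
Context (R : realType) (E : completeNormedModType R) (E_sep : separable E).
Context d (Omega : measurableType d) (P : probability Omega R).
Context (F : R -> set (set Omega)) (F_filt : filtration F).
Context (X : E -> R -> Omega -> E) (X_markov : markov_family P `[0, +oo[ F setT X).
Context (ht taut : R) (Eh : R -> set E) (xh : R -> E -> E).
Hypothesis Eh_spaces : state_spaces ht Eh xh.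
Context (Y : R -> R -> E -> nat -> Omega -> E).
Context (r rt gamma1 beta : R) (rho : R -> R).
Hypothesis A1 : ergodic_process P X r rt gamma1 beta rho.
Context (q qt gamma2 kappa : R) (rhoD : R -> R -> R -> R).
Hypothesis A2 : ergodic_scheme P F Eh Y ht taut q qt gamma2 kappa rhoD.
Context (alpha1 alpha2 : R) (alpha1_gt0 : 0 < alpha1) (alpha2_gt0 : 0 < alpha2).
Hypothesis A3 : strong_order P X xh Y ht taut rt qt alpha1 alpha2.

Context (mu : probability (borelType E) R).
Context (f : E -> R) (a gamma Cf : R).
Hypotheses (a0 : 0 <= a) (aq : 2 * a <= q) (ar : 2 * a <= r) (gamma01 : 0 < gamma <= 1).
Hypotheses (Cf0 : 0 <= Cf) (f_holder : holder_weight a gamma Cf f).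

Definition scheme_sum (h tau s : R) (k : nat) (x : E) (w : Omega) : R :=
  s * \sum_(0 <= i < k) (f (Y h tau (xh h x) i w) - mean mu f) * tau.

Let mf : measurable_fun setT (f : borelType E -> R).
Proof.
apply: continuous_borel_measurable; apply: holder_weight_continuous f_holder => //.
by case/andP: gamma01.
Qed.

Lemma measurable_scheme_sum h tau s k x : 0 <= h <= ht -> 0 < tau <= taut ->
  measurable_fun setT (scheme_sum h tau s k x).
Proof.
move=> hh htau; apply: measurable_funM; first exact: measurable_cst.
apply: measurable_sum => i; apply: measurable_funM; last exact: measurable_cst.
apply: measurable_funB; last exact: measurable_cst.
apply: (measurableT_comp mf).
exact: (measurable_scheme F_filt A2 _ hh htau (ss_xh Eh_spaces x hh)).
Qed.

(** There are k terms of size s tau O(tau^(alpha2 gamma)). As s^2 tau k = 1, the total is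
    O(tau^(alpha2 gamma) / s), at most a multiple of [de]. The condition on h makes the spatial
    error no larger than the temporal one. *)
Lemma scheme_sum_error x : exists2 C, 0 <= C & forall de h s tau k,
  small_grid taut (alpha2 * gamma) de s tau k -> 0 <= h <= ht -> h `^ alpha1 <= tau `^ alpha2 ->
  L1 P (fun w => `|scheme_sum h tau s k x w - grid_sum X mu f x s tau k w|) /\
  \int[P]_w `|scheme_sum h tau s k x w - grid_sum X mu f x s tau k w| <= C * de.
Proof.
have [C C0 hC] := scheme_error E_sep F_filt X_markov Eh_spaces A1 A2 alpha1_gt0 alpha2_gt0
  A3 a0 aq ar gamma01 Cf0 f_holder x.
have [g0 g1] := andP gamma01.
exists (C * 2 `^ gamma); first by rewrite mulr_ge0// powR_ge0.
move=> de h s tau k [/andP[s0 sd] tT td th sk] hh hal.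
have [tau0 _] := andP tT; have tauW := ltW tau0; have sW := ltW s0.
pose Z i w := `|f (X x (i%:R * tau) w) - f (Y h tau (xh h x) i w)|.
have hZ i : L1 P (Z i) /\ \int[P]_w Z i w <= C * (h `^ alpha1 + tau `^ alpha2) `^ gamma.
  have := hC h tau (i%:R * tau) hh tT (mulr_ge0 (ler0n _ i) tauW).
  by rewrite mulfK ?gt_eqF// natrK.
have LS : L1 P (fun w => \sum_(i < k) Z i w) by apply: L1_sum => i; exact: (hZ i).1.
have LZ := L1Z (s * tau) LS.
have bd w : `|scheme_sum h tau s k x w - grid_sum X mu f x s tau k w| <= s * tau * \sum_(i < k) Z i w.
  have -> : scheme_sum h tau s k x w - grid_sum X mu f x s tau k w =
      s * tau * \sum_(i < k) (f (Y h tau (xh h x) i w) - f (X x (i%:R * tau) w)).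
    rewrite /scheme_sum /grid_sum /partial_sum big_mkord -mulr_suml.
    rewrite [X in s * X]mulrC [s * (tau * _)]mulrA -mulrBr -sumrB; congr (_ * _).
    by apply: eq_bigr => i _; rewrite /grid_obs /centered opprB addrA subrK.
  rewrite normrM (ger0_norm (mulr_ge0 sW tauW)) ler_wpM2l ?mulr_ge0//.
  rewrite (le_trans (ler_norm_sum _ _ _))// ler_sum// => i _.
  by rewrite /Z distrC.
have mD : measurable_fun setT (fun w => `|scheme_sum h tau s k x w - grid_sum X mu f x s tau k w|).
  apply: measurableT_comp; first exact: normr_measurable.
  apply: measurable_funB; first exact: measurable_scheme_sum.
  apply: measurable_partial_sum => i; apply: measurable_funB; last exact: measurable_cst.
  apply: (measurableT_comp mf).
  by apply: (measurable_process F_filt X_markov); rewrite mulr_ge0.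
have LD : L1 P (fun w => `|scheme_sum h tau s k x w - grid_sum X mu f x s tau k w|).
  by apply: L1_le mD LZ _ => w; rewrite normr_id.
split=> //; rewrite (le_trans (ER_le LD LZ bd))// (ERZ _ LS) ER_sum; last by move=> i; exact: (hZ i).1.
have hS : \sum_(i < k) \int[P]_w Z i w <= k%:R * (C * (h `^ alpha1 + tau `^ alpha2) `^ gamma).
  rewrite [leRHS](_ : _ = \sum_(i < k) (C * (h `^ alpha1 + tau `^ alpha2) `^ gamma)).
    by apply: ler_sum => i _; exact: (hZ i).2.
  by rewrite sumr_const card_ord -[RHS]mulr_natl.
rewrite (le_trans (ler_wpM2l (mulr_ge0 sW tauW) hS))//.
have hp : (h `^ alpha1 + tau `^ alpha2) `^ gamma <= 2 `^ gamma * tau `^ (alpha2 * gamma).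
  rewrite powRrM -(powRM _ (ler0n _ 2) (powR_ge0 _ _)); apply: powR_mono; first exact: ltW.
    by rewrite addr_ge0 ?powR_ge0.
  by rewrite mulr_natl mulr2n lerD2r.
have -> : s * tau * (k%:R * (C * (h `^ alpha1 + tau `^ alpha2) `^ gamma)) =
    (s ^+ 2 * tau * k%:R) * (C * (h `^ alpha1 + tau `^ alpha2) `^ gamma) / s.
  by field; rewrite gt_eqF.
rewrite sk mul1r ler_pdivrMr// -!mulrA ler_wpM2l// (le_trans hp)//.
by rewrite ler_wpM2l// powR_ge0.
Qed.

Lemma scheme_sum_transfer x (psi psi1 psi2 : R -> R) (c : R) :
  smooth_test psi psi1 psi2 c -> exists2 C, 0 <= C & forall de h s tau k,
  small_grid taut (alpha2 * gamma) de s tau k -> 0 <= h <= ht -> h `^ alpha1 <= tau `^ alpha2 ->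
  `|\int[P]_w psi (scheme_sum h tau s k x w) -
    \int[P]_w psi (grid_sum X mu f x s tau k w)| <= C * de.
Proof.
move=> psiP; have [C C0 hC] := scheme_sum_error x.
have c0 : 0 <= c by exact: le_trans (test_bound psiP 0).
exists (c * C); first exact: mulr_ge0.
move=> de h s tau k sg hh hal; have [L1d I1d] := hC de h s tau k sg hh hal.
have [_ tT _ _ _] := sg.
have mS := measurable_scheme_sum s k x hh tT.
have mW : measurable_fun setT (grid_sum X mu f x s tau k).
  apply: measurable_partial_sum => i; apply: measurable_funB; last exact: measurable_cst.
  apply: (measurableT_comp mf).
  apply: (measurable_process F_filt X_markov); rewrite mulr_ge0//.
  by case/andP: tT => /ltW.
have Lpsi (V : Omega -> R) : measurable_fun setT V -> L1 P (fun w => psi (V w)).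
  move=> mV; apply: (@L1_bounded _ _ _ _ _ c); last by move=> w; exact: (test_bound psiP).
  exact: (measurableT_comp (continuous_measurable_fun (test_cont psiP)) mV).
rewrite -(ERB (Lpsi _ mS) (Lpsi _ mW)).
apply: le_trans (ER_abs (L1B (Lpsi _ mS) (Lpsi _ mW)) (L1Z c L1d) _) _.
  by move=> w; exact: (test_lip psiP).
by rewrite (ERZ c L1d) -mulrA ler_wpM2l.
Qed.

End scheme_sums.

Lemma space_step_eventually (R : realType) (full : bool) (alpha1 alpha2 ht : R) :
  0 < alpha1 -> 0 < alpha2 -> 0 <= ht -> (full -> 0 < ht) ->
  \forall tau \near (0 : R)^'+, 0 <= space_step full alpha1 alpha2 tau <= ht /\
    space_step full alpha1 alpha2 tau `^ alpha1 <= tau `^ alpha2.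
Proof.
move=> a1 a2 ht0; rewrite /space_step; case: full => [/(_ isT) ht_gt0|_]; last first.
  by near=> tau; rewrite lexx ht0 powR0 ?gt_eqF// powR_ge0.
near=> tau; rewrite powR_ge0/= -powRrM divfK ?gt_eqF//; split=> //.
by near: tau; apply: powR_eventually_le => //; rewrite divr_gt0.
Unshelve. all: by end_near. Qed.

Theorem theorem3p2 (R : realType) (E : completeNormedModType R)
    (E_sep : separable E)
    (d : measure_display) (Omega : measurableType d) (P : probability Omega R)
    (F : R -> set (set Omega)) (F_filt : filtration F)
    (X : E -> R -> Omega -> E)
    (X_markov : markov_family P `[0, +oo[ F setT X)
    (ht taut : R) (Eh : R -> set E) (xh : R -> E -> E)
    (Eh_spaces : state_spaces ht Eh xh)
    (Y : R -> R -> E -> nat -> Omega -> E)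
    (r rt gamma1 beta : R) (rho : R -> R)
    (A1 : ergodic_process P X r rt gamma1 beta rho)
    (q qt gamma2 kappa : R) (rhoD : R -> R -> R -> R)
    (A2 : ergodic_scheme P F Eh Y ht taut q qt gamma2 kappa rhoD)
    (alpha1 alpha2 : R) (alpha1_gt0 : 0 < alpha1) (alpha2_gt0 : 0 < alpha2)
    (A3 : strong_order P X xh Y ht taut rt qt alpha1 alpha2)
    (mu : probability (borelType E) R) (mu_inv : invariant_measure P X mu)
    (full : bool) (full_ht : full -> 0 < ht)
    (gamma lambda p : R)
    (gamma_range : Num.max gamma1 gamma2 <= gamma <= 1)
    (lambda_range : 0 < lambda < alpha2 * gamma)
    (p_ge1 : 1 <= p)
    (p_cond : qt ^+ 2 * Num.max 3 (lambda^-1 + 1) *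
        (p * Num.max qt rt + (3 + 4 * Num.max kappa beta) * gamma)
      <= Num.min q r)
    (rhoD_tail :
      tail_condition rhoD (space_step full alpha1 alpha2) gamma lambda)
    (f : E -> R) (f_C : space_C p gamma f) (x : E) :
  let h := space_step full alpha1 alpha2 in
  let k := num_steps lambda in
  let v2 := asymptotic_variance P X mu f in
  0 <= v2 /\
  cvg_in_distribution P
    (fun tau w => (Num.sqrt ((k tau)%:R * tau))^-1 *
       \sum_(0 <= i < k tau)
          (f (Y (h tau) tau (xh (h tau) x) i w) - mean mu f) * tau)
    (centered_gaussian v2).

Proof.
move=> h k v2.
have [gam1 gamle1] := andP gamma_range.
have g1g : gamma1 <= gamma by rewrite (le_trans _ gam1)// le_max lexx.
have [g10 _] := andP (ep_gamma1 A1).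
have gamma01 : 0 < gamma <= 1 by rewrite (lt_le_trans g10).
have p0 : 0 <= p by exact: le_trans p_ge1.
have a0 : 0 <= p / 2 by rewrite divr_ge0.
have [b0 _] := andP (ep_beta A1).
have g1range : 0 < gamma1 <= gamma by rewrite g10.
have [aq ar growth_r] := exponents_le p_ge1 (es_qt A2) (ep_rt A1) b0 g1range p_cond.
have [Cf Cf0 fh] := space_C_holder p0 f_C.
have fh1 := holder_weight_exponent Cf0 g1range fh.
have [taut0 _] := andP (es_taut A2).
have [l0 le] := andP lambda_range.
have eta0 : 0 < alpha2 * gamma by exact: lt_trans le.
clear p_cond rhoD_tail.
have cell := cell_regularity E_sep F_filt X_markov Eh_spaces A1 A2 alpha1_gt0 alpha2_gt0
  A3 a0 aq ar gamma01 Cf0 fh.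
pose D := mean mu (variance_density P X mu f).
have v2E : v2 = 2 * D.
  rewrite /v2 /asymptotic_variance; congr (2 * _); apply: eq_Rintegral => u _.
  by rewrite /variance_density poissonE.
pose s (tau : R) := (Num.sqrt ((k tau)%:R * tau))^-1.
have sge de : 0 < de -> \forall tau \near 0^'+, small_grid taut (alpha2 * gamma) de (s tau) tau (k tau).
  exact: small_grid_eventually.
have charfun := charfun_limit E_sep F_filt X_markov A1 mu_inv a0 Cf0 fh1 growth_r taut0 eta0 cell x.
(* At th = 1 and b = 0 the expectations of cosines, all at most 1, come arbitrarily close to
   exp(-D), so exp(-D) <= 1. *)
have D0 : 0 <= D.
  rewrite -oppr_le0 -ler_expR expR0; apply/ler_addgt0Pr => e e0.
  have [de de0 hde] := charfun 1 0 e e0.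
  have [tau sg] : exists tau, small_grid taut (alpha2 * gamma) de (s tau) tau (k tau).
    by have nh := sge de de0; exact: (@filter_ex _ _ (at_right_proper_filter (0 : R)) _ nh).
  have := hde _ _ _ sg; rewrite cos0 mul1r expr1n mul1r -/D distrC => hd.
  set I := \int[P]_w _ in hd.
  have I1 : I <= 1.
    have tau0 : 0 <= tau by case: sg => _ /andP[/ltW].
    have mW := measurable_grid_sum F_filt X_markov A1 mu a0 Cf0 fh1 x (s tau) (k tau) tau0.
    have cc : continuous (fun y : R => cos (1 * y + 0)) by exact: (test_cont (smooth_test_cos 1 0)).
    rewrite -(ER_cst P 1); apply: ER_le; [|exact: L1_cst|by move=> w; exact: cos_le1].
    apply: (@L1_bounded _ _ _ _ _ 1); first exact: (measurableT_comp (continuous_measurable_fun cc) mW).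
    by move=> w; rewrite ler_norml cos_geN1 cos_le1.
  by move: I1 (le_trans (ler_norm _) hd); clear; lra.
have v20 : 0 <= v2 by rewrite v2E mulr_ge0.
split; first exact: v20.
have [ht0 _] := andP (es_ht A2).
have h_small : \forall tau \near 0^'+, 0 <= h tau <= ht /\ h tau `^ alpha1 <= tau `^ alpha2.
  exact: space_step_eventually.
pose S tau := scheme_sum xh Y mu f (h tau) tau (s tau) (k tau) x.
have mS : \forall tau \near 0^'+, measurable_fun setT (S tau).
  near=> tau; have [hh _] : 0 <= h tau <= ht /\ h tau `^ alpha1 <= tau `^ alpha2 by near: tau.
  have tT : 0 < tau <= taut by have [] : small_grid taut (alpha2 * gamma) 1 (s tau) tau (k tau)
    by near: tau; exact: sge.
  exact: (measurable_scheme_sum F_filt Eh_spaces A2 mu a0 gamma01 fh).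
have transfer (psi psi1 psi2 : R -> R) (c e : R) : 0 < e -> smooth_test psi psi1 psi2 c ->
    \forall tau \near 0^'+,
      `|\int[P]_w psi (S tau w) - \int[P]_w psi (grid_sum X mu f x (s tau) tau (k tau) w)| <= e.
  move=> e0 psiP.
  have [C C0 hC] := scheme_sum_transfer E_sep F_filt X_markov Eh_spaces A1 A2 alpha1_gt0
    alpha2_gt0 A3 mu a0 aq ar gamma01 Cf0 fh x psiP.
  have C1 : 0 < C + 1 by rewrite ltr_wpDl.
  pose de := e / (C + 1); have de0 : 0 < de by exact: divr_gt0.
  have Cde : C * de <= e.
    rewrite /de mulrCA; apply: ler_piMr; first exact: ltW.
    by rewrite ler_pdivrMr// mul1r lerDl.
  near=> tau.
  have [hh ha] : 0 <= h tau <= ht /\ h tau `^ alpha1 <= tau `^ alpha2 by near: tau.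
  have sg : small_grid taut (alpha2 * gamma) de (s tau) tau (k tau) by near: tau; exact: sge.
  exact: le_trans (hC de _ _ _ _ sg hh ha) Cde.
move=> g cg gM.
apply: (@levy_continuity _ _ _ P _ _ S _ mS _ g _ cg gM).
- move=> th b; rewrite (centered_gaussian_cos th b v20).
  have -> : v2 / 2 = D by rewrite v2E mulrC mulKf.
  apply/cvgrPdist_le => e e0; have e2 : 0 < e / 2 by rewrite divr_gt0.
  have [de de0 hde] := charfun th b (e / 2) e2.
  have T := smooth_test_cos th b.
  near=> tau.
  have sg : small_grid taut (alpha2 * gamma) de (s tau) tau (k tau) by near: tau; exact: sge.
  have h1 := hde _ _ _ sg.
  have h2 : `|\int[P]_w cos (th * S tau w + b) -
      \int[P]_w cos (th * grid_sum X mu f x (s tau) tau (k tau) w + b)| <= e / 2.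
    by near: tau; exact: transfer e2 T.
  rewrite distrC -(subrKA (\int[P]_w cos (th * grid_sum X mu f x (s tau) tau (k tau) w + b))).
  by apply: le_trans (ler_normD _ _) _; rewrite [leRHS]splitr; exact: lerD.
- move=> e e0; have e2 : 0 < e / 2 by rewrite divr_gt0.
  have [L0 L01 hL0] := tail_limit E_sep F_filt X_markov A1 mu_inv a0 Cf0 fh1 growth_r
    taut0 eta0 cell x e2.
  have large : \forall n \near \oo, L0 <= n.+1%:R :> R.
    apply: filterS (nbhs_infty_ger L0) => n h0.
    by apply: le_trans h0 _; rewrite ler_nat; exact: leqnSn.
  (* One level n + 1 serves both laws: it exceeds the threshold for the sums and makes the tail of
     the Gaussian at most e. *)
  have [n [nL nt]] := filter_ex (filterI large (tail_fun_tight (centered_gaussian v2) e0)).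
  have [de de0 hde] := hL0 _ nL.
  exists n.+1%:R; split; [exact: ltr0Sn|exact: nt|].
  have n1 : 1 <= n.+1%:R :> R by rewrite ler1n.
  have [psi1 [psi2 [T _]]] := smooth_test_tail_fun n1.
  near=> tau.
  have sg : small_grid taut (alpha2 * gamma) de (s tau) tau (k tau) by near: tau; exact: sge.
  have h1 := hde _ _ _ sg.
  have h2 : `|\int[P]_w tail_fun n.+1%:R (S tau w) -
      \int[P]_w tail_fun n.+1%:R (grid_sum X mu f x (s tau) tau (k tau) w)| <= e / 2.
    by near: tau; exact: transfer e2 T.
  by move: h1 (le_trans (ler_norm _) h2); clear; lra.
Unshelve. all: by end_near. Qed.
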